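(* Let $F$, $L$, $G_2$, $P$, $K^H$, $\Gamma(\mathfrak P^r)$ be as in the context. Let $(\tau,V_\tau)$ be a generic irreducible admissible representation of $\mathrm{GL}_2(F)$ with central character $\omega_\tau$ and conductor $\mathfrak p^n$. Let $\chi_0$ be a character of $L^\times$ with $\chi_0|_{F^\times}=\omega_\tau$ and $\chi_0((1+\mathfrak P^n)\cap\mathfrak o_L^\times)=1$, let $\Lambda$ be an unramified character of $L^\times$, and let $\chi(\zeta)=\Lambda(\bar\zeta)^{-1}\chi_0(\bar\zeta)^{-1}$. For $s\in\mathbb{C}$ and an integer $r\ge0$ let $V(r)=\{\phi\in I(s,\chi,\chi_0,\tau):\phi(g\gamma)=\phi(g)\text{ for all }g\in G_2(F),\ \gamma\in K^H\Gamma(\mathfrak P^r)\}$. Then $\dim V(r)=\frac{(r-n+1)(r-n+2)}2$ if $r\ge n$, and $\dim V(r)=0$ if $r<n$.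
   Context: $F$ is a non-archimedean local field of characteristic zero, ring of integers $\mathfrak o$, maximal ideal $\mathfrak p$. $L$ is a quadratic extension field of $F$ or $L=F\oplus F$ (conjugation $\overline{(x,y)}=(y,x)$), $\mathfrak o_L$ its ring of integers, $\mathfrak P=\mathfrak p\mathfrak o_L$, $N(x)=x\bar x$. $G_2(F)=\{g\in\mathrm{GL}_4(L):{}^t\bar gJg=\mu(g)J,\mu(g)\in F^\times\}$ with $J=\begin{bmatrix}0&1_2\\-1_2&0\end{bmatrix}$, $G_1(F)=\{g\in\mathrm{GL}_2(L):{}^t\bar g\begin{bmatrix}0&1\\-1&0\end{bmatrix}g=\mu_1(g)\begin{bmatrix}0&1\\-1&0\end{bmatrix},\mu_1(g)\in F^\times\}=L^\times\mathrm{GL}_2(F)$. $K^H=\mathrm{GSp}_4(\mathfrak o)$, $\Gamma(\mathfrak P^r)=\{g\in G_2(F)\cap\mathrm{GL}_4(\mathfrak o_L):g\equiv1\bmod\mathfrak P^r\}$ ($=G_2(F)\cap\mathrm{GL}_4(\mathfrak o_L)$ for $r=0$). $m_1(\zeta)=\mathrm{diag}(\zeta,1,\bar\zeta^{-1},1)$, $m_2(\begin{bmatrix}a&b\\c&d\end{bmatrix})=\begin{bmatrix}1&&&\\&a&&b\\&&\bar ad-b\bar c&\\&c&&d\end{bmatrix}$, $N(F)=\{\begin{bmatrix}1&z&&\\&1&&\\&&1&\\&&-\bar z&1\end{bmatrix}\begin{bmatrix}1&&x&y\\&1&\bar y&\\&&1&\\&&&1\end{bmatrix}\}$, $P=m_1(L^\times)m_2(G_1)N$.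 $\chi_0\times\tau$ is the representation of $G_1(F)$ on $V_\tau$ given by $(\chi_0\times\tau)(\lambda g)=\chi_0(\lambda)\tau(g)$ for $\lambda\in L^\times$, $g\in\mathrm{GL}_2(F)$. $I(s,\chi,\chi_0,\tau)$ is the space of smooth functions $f:G_2(F)\to V_\tau$ with $f(m_1(\zeta)m_2(b)ng)=|N(\zeta)\mu_1(b)^{-1}|^{3(s+1/2)}\chi(\zeta)(\chi_0\times\tau)(b)f(g)$ for $\zeta\in L^\times$, $b\in G_1(F)$, $n\in N(F)$, $|\cdot|$ the normalized absolute value of $F$. The conductor $\mathfrak p^n$ of $\tau$ is given by the least $n$ such that $\tau$ has a nonzero vector fixed by $\mathrm{GL}_2(\mathfrak o)\cap\begin{bmatrix}1+\mathfrak p^n&\mathfrak o\\\mathfrak p^n&\mathfrak o\end{bmatrix}$. *)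

(* Defs.v *)
From HB Require Import structures.
From mathcomp Require Import all_boot all_order all_algebra.
From mathcomp Require Import all_classical all_reals all_analysis.
From mathcomp Require Import complex.

Set Implicit Arguments.
Unset Strict Implicit.
Unset Printing Implicit Defensive.

Import Order.TTheory GRing.Theory Num.Theory.

Local Open Scope classical_set_scope.
Local Open Scope ring_scope.

Section Dimension.
Variables (K : fieldType) (W : lmodType K).

(* [S] is a linear subspace of [W] (possibly of infinite-dimensional [W])
   having a basis of [d] elements. *)
Definition has_dim (S : set W) (d : nat) : Prop :=
  exists e : 'I_d -> W,
    (forall c : 'I_d -> K, \sum_i c i *: e i = 0 -> forall i, c i = 0) /\
    (forall w, S w <-> exists c : 'I_d -> K, w = \sum_i c i *: e i).

End Dimension.

(* A non-archimedean local field is a field complete for a normalized discrete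
   valuation with finite residue field. Only the values of [val] at nonzero
   elements are meaningful. *)
Record local_field (F : fieldType) := LocalField {
  val_lf : F -> int;
  val_lfM : forall x y, x != 0 -> y != 0 ->
    val_lf (x * y) = val_lf x + val_lf y;
  val_lfD : forall x y, x != 0 -> y != 0 -> x + y != 0 ->
    Num.min (val_lf x) (val_lf y) <= val_lf (x + y);
  uniformizer_lf : exists2 pi, pi != 0 & val_lf pi = 1;
  complete_lf : forall u : nat -> F,
    (forall k : nat, exists M : nat, forall i j : nat,
       (M <= i)%N -> (M <= j)%N -> u i - u j = 0 \/ k%:Z <= val_lf (u i - u j)) ->
    exists l : F, forall k : nat, exists M : nat, forall i : nat,
       (M <= i)%N -> u i - l = 0 \/ k%:Z <= val_lf (u i - l);
  (* a complete irredundant list of representatives of o / p *)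
  residues_lf : seq F;
  residues_lf_int : forall x, x \in residues_lf -> x = 0 \/ 0 <= val_lf x;
  residues_lf_complete : forall x, x = 0 \/ 0 <= val_lf x ->
    exists2 y, y \in residues_lf & x - y = 0 \/ 1 <= val_lf (x - y);
  residues_lf_uniq : uniq residues_lf;
  residues_lf_irredundant : forall x y,
    x \in residues_lf -> y \in residues_lf ->
    x - y = 0 \/ 1 <= val_lf (x - y) -> x = y
}.

(* GL_n of the subring [D] of [A]. *)
Definition GLin (A : comUnitRingType) (n : nat) (D : set A) : set 'M[A]_n :=
  [set g | [/\ g \in unitmx, forall i j, D (g i j) & forall i j, D (invmx g i j)]].

Section LocalField.
Variables (F : fieldType) (v : local_field F).

(* p ^ k, so that [ppow 0] is the ring of integers o *)
Definition ppow (k : nat) : set F := [set x | x = 0 \/ k%:Z <= val_lf v x].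

Definition abs_lf (R : realType) (x : F) : R :=
  if x == 0 then 0 else (size (residues_lf v))%:R ^ (- val_lf v x).

Definition GL2_cong (k : nat) : set 'M[F]_2 :=
  [set g | GLin (ppow 0) g /\ forall i j, ppow k ((g - 1%:M) i j)].

Definition open_subgroup (H : set 'M[F]_2) : Prop :=
  [/\ H `<=` [set g | g \in unitmx],
      H 1%:M,
      (forall g h, H g -> H h -> H (g *m h)),
      (forall g, H g -> H (invmx g)) &
      exists k, GL2_cong k `<=` H].

Section Representation.
Variables (C : fieldType) (V : lmodType C).
(* Only the operators attached to invertible matrices are meaningful. *)
Variable tau : 'M[F]_2 -> {linear V -> V}.

Definition fixed_by (H : set 'M[F]_2) : set V :=
  [set w | forall g, H g -> tau g w = w].

Definition is_rep : Prop :=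
  (forall w, tau 1%:M w = w) /\
  (forall g h w, g \in unitmx -> h \in unitmx ->
     tau (g *m h) w = tau g (tau h w)).

Definition admissible : Prop :=
  (forall w, exists k, fixed_by (GL2_cong k) w) /\
  (forall H, open_subgroup H -> exists d, has_dim (fixed_by H) d).

Definition irreducible_rep : Prop :=
  (exists w : V, w != 0) /\
  forall S : set V,
    S 0 -> (forall (a : C) u w, S u -> S w -> S (a *: u + w)) ->
    (forall g w, g \in unitmx -> S w -> S (tau g w)) ->
    (forall w, S w -> w = 0) \/ (forall w, S w).

Definition additive_character (psi : F -> C) : Prop :=
  [/\ forall x, psi x != 0,
      forall x y, psi (x + y) = psi x * psi y &
      exists k, forall x, ppow k x -> psi x = 1].

Definition unip2 (x : F) : 'M[F]_2 :=
  \matrix_(i, j) nth 0 (nth [::] [:: [:: 1; x]; [:: 0; 1]] i) j.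

(* existence of a nonzero Whittaker functional *)
Definition generic : Prop :=
  exists psi : F -> C, [/\ additive_character psi, exists x, psi x != 1 &
    exists l : {linear V -> C^o},
      (exists w, l w != 0) /\
      (forall x w, l (tau (unip2 x) w) = psi x * l w)].

Definition central_character (omega : F -> C) : Prop :=
  forall z w, z != 0 -> tau z%:M w = omega z *: w.

(* GL_2(o) intersected with [1 + p^n, o; p^n, o] *)
Definition K1 (n : nat) : set 'M[F]_2 :=
  [set g | [/\ GLin (ppow 0) g, ppow n (g 0 0 - 1) & ppow n (g 1 0)]].

Definition has_conductor (n : nat) : Prop :=
  (exists2 w, w != 0 & fixed_by (K1 n) w) /\
  (forall m, (exists2 w, w != 0 & fixed_by (K1 m) w) -> (n <= m)%N).

End Representation.

Section QuadraticAlgebra.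
Variables (L : comUnitAlgType F) (conj : {lrmorphism L -> L}).

Definition quadratic_field : Prop :=
  [/\ forall x : L, x != 0 -> x \is a GRing.unit,
      has_dim [set: L] 2 &
      exists x, conj x != x].

Definition split_quadratic : Prop :=
  exists2 phi : {lrmorphism L -> (F^o * F^o)%type}, bijective phi &
    forall x, phi (conj x) = ((phi x).2, (phi x).1).

Definition quadratic_algebra : Prop := quadratic_field \/ split_quadratic.

(* The norm as an element of F, defined by N(x) = x * conj x; the default 0 is
   never used for a quadratic algebra. *)
Definition normL (x : L) : F := xget 0 [set a : F | a%:A = x * conj x].

(* the ring of integers of L, i.e. the integral closure of o in L (which is
   o + o when L is split) *)
Definition oL : set L :=
  [set x | exists p : {poly F},
     [/\ p \is monic, forall i, ppow 0 p`_i & horner_alg x p = 0]].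

(* (p o_L) ^ k = p ^ k o_L; as p is principal, products a *: y already form
   this ideal *)
Definition PLpow (k : nat) : set L :=
  [set x | exists a y, [/\ ppow k a, oL y & x = a *: y]].

Definition oL_unit : set L :=
  [set x | [/\ x \is a GRing.unit, oL x & oL x^-1]].

Definition oL_unit_cong (k : nat) : set L :=
  [set x | oL_unit x /\ PLpow k (x - 1)].

(* Only the values of a character at units of L are meaningful. *)
Definition is_character (C : fieldType) (chi : L -> C) : Prop :=
  [/\ forall x, x \is a GRing.unit -> chi x != 0,
      forall x y, x \is a GRing.unit -> y \is a GRing.unit ->
        chi (x * y) = chi x * chi y &
      exists k, forall x, oL_unit_cong k x -> chi x = 1].

Definition unramified_character (C : fieldType) (chi : L -> C) : Prop :=
  is_character chi /\ forall x, oL_unit x -> chi x = 1.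

Definition mat4 (A : pzRingType) (s : seq (seq A)) : 'M[A]_4 :=
  \matrix_(i, j) nth 0 (nth [::] s i) j.

Definition mat2 (A : pzRingType) (a b c d : A) : 'M[A]_2 :=
  \matrix_(i, j) nth 0 (nth [::] [:: [:: a; b]; [:: c; d]] i) j.

Definition J4 (A : pzRingType) : 'M[A]_4 :=
  mat4 [:: [:: 0; 0; 1; 0]; [:: 0; 0; 0; 1]; [:: -1; 0; 0; 0]; [:: 0; -1; 0; 0]].

Definition J2 (A : pzRingType) : 'M[A]_2 := mat2 0 1 (-1) 0.

Definition conjT m (g : 'M[L]_m) : 'M[L]_m := (map_mx conj g)^T.

Definition similitude_group m (J : 'M[L]_m) : set 'M[L]_m :=
  [set g | g \in unitmx /\
     exists2 mu : F, mu != 0 & conjT g *m J *m g = mu%:A *: J].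

Definition multiplier m (J : 'M[L]_m) (g : 'M[L]_m) : F :=
  xget 0 [set mu : F | conjT g *m J *m g = mu%:A *: J].

Definition G1 : set 'M[L]_2 := similitude_group (J2 L).
Definition mu1 (b : 'M[L]_2) : F := multiplier (J2 L) b.

Definition G2 : Type := {g : 'M[L]_4 | similitude_group (J4 L) g}.

Definition Gamma (r : nat) : set 'M[L]_4 :=
  [set g | [/\ similitude_group (J4 L) g, GLin oL g &
     forall i j, PLpow r ((g - 1%:M) i j)]].

Definition embed m (g : 'M[F]_m) : 'M[L]_m := map_mx (in_alg L) g.

(* the image of GSp_4(o) in GL_4(L) *)
Definition KH : set 'M[L]_4 :=
  [set g | exists h : 'M[F]_4, [/\ g = embed h, GLin (ppow 0) h &
     exists2 mu : F, mu != 0 & h^T *m J4 F *m h = mu *: J4 F]].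

Definition m1 (z : L) : 'M[L]_4 :=
  mat4 [:: [:: z; 0; 0; 0]; [:: 0; 1; 0; 0];
           [:: 0; 0; (conj z)^-1; 0]; [:: 0; 0; 0; 1]].

Definition m2 (g : 'M[L]_2) : 'M[L]_4 :=
  let a := g 0 0 in let b := g 0 1 in let c := g 1 0 in let d := g 1 1 in
  mat4 [:: [:: 1; 0; 0; 0]; [:: 0; a; 0; b];
           [:: 0; 0; conj a * d - b * conj c; 0]; [:: 0; c; 0; d]].

(* x runs over F, y and z over L *)
Definition NF : set 'M[L]_4 :=
  [set u | exists (x : F) (y z : L),
     u = mat4 [:: [:: 1; z; 0; 0]; [:: 0; 1; 0; 0];
                  [:: 0; 0; 1; 0]; [:: 0; 0; - conj z; 1]] *m
         mat4 [:: [:: 1; 0; x%:A; y]; [:: 0; 1; conj y; 0];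
                  [:: 0; 0; 1; 0]; [:: 0; 0; 0; 1]]].

(* a ^ z = exp (z * ln a) for a > 0 *)
Definition cpow (R : realType) (a : R) (z : R[i]) : R[i] :=
  let t := complex.Im z * ln a in
  ((expR (complex.Re z * ln a) * cos t) +i* (expR (complex.Re z * ln a) * sin t))%C.

Section Induced.
Variables (R : realType) (V : lmodType R[i]).
Variables (s : R[i]) (chi chi0 : L -> R[i]) (tau : 'M[F]_2 -> {linear V -> V}).

(* The operator (chi0 x tau)(b), for b = l * g with l a unit of L and g in
   GL_2(F). It does not depend on the decomposition when chi0 extends the
   central character of tau. *)
Definition chi0tau (b : 'M[L]_2) (w : V) : V :=
  xget 0 [set w' | exists (l : L) (g : 'M[F]_2),
    [/\ l \is a GRing.unit, g \in unitmx, b = l *: embed g &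
        w' = chi0 l *: tau g w]].

(* smooth = locally constant, the Gamma k being a basis of neighbourhoods
   of 1 *)
Definition smooth_fun (f : G2 -> V) : Prop :=
  forall g : G2, exists k, forall g' : G2,
    (exists2 u, Gamma k u & sval g' = sval g *m u) -> f g' = f g.

Definition induced : set (G2 -> V) :=
  [set f | smooth_fun f /\
    forall (z : L) (b : 'M[L]_2) (u : 'M[L]_4) (g g' : G2),
      z \is a GRing.unit -> G1 b -> NF u ->
      sval g' = m1 z *m m2 b *m u *m sval g ->
      f g' = (cpow (abs_lf R (normL z * (mu1 b)^-1)) (3 * (s + 2^-1)) * chi z)
             *: chi0tau b (f g)].

Definition invariants (r : nat) : set (G2 -> V) :=
  [set f | induced f /\
    forall (g g' : G2) (k u : 'M[L]_4),
      KH k -> Gamma r u -> sval g' = sval g *m (k *m u) -> f g' = f g].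

End Induced.
End QuadraticAlgebra.
End LocalField.

(* Main.v *)
Require Import Defs.
From HB Require Import structures.
From mathcomp Require Import all_boot all_order all_algebra.
From mathcomp Require Import all_classical all_reals all_analysis.
From mathcomp Require Import complex.
From mathcomp Require Import zify ring.
Import Order.TTheory GRing.Theory Num.Theory.
Local Open Scope ring_scope.

Set Implicit Arguments.
Unset Strict Implicit.
Unset Printing Implicit Defensive.

(* A function in V(r) is determined by its values on representatives of P \ G_2 / K^H Gamma(P^r).
   The cosets P g correspond to the lines spanned by the third row of g. Write o_L = o + o al and
   this row as x + y al: the vectors x, y over F are orthogonal for the symplectic form, so that
   Sp_4(o) moves the row to (0, 0, w1, w2). The lattice o w1 + o w2 is homothetic to o + p^m al
   for a unique m, or to o; modulo P^r this leaves r + 1 double cosets, with representatives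
   eta_m, 0 <= m <= r. The stabilizer of eta_m acts on V_tau through K1(p^(r - m)), hence
   dim V(r) is the sum of the dimensions of V_tau^K1(p^k) for 0 <= k <= r.

   These dimensions are k - n + 1 for k >= n and 0 for k < n, by the theory of newforms. Let w be
   a newform and delta = diag(1, pi). The delta^i w are linearly independent, since a vector fixed
   by all upper unipotents vanishes. They span, since a finite Fourier transform embeds
   V_tau^K1(p^k) / delta V_tau^K1(p^(k - 1)) into a space of vectors on which a congruence subgroup
   acts by a character; this space has dimension at most 1 by Gelfand's trick. *)

(** The choice of chi is matched to the stabilizers: on that of eta_m, an element with Levi part
    m_1(zeta) m_2(l g) acts on V_tau by chi_0(l / conj zeta) tau(g), with l / conj zeta in 1 + P^(r
    - m). If r - m >= n this scalar is 1 by the condition on chi_0; if r - m < n, the space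
    V_tau^K1(p^(r - m)) is zero and no compatibility is required.

    Neither Haar measure nor a Kirillov model is used. Integrals over compact groups become finite
    averages over representatives modulo a level that fixes the vector, and independence of the
    level has to be proved. Genericity enters in two places: it rules out nonzero vectors fixed by
    all upper unipotents, and it supplies additive characters of prescribed conductor.

    L may be split and the residue characteristic may be 2. Hence o_L is described by a basis 1, al
    with trace t and norm nu rather than by a square root, and where a field would have no zero
    divisors the argument uses that an element of trace 0 and norm 0 vanishes. *)

(** * Valuations, units and residues *)

Section Valuation.
Variables (F : fieldType) (v : local_field F).
Local Notation val := (val_lf v).

(* As for [val_lf], the junk value at 0 is discarded: 0 lies in every p ^ k. *)
Definition ival (k : int) (x : F) : bool := (x == 0) || (k <= val x).

Lemma ppowP k x : ppow v k x <-> ival k%:Z x.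
Proof.
rewrite /ppow /ival /=; split; first by case=> [->|->]; rewrite ?eqxx ?orbT.
by case/orP=> [/eqP|]; [left|right].
Qed.

Lemma ival0 k : ival k 0. Proof. by rewrite /ival eqxx. Qed.

Lemma val1 : val 1 = 0.
Proof.
have := val_lfM v (oner_neq0 F) (oner_neq0 F); rewrite mulr1 => h; apply: (addIr (val 1)); rewrite add0r; exact: esym h.
Qed.

Lemma valN1 : val (-1) = 0.
Proof.
have h1 : (-1 : F) != 0 by rewrite oppr_eq0 oner_neq0.
have := val_lfM v h1 h1; by rewrite mulrNN mulr1 val1; case: (val (-1)) => // n; rewrite ?NegzE; lia.
Qed.

Lemma valN x : val (- x) = val x.
Proof.
have [->|x0] := eqVneq x 0; first by rewrite oppr0.
by rewrite -mulN1r val_lfM ?oppr_eq0 ?oner_neq0 // valN1 add0r.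
Qed.

Lemma valV x : x != 0 -> val x^-1 = - val x.
Proof.
move=> x0; have xV0 : x^-1 != 0 by rewrite invr_eq0.
by have := val_lfM v x0 xV0; rewrite mulfV // val1; lia.
Qed.

Lemma valX x n : x != 0 -> val (x ^+ n) = val x *+ n.
Proof.
move=> x0; elim: n => [|n IH]; first by rewrite expr0 val1.
by rewrite exprS val_lfM ?expf_neq0 // IH mulrS.
Qed.

Lemma ival_val k x : x != 0 -> ival k x = (k <= val x).
Proof. by move=> x0; rewrite /ival (negbTE x0). Qed.

Lemma ival1 : ival 0 1.
Proof. by rewrite ival_val ?oner_neq0 // val1. Qed.

Lemma ivalN k x : ival k (- x) = ival k x.
Proof. by rewrite /ival oppr_eq0 valN. Qed.

Lemma ivalD k x y : ival k x -> ival k y -> ival k (x + y).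
Proof.
have [->|x0] := eqVneq x 0; first by rewrite add0r.
have [->|y0] := eqVneq y 0; first by rewrite addr0.
have [->|xy0] := eqVneq (x + y) 0; first by rewrite ival0.
rewrite !ival_val // => hx hy; apply: le_trans (val_lfD v x0 y0 xy0).
by rewrite le_min hx.
Qed.

Lemma ivalB k x y : ival k x -> ival k y -> ival k (x - y).
Proof. by move=> hx hy; rewrite ivalD ?ivalN. Qed.

Lemma ivalBC k x y : ival k (x - y) = ival k (y - x).
Proof. by rewrite -ivalN opprB. Qed.

Lemma ivalM k l x y : ival k x -> ival l y -> ival (k + l) (x * y).
Proof.
have [->|x0] := eqVneq x 0; first by rewrite mul0r !ival0.
have [->|y0] := eqVneq y 0; first by rewrite mulr0 !ival0.
rewrite !ival_val ?mulf_neq0 // val_lfM //; lia.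
Qed.

Lemma ivalW l k x : k <= l -> ival l x -> ival k x.
Proof. by rewrite /ival => kl /orP[->//|h]; rewrite (le_trans kl h) orbT. Qed.

Lemma ivalMo k x y : ival k x -> ival 0 y -> ival k (x * y).
Proof. by move=> hx hy; rewrite -[k]addr0 ivalM. Qed.

Lemma ivaloM k x y : ival 0 x -> ival k y -> ival k (x * y).
Proof. by move=> hx hy; rewrite -[k]add0r ivalM. Qed.

Lemma ivalX x n : ival 0 x -> ival 0 (x ^+ n).
Proof.
by move=> hx; elim: n => [|n IH]; rewrite ?expr0 ?ival1 // exprS ivalMo.
Qed.

Lemma ival_sum k (I : Type) (s : seq I) (P : pred I) (f : I -> F) :
  (forall i, P i -> ival k (f i)) -> ival k (\sum_(i <- s | P i) f i).
Proof.
by move=> h; elim/big_ind: _ => //; [exact: ival0|exact: ivalD].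
Qed.

Lemma ival_nat n : ival 0 n%:R.
Proof.
elim: n => [|n IH]; first exact: ival0.
by rewrite -natr1 ivalD ?ival1.
Qed.

Lemma ival_bound x : exists c : nat, forall c', (c <= c')%N -> ival (- c'%:Z) x.
Proof.
have [->|x0] := eqVneq x 0; first by exists 0%N => c' _; rewrite ival0.
by exists `|val x|%N => c' h; rewrite ival_val //; lia.
Qed.

Definition vunit (x : F) : bool := (x != 0) && (val x == 0).

Lemma vunit1 : vunit 1. Proof. by rewrite /vunit oner_neq0 val1. Qed.

Lemma vunit_neq0 x : vunit x -> x != 0. Proof. by case/andP. Qed.

Lemma vunit_ival x : vunit x -> ival 0 x.
Proof. by case/andP=> x0 /eqP h; rewrite ival_val // h. Qed.

Lemma vunitV x : vunit x -> vunit x^-1.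
Proof. by case/andP=> x0 /eqP h; rewrite /vunit invr_eq0 x0 valV // h. Qed.

Lemma vunitM x y : vunit x -> vunit y -> vunit (x * y).
Proof.
case/andP=> x0 /eqP hx /andP[y0 /eqP hy].
by rewrite /vunit mulf_neq0 // val_lfM // hx hy.
Qed.

Lemma vunitN x : vunit x -> vunit (- x).
Proof. by rewrite /vunit oppr_eq0 valN. Qed.

Lemma vunitP x : ival 0 x -> ival 0 x^-1 -> x != 0 -> vunit x.
Proof. by move=> hx hV x0; move: hx hV; rewrite /vunit x0 !ival_val ?invr_eq0 // valV //=; lia. Qed.

Lemma vunit_mulr1 x y : ival 0 x -> ival 0 y -> x * y = 1 -> vunit x.
Proof.
move=> hx hy xy; have x0 : x != 0 by apply: contra_eq_neq xy => ->; rewrite mul0r eq_sym oner_neq0.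
by apply: vunitP => //; rewrite -[x^-1]mulr1 -xy mulKf.
Qed.

Lemma nvunit x : ival 0 x -> ~~ vunit x -> ival 1 x.
Proof. by rewrite /vunit /ival; case: (eqVneq x 0) => //= x0; lia. Qed.

Lemma ivalMu k x y : vunit y -> ival k (x * y) = ival k x.
Proof.
move=> hy; apply/idP/idP => h; last by rewrite ivalMo ?vunit_ival.
by rewrite -[x](mulfK (vunit_neq0 hy)) ivalMo ?vunit_ival ?vunitV.
Qed.

Lemma ivalVM k x y : y != 0 -> ival k (x / y) = ival (k + val y) x.
Proof.
move=> y0; have [->|x0] := eqVneq x 0; first by rewrite mul0r !ival0.
by rewrite !ival_val ?mulf_neq0 ?invr_eq0 // val_lfM ?invr_eq0 // valV //; lia.
Qed.

Lemma ival1N x : ival 1 x -> ~~ vunit x.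
Proof. by rewrite /vunit /ival; case: (eqVneq x 0) => //= x0; lia. Qed.

Lemma vunitD x y : vunit x -> ival 1 y -> vunit (x + y).
Proof.
move=> hx hy; apply: contraT => h.
have := ivalB (nvunit (ivalD (vunit_ival hx) (ivalW (ler01) hy)) h) hy.
by rewrite addrK => /ival1N; rewrite hx.
Qed.

Lemma vunit_cong1 k x : 0 < k -> ival k (x - 1) -> vunit x.
Proof.
move=> k0 h; rewrite -[x](subrK 1) addrC; apply: vunitD vunit1 _.
by apply: ivalW h; lia.
Qed.

Lemma cong1_o (k : nat) x : ival k (x - 1) -> ival 0 x.
Proof. by move=> h; rewrite -[x](subrK 1); apply: ivalD ival1; exact: ivalW h. Qed.

Definition unif : F := s2val (cid2 (uniformizer_lf v)).

Lemma unif_neq0 : unif != 0.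
Proof. exact: s2valP (cid2 (uniformizer_lf v)). Qed.

Lemma val_unif : val unif = 1.
Proof. exact: s2valP' (cid2 (uniformizer_lf v)). Qed.

Definition upi (k : int) : F := unif ^ k.

Lemma upi_neq0 k : upi k != 0. Proof. exact/expfz_neq0/unif_neq0. Qed.

Lemma upiD k l : upi (k + l) = upi k * upi l.
Proof. by rewrite /upi expfzDr ?unif_neq0. Qed.

Lemma upi0 : upi 0 = 1. Proof. by rewrite /upi expr0z. Qed.

Lemma upiN k : upi (- k) = (upi k)^-1.
Proof. by apply: (mulIf (upi_neq0 k)); rewrite mulVf ?upi_neq0 // -upiD addNr upi0. Qed.

Lemma val_upi k : val (upi k) = k.
Proof.
have nn n : val (upi n%:Z) = n.
  by rewrite /upi -exprnP valX ?unif_neq0 // val_unif natz.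
by case: (intP k) => [|n|n]; rewrite ?upi0 ?val1 ?nn // upiN valV ?upi_neq0 // nn.
Qed.

Lemma ival_upiM k l x : ival k (upi l * x) = ival (k - l) x.
Proof.
by rewrite mulrC -[upi l]invrK -upiN ivalVM ?upi_neq0 // val_upi.
Qed.

Lemma ival_upi k : ival k (upi k).
Proof. by rewrite ival_val ?upi_neq0 // val_upi. Qed.

(** Truncated expansions in the uniformizer: representatives x modulo p^K and residues y give the
    representatives x + pi^K y modulo p^(K+1). *)
Lemma residue_transversal (K : nat) : exists s : seq F,
  [/\ uniq s, forall x, x \in s -> ival 0 x,
      forall x, ival 0 x -> exists2 y, y \in s & ival K (x - y) &
      forall x y, x \in s -> y \in s -> ival K (x - y) -> x = y].
Proof.
have vE k x : ival k x <-> x = 0 \/ k <= val x.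
  by rewrite /ival; split=> [/orP[/eqP|]|[->|->]]; rewrite ?eqxx ?orbT; [left|right| |].
elim: K => [|K [s [us so sc si]]].
  exists [:: 0]; split=> // [x|x hx|x y].
  - by rewrite inE => /eqP->; exact: ival0.
  - by exists 0; rewrite ?mem_head // subr0.
  - by rewrite !inE => /eqP-> /eqP->.
pose t := residues_lf v.
have inj x x' r r' : x \in s -> x' \in s -> r \in t -> r' \in t ->
    ival K.+1 ((x + upi K * r) - (x' + upi K * r')) -> x = x' /\ r = r'.
  move=> xs xs' rt rt' h.
  have [ro ro'] : ival 0 r /\ ival 0 r' by split; apply/vE/residues_lf_int.
  have e : (x + upi K * r) - (x' + upi K * r') = (x - x') + upi K * (r - r') by ring.
  have xx : x = x'.
    apply: si => //; rewrite -[x - x'](addrK (upi K * (r - r'))) -e.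
    apply: ivalB; first by apply: ivalW h; lia.
    by rewrite ival_upiM subrr ivalB.
  split=> //; apply: (@residues_lf_irredundant _ v) => //; apply/vE.
  by move: h; rewrite e xx subrr add0r ival_upiM; have -> : K.+1%:Z - K%:Z = 1 by lia.
exists [seq x + upi K * r | x <- s, r <- t]; split.
- apply: allpairs_uniq => //; first exact: residues_lf_uniq.
  move=> [x r] [x' r'] /allpairsP[[? ?] /= [xs rt [-> ->]]] /allpairsP[[? ?] /= [xs' rt' [-> ->]]] /= e.
  by have [|-> ->] := inj _ _ _ _ xs xs' rt rt' => //; rewrite e subrr ival0.
- move=> _ /allpairsP[[x r] /= [xs rt ->]]; apply: ivalD; first exact: so.
  rewrite ival_upiM; apply: (@ivalW 0); first by lia.
  exact/vE/residues_lf_int.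
- move=> x /sc[y ys h]; have e : x - y = upi K * ((x - y) / upi K).
    by rewrite mulrC divfK ?upi_neq0.
  have : ival 0 ((x - y) / upi K) by move: h; rewrite {1}e ival_upiM subrr.
  move=> /vE/(@residues_lf_complete _ v)[r rt /vE hr].
  exists (y + upi K * r); first by apply/allpairsP; exists (y, r).
  have -> : x - (y + upi K * r) = upi K * ((x - y) / upi K - r).
    by rewrite mulrBr -e; ring.
  by rewrite ival_upiM; have -> : K.+1%:Z - K%:Z = 1 by lia.
- move=> _ _ /allpairsP[[x r] /= [xs rt ->]] /allpairsP[[x' r'] /= [xs' rt' ->]] h.
  by have [-> ->] := inj _ _ _ _ xs xs' rt rt' h.
Qed.

Lemma ivalWn (k : nat) x : ival k x -> ival 0 x.
Proof. exact: ivalW. Qed.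

End Valuation.

Ltac ilia := repeat match goal with H : is_true (ival _ _ _) |- _ => clear H end; lia.

Ltac ord2 i j := case: i => [[|[|//]] ?]; case: j => [[|[|//]] ?].

(** * Matrices of size 2 *)

Section Mat2.
Variable K : fieldType.
Implicit Types a b c d x y : K.

Lemma mat2_eta (A : pzRingType) (g : 'M[A]_2) : g = mat2 (g 0 0) (g 0 1) (g 1 0) (g 1 1).
Proof.
apply/matrixP=> i j; rewrite mxE.
by ord2 i j; rewrite /=; congr (g _ _); apply/val_inj.
Qed.

Lemma mat2M (A : pzRingType) (a b c d a' b' c' d' : A) :
  mat2 a b c d *m mat2 a' b' c' d' =
  mat2 (a * a' + b * c') (a * b' + b * d') (c * a' + d * c') (c * b' + d * d').
Proof.
apply/matrixP=> i j; rewrite !mxE big_ord_recl big_ord1 !mxE.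
by ord2 i j.
Qed.

Lemma mat2_1 (A : pzRingType) : mat2 1 0 0 1 = 1%:M :> 'M[A]_2.
Proof.
apply/matrixP=> i j; rewrite !mxE.
by ord2 i j.
Qed.

Lemma mat2_inj (A : pzRingType) (a b c d a' b' c' d' : A) :
  mat2 a b c d = mat2 a' b' c' d' -> [/\ a = a', b = b', c = c' & d = d'].
Proof.
move=> /matrixP h; split; [have := h 0 0|have := h 0 1|have := h 1 0|have := h 1 1];
  by rewrite !mxE.
Qed.

Lemma det_mat2 (A : comPzRingType) (a b c d : A) : \det (mat2 a b c d) = a * d - b * c.
Proof.
rewrite (expand_det_row _ 0) big_ord_recl big_ord1 /cofactor !det_mx11 !mxE /=.
by rewrite expr0 expr1 mul1r mulN1r mulrN.
Qed.

Lemma unit_mat2 (A : comUnitRingType) (a b c d : A) :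
  (mat2 a b c d \in unitmx) = (a * d - b * c \is a GRing.unit).
Proof. by rewrite unitmxE det_mat2. Qed.

Definition up x := mat2 1 x 0 1.
Definition lo y := mat2 1 0 y 1.
Definition dg a d := mat2 a 0 0 d.

Lemma up_unit x : up x \in unitmx.
Proof. by rewrite unit_mat2 mulr0 mulr1 subr0 unitr1. Qed.

Lemma lo_unit x : lo x \in unitmx.
Proof. by rewrite unit_mat2 mul0r mulr1 subr0 unitr1. Qed.

Lemma dg_unit a d : a != 0 -> d != 0 -> dg a d \in unitmx.
Proof. by move=> a0 d0; rewrite unit_mat2 mulr0 subr0 unitfE mulf_neq0. Qed.

Lemma upD x y : up (x + y) = up x *m up y.
Proof. by rewrite mat2M; congr mat2; ring. Qed.

End Mat2.

Section GL2o.
Variables (F : fieldType) (v : local_field F).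
Local Notation ival := (ival v).
Local Notation vunit := (vunit v).

Lemma invmx_mat2 (a b c d : F) : a * d - b * c != 0 ->
  invmx (mat2 a b c d) = (a * d - b * c)^-1 *: mat2 d (- b) (- c) a.
Proof.
move=> D0; have u : mat2 a b c d \in unitmx by rewrite unit_mat2 unitfE.
apply: (can_inj (mulKmx u)); rewrite mulmxV // -scalemxAr mat2M -mat2_1.
apply/matrixP=> i j; rewrite !mxE.
ord2 i j; rewrite /=; by field.
Qed.

Lemma GLin_mat2 (a b c d : F) : ival 0 a -> ival 0 b -> ival 0 c -> ival 0 d ->
  vunit (a * d - b * c) -> GLin (ppow v 0) (mat2 a b c d).
Proof.
move=> ha hb hc hd hD; split; first by rewrite unit_mat2 unitfE (vunit_neq0 hD).
  by move=> i j; apply/ppowP; rewrite mxE; ord2 i j.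
move=> i j; apply/ppowP; rewrite invmx_mat2 ?(vunit_neq0 hD) // !mxE.
apply: ivaloM; first by rewrite vunit_ival ?vunitV.
by ord2 i j; rewrite //= ivalN.
Qed.

Lemma GLin_mat2P (g : 'M[F]_2) : GLin (ppow v 0) g -> exists a b c d,
  [/\ g = mat2 a b c d, ival 0 a /\ ival 0 b, ival 0 c /\ ival 0 d & vunit (a * d - b * c)].
Proof.
move=> [gu h hi]; exists (g 0 0), (g 0 1), (g 1 0), (g 1 1).
have e := mat2_eta g; split=> //; try by split; apply/ppowP/h.
have ho i j : ival 0 (g i j) by apply/ppowP/h.
have hio i j : ival 0 (invmx g i j) by apply/ppowP/hi.
have := congr1 determinant (mulmxV gu); rewrite det_mulmx {1}e (mat2_eta (invmx g)) !det_mat2 det1.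
by apply: vunit_mulr1; apply: ivalB; apply: ivalMo.
Qed.

Lemma GL2_cong_mat2 k (a b c d : F) : ival k%:Z (a - 1) -> ival k%:Z b -> ival k%:Z c -> ival k%:Z (d - 1) ->
  vunit (a * d - b * c) -> GL2_cong v k (mat2 a b c d).
Proof.
move=> ha hb hc hd hD.
split; first by apply: GLin_mat2 => //; by [exact: cong1_o ha|exact: cong1_o hd|exact: ivalW hb|exact: ivalW hc].
move=> i j; apply/ppowP; rewrite -mat2_1 !mxE.
by ord2 i j; rewrite /= ?subr0.
Qed.

Lemma GL2_congP k (g : 'M[F]_2) : GL2_cong v k g -> exists a b c d,
  [/\ g = mat2 a b c d, ival k%:Z (a - 1) /\ ival k%:Z b, ival k%:Z c /\ ival k%:Z (d - 1)
    & vunit (a * d - b * c)].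
Proof.
case=> /GLin_mat2P[a [b [c [d [-> _ _ hD]]]]] h; exists a, b, c, d; split=> //; split.
- by have /ppowP := h 0 0; rewrite !mxE.
- by have /ppowP := h 0 1; rewrite !mxE subr0.
- by have /ppowP := h 1 0; rewrite !mxE subr0.
- by have /ppowP := h 1 1; rewrite !mxE.
Qed.

Lemma GL2_congW k l (g : 'M[F]_2) : (k <= l)%N -> GL2_cong v l g -> GL2_cong v k g.
Proof.
move=> kl [h1 h2]; split=> // i j; apply/ppowP; apply: (@ivalW _ v l); first by lia.
exact/ppowP.
Qed.

Lemma K1_mat2 n (a b c d : F) : ival 0 a -> ival n%:Z (a - 1) -> ival 0 b -> ival n%:Z c -> ival 0 d ->
  vunit (a * d - b * c) -> K1 v n (mat2 a b c d).
Proof.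
move=> ha ha1 hb hc hd hD; split.
- by apply: GLin_mat2 => //; apply: ivalW hc; lia.
- by apply/ppowP; rewrite !mxE.
- by apply/ppowP; rewrite !mxE.
Qed.

Lemma K1P n (g : 'M[F]_2) : K1 v n g -> exists a b c d,
  [/\ g = mat2 a b c d, [/\ ival 0 a, ival 0 b, ival 0 c & ival 0 d], ival n%:Z (a - 1),
      ival n%:Z c & vunit (a * d - b * c)].
Proof.
case=> /GLin_mat2P[a [b [c [d [-> [? ?] [? ?] hD]]]]] /ppowP h1 /ppowP h2.
by exists a, b, c, d; move: h1 h2; rewrite !mxE.
Qed.

End GL2o.

(** * Newforms for GL(2) *)

Section RepBasics.
Variables (F : fieldType) (v : local_field F) (C : fieldType) (V : lmodType C).
Variable tau : 'M[F]_2 -> {linear V -> V}.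
Hypothesis tau_rep : is_rep tau.
Local Notation ival := (ival v).
Local Notation vunit := (vunit v).
Implicit Types (g h : 'M[F]_2) (w : V).

Lemma tau1 w : tau 1%:M w = w. Proof. exact: tau_rep.1. Qed.

Lemma tauM g h w : g \in unitmx -> h \in unitmx -> tau (g *m h) w = tau g (tau h w).
Proof. exact: tau_rep.2. Qed.

Lemma tauZ g a w : tau g (a *: w) = a *: tau g w. Proof. exact: linearZ. Qed.

Lemma tauB g w w' : tau g (w - w') = tau g w - tau g w'. Proof. exact: linearB. Qed.

Definition fx g w := g \in unitmx /\ tau g w = w.

Lemma fxM g h w : fx g w -> fx h w -> fx (g *m h) w.
Proof. by move=> [ug hg] [uh hh]; split; rewrite ?unitmx_mul ?ug // tauM // hh. Qed.

Lemma fx_conj h g g' w : h \in unitmx -> g' \in unitmx -> h *m g = g' *m h ->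
  fx g w -> fx g' (tau h w).
Proof. by move=> uh ug' e [ug hg]; split=> //; rewrite -tauM // -e tauM // hg. Qed.

Lemma fx0 g : g \in unitmx -> fx g 0. Proof. by move=> u; split; rewrite ?linear0. Qed.

Lemma fxZD g a w w' : fx g w -> fx g w' -> fx g (a *: w + w').
Proof. by move=> [u h] [_ h']; split; rewrite // linearP h h'. Qed.

Lemma fx_sum g (I : Type) (s : seq I) (P : pred I) (f : I -> V) : g \in unitmx ->
  (forall i, P i -> fx g (f i)) -> fx g (\sum_(i <- s | P i) f i).
Proof.
move=> u h; elim/big_ind: _ => //; first exact: fx0.
by move=> x y hx hy; rewrite -[x]scale1r; apply: fxZD.
Qed.

Lemma fxZ g a w : fx g w -> fx g (a *: w).
Proof. by move=> h; rewrite -[_ *: _]addr0; apply: (fxZD _ h); apply: fx0; case: h. Qed.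

Lemma fixed_K1 n w : fixed_by tau (K1 v n) w <-> forall g, K1 v n g -> fx g w.
Proof.
split=> [hw g hg|hw g hg]; last by case: (hw g hg).
by split; [case: hg => -[]|exact: hw].
Qed.

(* The elements u^-(c) u(1) and their inverses give the torus elements diag(a, 1/a). *)
Lemma K1_gen n w :
  (forall x, ival 0 x -> fx (up x) w) -> (forall y, ival n%:Z y -> fx (lo y) w) ->
  (forall d, vunit d -> fx (dg 1 d) w) -> fixed_by tau (K1 v n) w.
Proof.
move=> hU hL hD; apply/fixed_K1 => g /K1P[a [b [c [d [-> [ha hb hc hd] ha1 hcn hdet]]]]].
have dgV e : vunit e -> ival n%:Z (e - 1) -> fx (dg e e^-1) w.
  move=> he he1; have e0 := vunit_neq0 he.
  have cn : ival n%:Z (e^-1 - 1).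
    have -> : e^-1 - 1 = - ((e - 1) * e^-1) by field.
    by rewrite ivalN ivalMu ?vunitV.
  have -> : dg e e^-1 = up (- e) *m (lo (e^-1 - 1) *m (up 1 *m lo (- ((e^-1 - 1) * e)))).
    by rewrite !mat2M; congr mat2; field.
  apply: fxM; first by apply: hU; rewrite ivalN vunit_ival.
  apply: fxM; first exact: hL.
  apply: fxM; first by apply: hU; rewrite ival1.
  by apply: hL; rewrite ivalN ivalMu.
have main a' b' c' d' : vunit a' -> ival n%:Z (a' - 1) -> ival n%:Z c' -> ival 0 b' ->
    vunit (a' * d' - b' * c') -> fx (mat2 a' b' c' d') w.
  move=> ua han hcn' hb' hdet'; have a0 := vunit_neq0 ua.
  have -> : mat2 a' b' c' d' = lo (c' / a') *m (dg a' a'^-1 *m (dg 1 (a' * d' - b' * c') *m up (b' / a'))).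
    by rewrite !mat2M; congr mat2; field.
  apply: fxM; first by apply: hL; rewrite ivalMu ?vunitV.
  apply: fxM; first exact: dgV.
  by apply: fxM; [exact: hD|apply: hU; rewrite ivalMu ?vunitV].
have [ua|nua] := boolP (vunit a); first exact: main.
(* As a = 1 mod p^n, a non-unit a forces n = 0. The unit determinant then makes a + c a unit, and
   adding the second row to the first reduces to [main]. *)
have n0 : n = 0%N.
  by case: n ha1 {hL dgV main hcn} => // n ha1; move: nua; rewrite (@vunit_cong1 _ _ n.+1).
have uc : vunit (a + c).
  apply: contraT => nuac.
  have h1 : ival 1 a by exact: nvunit.
  have h2 : ival 1 c by rewrite (_ : c = a + c - a); [apply: ivalB => //; apply: nvunit => //; exact: ivalD|ring].
  have : ival 1 (a * d - b * c) by apply: ivalB; [exact: ivalMo|exact: ivaloM].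
  by move/ival1N; rewrite hdet.
have -> : mat2 a b c d = up (-1) *m mat2 (a + c) (b + d) c d by rewrite mat2M; congr mat2; ring.
apply: fxM; first by apply: hU; rewrite ivalN ival1.
apply: main => //; rewrite ?n0.
- by apply: ivalB; [exact: ivalD|exact: ival1].
- by apply: ivalD.
- by have -> : (a + c) * d - (b + d) * c = a * d - b * c by ring.
Qed.

End RepBasics.

Section GenericRep.
Variables (F : fieldType) (v : local_field F) (C : fieldType) (V : lmodType C).
Variable tau : 'M[F]_2 -> {linear V -> V}.
Hypothesis tau_rep : is_rep tau.
Hypothesis tau_smooth : forall w, exists k, fixed_by tau (GL2_cong v k) w.
Hypothesis tau_irr : irreducible_rep tau.
Hypothesis tau_gen : generic v tau.
Local Notation ival := (ival v).
Local Notation vunit := (vunit v).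
Local Notation fx := (fx tau).
Local Notation upi := (upi v).
Implicit Types (g h : 'M[F]_2) (w : V).

Lemma unip2E (x : F) : unip2 x = up x.
Proof.
by apply/matrixP=> i j; rewrite !mxE; ord2 i j.
Qed.

(* By smoothness and a Weyl element such a vector is fixed by SL_2(F); irreducibility
   would make this true of every vector, against the Whittaker functional. *)
Lemma up_fixed_eq0 w : (forall x, fx (up x) w) -> w = 0.
Proof.
move=> hU; have [k hk] := tau_smooth w.
pose c := upi k; have c0 : c != 0 by exact: upi_neq0.
have hc : fx (lo c) w.
  split; first exact: lo_unit.
  apply: hk; apply: GL2_cong_mat2; rewrite ?subrr ?ival0 ?ival_upi //.
  by rewrite mul0r subr0 mulr1 vunit1.
pose W := mat2 0 (- c^-1) c 0.
have hW : fx W w.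
  have -> : W = up (- c^-1) *m (lo c *m up (- c^-1)) by rewrite !mat2M; congr mat2; field.
  by apply: (fxM tau_rep) => //; apply: (fxM tau_rep).
have hL y : fx (lo y) w.
  have [uW eW] := hW; rewrite -eW; apply: (fx_conj tau_rep uW (lo_unit _)) (hU (- y / c ^+ 2)).
  by rewrite !mat2M; congr mat2; field.
pose S (u : V) : Prop := forall g, \det g = 1 -> fx g u.
have detU g : \det g = 1 -> g \in unitmx by move=> e; rewrite unitmxE e unitr1.
have Sw : S w.
  have main a b x d : x != 0 -> a * d - b * x = 1 -> fx (mat2 a b x d) w.
    move=> x0 e.
    have -> : mat2 a b x d = up ((a - 1) / x) *m (lo x *m up ((d - 1) / x)).
      rewrite !mat2M; congr mat2; try by field.
      by apply: (mulIf x0); rewrite -[LHS](subrK (a * d)) -[b * x - _]opprB e; field.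
    by apply: (fxM tau_rep) => //; apply: (fxM tau_rep).
  move=> g; rewrite (mat2_eta g) det_mat2 => e.
  have [g10|] := eqVneq (g 1 0) 0; last by move=> ?; exact: main.
  have g00 : g 0 0 != 0.
    by apply: contra_eq_neq e => ->; rewrite g10 mul0r mulr0 subrr eq_sym oner_neq0.
  have -> : mat2 (g 0 0) (g 0 1) (g 1 0) (g 1 1) =
     lo (-1) *m mat2 (g 0 0) (g 0 1) (g 0 0) (g 0 1 + g 1 1).
    by rewrite mat2M g10; congr mat2; ring.
  apply: (fxM tau_rep) => //; apply: main => //.
  by rewrite -e g10; ring.
have [_ irr] := tau_irr.
have [|||h|h] := irr S.
- by move=> g /detU; exact: fx0.
- by move=> a u u' hu hu' g e; apply: fxZD; [exact: hu|exact: hu'].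
- move=> g u ug hu h e; apply: (fx_conj tau_rep ug (detU _ e)) (hu (invmx g *m h *m g) _).
    by rewrite !mulmxA mulmxV // mul1mx.
  by rewrite !det_mulmx e mulr1 -det_mulmx mulVmx // det1.
- exact: h.
have [psi [_ [x psix] [l [[w1 lw1] hl]]]] := tau_gen.
have := hl x w1; rewrite unip2E; have [|_ ->] := h w1 (up x); first by rewrite det_mat2 mulr0 subr0 mulr1.
by rewrite -{1}[l w1]mul1r => /(mulIf lw1) /esym /eqP; rewrite (negbTE psix).
Qed.

Definition dl (k : int) : 'M[F]_2 := dg 1 (upi k).

Lemma dl_unit k : dl k \in unitmx. Proof. by rewrite dg_unit ?oner_neq0 ?upi_neq0. Qed.

Lemma dl0 : dl 0 = 1%:M. Proof. by rewrite /dl upi0 -mat2_1. Qed.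

Lemma dlD k l : dl (k + l) = dl k *m dl l.
Proof. by rewrite /dl mat2M upiD; congr mat2; ring. Qed.

Lemma tau_dlD k l w : tau (dl (k + l)) w = tau (dl k) (tau (dl l) w).
Proof. by rewrite dlD tauM // dl_unit. Qed.

Lemma tau_dlK k : cancel (tau (dl k)) (tau (dl (- k))).
Proof. by move=> w; rewrite -tau_dlD addNr dl0 tau1. Qed.

Lemma tau_dlVK k : cancel (tau (dl (- k))) (tau (dl k)).
Proof. by move=> w; rewrite -tau_dlD addrN dl0 tau1. Qed.

Lemma fx_up_dl k x w : fx (up x) w -> fx (up (x / upi k)) (tau (dl k) w).
Proof.
apply: (fx_conj tau_rep (dl_unit _) (up_unit _)); have p0 := upi_neq0 v k.
by rewrite !mat2M; congr mat2; field.
Qed.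

Lemma fx_lo_dl k y w : fx (lo y) w -> fx (lo (upi k * y)) (tau (dl k) w).
Proof.
by apply: (fx_conj tau_rep (dl_unit _) (lo_unit _)); rewrite !mat2M; congr mat2; ring.
Qed.

Lemma fx_dg_dl k a d w : a != 0 -> d != 0 -> fx (dg a d) w -> fx (dg a d) (tau (dl k) w).
Proof.
move=> a0 d0; apply: (fx_conj tau_rep (dl_unit _) (dg_unit a0 d0)).
by rewrite !mat2M; congr mat2; ring.
Qed.

Lemma K1_up n w x : fixed_by tau (K1 v n) w -> ival 0 x -> fx (up x) w.
Proof.
move=> /fixed_K1 h hx; apply: h; apply: K1_mat2; rewrite ?subrr ?ival0 ?ival1 //.
by rewrite mulr0 subr0 mulr1 vunit1.
Qed.

Lemma K1_lo n w y : fixed_by tau (K1 v n) w -> ival n%:Z y -> fx (lo y) w.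
Proof.
move=> /fixed_K1 h hx; apply: h; apply: K1_mat2; rewrite ?subrr ?ival0 ?ival1 //.
by rewrite mul0r subr0 mulr1 vunit1.
Qed.

Lemma K1_dg n w a d : fixed_by tau (K1 v n) w -> vunit a -> ival n%:Z (a - 1) -> vunit d -> fx (dg a d) w.
Proof.
move=> /fixed_K1 h ha ha1 hd; apply: h; apply: K1_mat2; rewrite ?ival0 ?vunit_ival //.
by rewrite mulr0 subr0 vunitM.
Qed.

Lemma K1_mono n n' w : (n <= n')%N -> fixed_by tau (K1 v n) w -> fixed_by tau (K1 v n') w.
Proof.
move=> nn h; apply: K1_gen => // [x hx|y hy|d hd].
- exact: K1_up h hx.
- by apply: K1_lo h _; apply: ivalW hy; lia.
- by apply: K1_dg h _ _ hd; rewrite ?vunit1 // subrr ival0.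
Qed.

Lemma K1_raise n (i : nat) w : fixed_by tau (K1 v n) w -> fixed_by tau (K1 v (n + i)) (tau (dl i) w).
Proof.
move=> h; apply: K1_gen => // [x hx|y hy|d hd].
- rewrite -[x](mulfK (upi_neq0 v i)); apply: fx_up_dl; apply: K1_up h _.
  by rewrite mulrC ival_upiM; apply: ivalW hx; lia.
- rewrite -[y](divfK (upi_neq0 v i)) mulrC; apply: fx_lo_dl; apply: K1_lo h _.
  by rewrite ivalVM ?upi_neq0 // val_upi; apply: ivalW hy; lia.
- apply: fx_dg_dl; rewrite ?oner_neq0 ?(vunit_neq0 hd) //.
  by apply: K1_dg h _ _ hd; rewrite ?vunit1 // subrr ival0.
Qed.

(* A relation w = sum_(i > 0) c_i delta ^ i w improves the level of w under
   upper unipotents by one, hence indefinitely. *)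
Lemma dl_rel_eq0 n w N (c : nat -> C) : fixed_by tau (K1 v n) w ->
  w = \sum_(i < N) c i *: tau (dl i.+1) w -> w = 0.
Proof.
move=> hw e; apply: up_fixed_eq0 => x.
suff P (j : nat) : forall y, ival (- j%:Z) y -> fx (up y) w.
  have [->|x0] := eqVneq x 0; first by apply: K1_up hw (ival0 _ _).
  by apply: (P `|val_lf v x|%N); rewrite ival_val //; lia.
elim: j => [|j IH] y hy; first by apply: K1_up hw _; rewrite -oppr0.
rewrite e; apply: fx_sum => [|i _]; first exact: up_unit.
apply: fxZ; rewrite -[y](mulfK (upi_neq0 v i.+1)); apply: fx_up_dl; apply: IH.
by rewrite mulrC ival_upiM; apply: ivalW hy; lia.
Qed.

(** The lowest coefficient vanishes by [dl_rel_eq0]; what remains is divisible by delta, which gives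
    a shorter relation. *)
Lemma dl_free n w N (c : nat -> C) : fixed_by tau (K1 v n) w -> w != 0 ->
  \sum_(i < N) c i *: tau (dl i) w = 0 -> forall i, (i < N)%N -> c i = 0.
Proof.
move=> hw w0; elim: N c => [//|N IH] c.
rewrite big_ord_recl dl0 tau1 // => e.
have c0 : c 0%N = 0.
  apply: contraNeq w0 => c0; apply/eqP.
  apply: (@dl_rel_eq0 n w N (fun i => - ((c 0%N)^-1 * c i.+1)) hw).
  apply: (scalerI c0); rewrite scaler_sumr; apply/eqP; rewrite -subr_eq0 -sumrN -[X in _ == X]e; apply/eqP.
  congr (_ + _); apply: eq_bigr => i _.
  by rewrite scalerA mulrN mulVKf // scaleNr opprK lift0.
have hS : forall i, (i < N)%N -> c i.+1 = 0.
  apply: (IH (fun i => c i.+1)); apply: (can_inj (tau_dlK 1)); rewrite linear0 linear_sum -[RHS]e c0 scale0r add0r.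
  by apply: eq_bigr => i _; rewrite lift0 linearZ /= -tau_dlD; congr (_ *: tau (dl _) _); lia.
by case=> [|i] // /hS.
Qed.

End GenericRep.

(** A change of variables for sums over representatives. The image of a representative is only
    congruent to one, so the substitution is a relation E; total and injective on a finite set, it
    is a permutation. *)
Lemma sum_rel (T : eqType) (G : nmodType) (R : seq T) (E : T -> T -> Prop) (f g : T -> G) :
  uniq R -> (forall q, q \in R -> exists2 q', q' \in R & E q q') ->
  (forall q1 q2 q', q1 \in R -> q2 \in R -> q' \in R -> E q1 q' -> E q2 q' -> q1 = q2) ->
  (forall q q', q \in R -> q' \in R -> E q q' -> f q = g q') ->
  \sum_(q <- R) f q = \sum_(q <- R) g q.
Proof.
move=> uR tot inj fg.
have /choice[phi hphi] : forall q, exists q', q \in R -> q' \in R /\ E q q'.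
  move=> q.
  by have [/tot[q' ? ?]|] := boolP (q \in R); [exists q'|exists q].
have uphi : uniq (map phi R).
  rewrite map_inj_in_uniq // => q1 q2 h1 h2 e; have [h3 h4] := hphi _ h1; have [h5 h6] := hphi _ h2.
  by apply: (inj q1 q2 (phi q1)); rewrite // e.
have sub : {subset map phi R <= R} by move=> _ /mapP[q /hphi[? _] ->].
have [_ eqR] := uniq_min_size uphi sub (eq_leq (esym (size_map _ _))).
have pm : perm_eq (map phi R) R by exact: uniq_perm uphi uR eqR.
rewrite -[RHS](perm_big _ pm) /= big_map; apply: eq_big_seq => q hq.
by have [? ?] := hphi _ hq; apply: fg.
Qed.

(** * Integral matrices and linear algebra *)

Section InverseMatrix.
Variables (A : comUnitRingType) (n : nat).
Implicit Types g h : 'M[A]_n.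

Lemma invmx_eq g h : g *m h = 1%:M -> invmx g = h.
Proof.
move=> e; have [ug _] := mulmx1_unit e.
by rewrite -[h](mulKmx ug) e mulmx1.
Qed.

Lemma invmxM g h : g \in unitmx -> h \in unitmx -> invmx (g *m h) = invmx h *m invmx g.
Proof.
by move=> ug uh; apply: invmx_eq; rewrite -mulmxA (mulmxA h) mulmxV // mul1mx mulmxV.
Qed.

End InverseMatrix.

Lemma GLinV (A : comUnitRingType) (D : set A) n (g : 'M[A]_n) : GLin D g -> GLin D (invmx g).
Proof. by case=> ug hg ig; split; rewrite ?unitmx_inv ?invmxK. Qed.

Lemma GLinM (A : comUnitRingType) (D : set A) n (g h : 'M[A]_n) : D 0 ->
  (forall x y, D x -> D y -> D (x + y)) -> (forall x y, D x -> D y -> D (x * y)) ->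
  GLin D g -> GLin D h -> GLin D (g *m h).
Proof.
move=> D0 DD DM [ug hg ig] [uh hh ih].
have DmM (X Y : 'M[A]_n) i j : (forall i j, D (X i j)) -> (forall i j, D (Y i j)) -> D ((X *m Y) i j).
  by move=> hX hY; rewrite mxE; elim/big_ind: _ => // k _; apply: DM.
split=> [|i j|i j]; first by rewrite unitmx_mul ug.
  exact: DmM.
by rewrite invmxM //; apply: DmM.
Qed.

Section IntegralMatrices.
Variables (F : fieldType) (v : local_field F).
Local Notation ival := (ival v).

Definition mxival (k : int) m n (A : 'M[F]_(m, n)) : Prop := forall i j, ival k (A i j).

Lemma mxivalM k l m n p (A : 'M[F]_(m, n)) (B : 'M[F]_(n, p)) :
  mxival k A -> mxival l B -> mxival (k + l) (A *m B).
Proof. by move=> hA hB i j; rewrite mxE; apply: ival_sum => x _; apply: ivalM. Qed.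

Lemma mxivalMo k m n p (A : 'M[F]_(m, n)) (B : 'M[F]_(n, p)) :
  mxival k A -> mxival 0 B -> mxival k (A *m B).
Proof. by move=> hA hB; rewrite -[k]addr0; apply: mxivalM. Qed.

Lemma mxivaloM k m n p (A : 'M[F]_(m, n)) (B : 'M[F]_(n, p)) :
  mxival 0 A -> mxival k B -> mxival k (A *m B).
Proof. by move=> hA hB; rewrite -[k]add0r; apply: mxivalM. Qed.

Lemma mxivalD k m n (A B : 'M[F]_(m, n)) : mxival k A -> mxival k B -> mxival k (A + B).
Proof. by move=> hA hB i j; rewrite mxE ivalD. Qed.

Lemma mxivalB k m n (A B : 'M[F]_(m, n)) : mxival k A -> mxival k B -> mxival k (A - B).
Proof. by move=> hA hB i j; rewrite !mxE ivalB. Qed.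

Lemma mxivalBC k m n (A B : 'M[F]_(m, n)) : mxival k (A - B) -> mxival k (B - A).
Proof. by move=> h i j; have := h i j; rewrite !mxE ivalBC. Qed.

Lemma mxival1 n : mxival 0 (1%:M : 'M[F]_n).
Proof. by move=> i j; rewrite mxE; case: (i == j); rewrite ?ival1 ?ival0. Qed.

Lemma mxival_mat2 k (a b c d : F) : ival k a -> ival k b -> ival k c -> ival k d -> mxival k (mat2 a b c d).
Proof.
by move=> ha hb hc hd i j; rewrite mxE; ord2 i j.
Qed.

Lemma GLinoP n (g : 'M[F]_n) : GLin (ppow v 0) g <-> [/\ g \in unitmx, mxival 0 g & mxival 0 (invmx g)].
Proof. by split=> -[u h hi]; split=> // i j; apply/ppowP/h || apply/ppowP/hi. Qed.

Lemma GLinoM n (g h : 'M[F]_n) : GLin (ppow v 0) g -> GLin (ppow v 0) h -> GLin (ppow v 0) (g *m h).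
Proof.
apply: GLinM => [|x y /ppowP hx /ppowP hy|x y /ppowP hx /ppowP hy]; apply/ppowP.
- exact: ival0.
- exact: ivalD.
- exact: ivalMo.
Qed.

Lemma GL2_congE k (g : 'M[F]_2) : GL2_cong v k g <-> GLin (ppow v 0) g /\ mxival k%:Z (g - 1%:M).
Proof. by split=> -[h1 h2]; split=> // i j; apply/ppowP/h2. Qed.

End IntegralMatrices.

Section LinearDependence.
Variables (C : fieldType) (V : lmodType C).

Lemma dependent (W : set V) d (x : 'I_d.+1 -> V) : has_dim W d -> (forall i, W (x i)) ->
  exists c : 'I_d.+1 -> C, (exists i, c i != 0) /\ \sum_i c i *: x i = 0.
Proof.
move=> [e [_ span]] hx.
have /choice[f hf] : forall i, exists c : 'I_d -> C, x i = \sum_j c j *: e j.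
  by move=> i; apply/span.
pose M := \matrix_(i < d.+1, j < d) f i j.
have : kermx M != 0.
  apply: contraTneq isT => k0; have := mxrank_ker M; rewrite k0 mxrank0 => h.
  by have := rank_leq_col M; lia.
case/rowV0Pn=> u /sub_kermxP uM u0.
exists (fun i => u 0 i); split.
  by have /matrix0Pn[i [j]] := u0; rewrite ord1 => h; exists j.
under eq_bigr => i _ do rewrite hf scaler_sumr.
rewrite exchange_big big1 // => j _.
under eq_bigr => i _ do rewrite scalerA.
rewrite -scaler_suml; have /matrixP/(_ 0 j) := uM; rewrite !mxE => uMj.
rewrite (eq_bigr (fun i => u 0 i * M i j)) ?uMj ?scale0r // => i _; by rewrite mxE.
Qed.

End LinearDependence.

Section Eigenvector.
Variables (C : closedFieldType) (V : lmodType C).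

(* Dependence of x, T x, ..., T^d x gives a polynomial killing x; split it. *)
Lemma eigenvector (W X : set V) d (T : V -> V) (x : V) : has_dim W d ->
  (forall y, X y -> W y) -> (forall y, X y -> X (T y)) ->
  (forall a y z, X y -> X z -> X (a *: y + z)) ->
  (forall a y z, T (a *: y + z) = a *: T y + T z) ->
  X x -> x != 0 -> exists l z, [/\ X z, z != 0 & T z = l *: z].
Proof.
move=> dW XW XT XL TL Xx x0.
have T0 : T 0 = 0.
  by have := TL 1 0 0; rewrite !scale1r addr0 => h; apply: (addIr (T 0)); rewrite -h add0r.
have TZ a y : T (a *: y) = a *: T y by rewrite -[_ *: y]addr0 TL T0 addr0.
have TD y z : T (y + z) = T y + T z by rewrite -[y]scale1r TL !scale1r.
have X0 : X 0 by have := XL (-1) x x Xx Xx; rewrite scaleN1r addNr.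
have XZ a y : X y -> X (a *: y) by move=> h; rewrite -[_ *: y]addr0; exact: XL.
have Tsum I (s : seq I) (f : I -> V) : T (\sum_(i <- s) f i) = \sum_(i <- s) T (f i).
  by apply: (big_morph T TD T0).
have iX i y : X y -> X (iter i T y) by move=> h; elim: i => //= i; exact: XT.
have [c [[i0 ci0] e]] := dependent dW (fun i : 'I_d.+1 => XW _ (iX i x Xx)).
pose act (p : {poly C}) (y : V) := \sum_(i < size p) p`_i *: iter i T y.
have actE n (p : {poly C}) y : (size p <= n)%N -> act p y = \sum_(i < n) p`_i *: iter i T y.
  move=> h; rewrite /act (big_ord_widen _ (fun i => p`_i *: iter i T y) h) big_mkcond /=.
  by apply: eq_bigr => i _; case: ltnP => // hi; rewrite nth_default ?scale0r.
have iT0 i : iter i T 0 = 0 by elim: i => //= i ->.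
have iTL i a y z : iter i T (a *: y + z) = a *: iter i T y + iter i T z.
  by elim: i => //= i ->; rewrite TL.
have act_lin p a y z : act p (a *: y + z) = a *: act p y + act p z.
  rewrite /act scaler_sumr -big_split; apply: eq_bigr => i _ /=.
  by rewrite iTL scalerDr !scalerA mulrC.
have actM (p : {poly C}) a y : act (p * ('X - a%:P)) y = act p (T y - a *: y).
  have h : (size (p * ('X - a%:P))%R <= (size p).+1)%N.
    by apply: leq_trans (size_polyMleq _ _) _; rewrite size_XsubC addn2.
  rewrite (actE (size p).+1) //.
  have -> : act p (T y - a *: y) = \sum_(i < size p) p`_i *: iter i.+1 T y - a *: \sum_(i < size p) p`_i *: iter i T y.
    rewrite addrC -scaleNr act_lin addrC scaleNr; congr (_ - _).
    by apply: eq_bigr => i _; rewrite -iterSr.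
  rewrite (eq_bigr (fun i : 'I__ => (p * 'X)`_i *: iter i T y - a *: (p`_i *: iter i T y))); last first.
    by move=> i _; rewrite mulrBr coefB coefMC scalerBl scalerA [p`_i * a]mulrC.
  rewrite sumrB big_ord_recl coefMX eqxx scale0r add0r; congr (_ - _).
    by apply: eq_bigr => i _; rewrite coefMX lift0.
  by rewrite scaler_sumr big_ord_recr /= nth_default // scale0r scaler0 addr0.
pose p := \poly_(i < d.+1) c (inord i).
have px : act p x = 0.
  rewrite (actE d.+1) ?size_poly // -[RHS]e; apply: eq_bigr => i _.
  by rewrite coef_poly ltn_ord inord_val.
have p0 : p != 0.
  by apply: contraNneq ci0 => /polyP/(_ i0); rewrite coef_poly ltn_ord inord_val coef0 => ->.
have [rs defp] := closed_field_poly_normal p.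
(* With [act p y] standing for p(T) y, linear factors are peeled off one at a time: either T y = a y
   for the current root a, or T y - a y is a nonzero vector of X killed by the remaining factors. *)
suff H : forall (rs : seq C) y, X y -> y != 0 -> act (\prod_(z <- rs) ('X - z%:P)) y = 0 ->
    exists l z, [/\ X z, z != 0 & T z = l *: z].
  apply: (H rs x Xx x0); apply: (@scalerI _ _ (lead_coef p)); rewrite ?lead_coef_eq0 // scaler0 -[RHS]px {2}defp.
  rewrite [in RHS](actE (size (\prod_(z <- rs) ('X - z%:P)))) ?size_scale_leq // scaler_sumr.
  by apply: eq_bigr => i _; rewrite coefZ scalerA.
elim=> [|a s IH] y Xy y0.
  by rewrite big_nil /act size_poly1 big_ord1 coefC eqxx scale1r /= => ye; rewrite ye eqxx in y0.
rewrite big_cons mulrC actM; have [ye|yn] := eqVneq (T y - a *: y) 0.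
  by move=> _; exists a, y; split=> //; apply/eqP; rewrite -subr_eq0 ye.
by apply: IH => //; rewrite addrC -scaleNr; apply: XL => //; exact: XT.
Qed.

End Eigenvector.

(** * Multiplicity one for a character of a congruence subgroup *)

Section Gelfand.
Variables (F : fieldType) (v : local_field F) (C : numClosedFieldType) (V : lmodType C).
Variable tau : 'M[F]_2 -> {linear V -> V}.
Hypothesis tau_rep : is_rep tau.
Hypothesis tau_smooth : forall w, exists k, fixed_by tau (GL2_cong v k) w.
Hypothesis tau_fin : forall k, exists d, has_dim (fixed_by tau (GL2_cong v k)) d.
Hypothesis tau_irr : irreducible_rep tau.
Variables (m : nat) (theta : F -> C).
Hypothesis m_gt0 : (0 < m)%N.
Hypothesis thetaD : forall x y, theta (x + y) = theta x * theta y.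
Hypothesis theta_neq0 : forall x, theta x != 0.
Hypothesis theta_m : forall x, ival v m x -> theta x = 1.
Hypothesis theta_m1 : exists2 z, ival v (m%:Z - 1) z & theta z != 1.
Local Notation ival := (ival v).
Local Notation vunit := (vunit v).
Local Notation fx := (fx tau).
Local Notation upi := (upi v).
Implicit Types (g h t : 'M[F]_2) (w : V).

Lemma theta0 : theta 0 = 1. Proof. by rewrite theta_m ?ival0. Qed.

Lemma thetaN x : theta (- x) = (theta x)^-1.
Proof. by apply: (mulIf (theta_neq0 x)); rewrite -thetaD addNr theta0 mulVf. Qed.

Lemma theta_cong x y : ival m%:Z (x - y) -> theta x = theta y.
Proof. by move=> h; rewrite -[x](subrK y) thetaD theta_m // mul1r. Qed.

(** Otherwise s p^i would contain p^(m - 1), on which theta is nontrivial. *)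
Lemma theta_primitive i s : (forall x, ival i x -> theta (s * x) = 1) -> ival (m%:Z - i) s.
Proof.
move=> h; have [->|s0] := eqVneq s 0; first exact: ival0.
apply: contraT; rewrite ival_val // -ltNge => hs; have [z hz zn] := theta_m1.
have := h (z / s); rewrite mulrCA mulfV // mulr1 => e; move: zn; rewrite e ?eqxx //.
by rewrite ivalVM //; apply: ivalW hz; ilia.
Qed.

(** The congruence subgroup H of Gelfand's trick; its upper right entry is left free, to carry the
    character theta. *)
Definition inH g : bool :=
  [&& ival m (g 0 0 - 1), ival 0 (g 0 1), ival m (g 1 0) & ival m (g 1 1 - 1)].

Lemma inHE a b c d : inH (mat2 a b c d) =
  [&& ival m (a - 1), ival 0 b, ival m c & ival m (d - 1)].
Proof. by rewrite /inH !mxE. Qed.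

Lemma inH_mxival g : inH g -> mxival v 0 g.
Proof.
rewrite {1 2}(mat2_eta g) inHE => /and4P[ha hb hc hd]; apply: mxival_mat2 => //.
- exact: cong1_o ha.
- by apply: ivalW hc; ilia.
- exact: cong1_o hd.
Qed.

Lemma inH_det g : inH g -> vunit (\det g).
Proof.
rewrite {1 2}(mat2_eta g) inHE => /and4P[ha hb hc hd]; rewrite det_mat2.
apply: (@vunit_cong1 _ _ m%:Z); first by ilia.
set a := g 0 0 in ha *; set b := g 0 1 in hb *; set c := g 1 0 in hc *; set d := g 1 1 in hd *.
have -> : a * d - b * c - 1 = (a - 1) * d + (d - 1) - b * c by ring.
apply: ivalB; last exact: ivaloM.
by apply: ivalD => //; apply: ivalMo => //; apply: cong1_o hd.
Qed.

Lemma inH_GL g : inH g -> GLin (ppow v 0) g.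
Proof.
move=> hg; have := inH_det hg; have := inH_mxival hg.
rewrite {2 3}(mat2_eta g) det_mat2 => h hd.
by apply: GLin_mat2 => //; apply: h.
Qed.

Lemma inH_unit g : inH g -> g \in unitmx.
Proof. by case/inH_GL. Qed.

(** The upper right entry a b' + b d' of the product is b + b' modulo p^m, so theta of this entry is
    a character of H. *)
Lemma inHM g h : inH g -> inH h ->
  inH (g *m h) /\ theta ((g *m h) 0 1) = theta (g 0 1) * theta (h 0 1).
Proof.
move=> hg hh; have := hg; have := hh; rewrite (mat2_eta g) (mat2_eta h) !inHE mat2M.
move: (g 0 0) (g 0 1) (g 1 0) (g 1 1) (h 0 0) (h 0 1) (h 1 0) (h 1 1) => a b c d a' b' c' d'.
move=> /and4P[ha' hb' hc' hd'] /and4P[ha hb hc hd].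
have oa := cong1_o ha; have od := cong1_o hd.
have oa' := cong1_o ha'; have od' := cong1_o hd'.
have oc := ivalWn hc.
split.
  rewrite inHE; apply/and4P; split.
  - have -> : a * a' + b * c' - 1 = (a - 1) * a' + (a' - 1) + b * c' by ring.
    by apply: ivalD; [apply: ivalD => //; exact: ivalMo|exact: ivaloM].
  - by apply: ivalD; apply: ivalMo.
  - by apply: ivalD; [exact: ivalMo|exact: ivaloM].
  - have -> : c * b' + d * d' - 1 = c * b' + (d * (d' - 1) + (d - 1)) by ring.
    by apply: ivalD; [exact: ivalMo|apply: ivalD => //; exact: ivaloM].
rewrite -thetaD !mxE /=; apply: theta_cong.
have -> : a * b' + b * d' - (b + b') = (a - 1) * b' + b * (d' - 1) by ring.
by apply: ivalD; [exact: ivalMo|exact: ivaloM].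
Qed.

Lemma inH1 : inH 1%:M.
Proof. by rewrite -mat2_1 inHE !subrr !ival0. Qed.

Lemma inHV g : inH g -> inH (invmx g).
Proof.
move=> hg; have := hg; have := inH_det hg; rewrite (mat2_eta g) det_mat2 inHE.
move: (g 0 0) (g 0 1) (g 1 0) (g 1 1) => a b c d hD /and4P[ha hb hc hd].
have D0 := vunit_neq0 hD; rewrite invmx_mat2 //; set D := a * d - b * c in hD D0 *.
have -> : D^-1 *: mat2 d (- b) (- c) a = mat2 (d / D) (- b / D) (- c / D) (a / D).
  by apply/matrixP=> i j; rewrite !mxE; ord2 i j; rewrite /= mulrC.
have uD := vunitV hD; have oa := cong1_o ha; have od := cong1_o hd.
rewrite inHE; apply/and4P; split.
- have -> : d / D - 1 = (b * c - (a - 1) * d) / D by rewrite /D; field.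
  by rewrite ivalMu //; apply: ivalB; [exact: ivaloM|exact: ivalMo].
- by rewrite ivalMu // ivalN.
- by rewrite ivalMu // ivalN.
- have -> : a / D - 1 = (b * c - a * (d - 1)) / D by rewrite /D; field.
  by rewrite ivalMu //; apply: ivalB; exact: ivaloM.
Qed.

Definition isotypic w : Prop := forall g, inH g -> tau g w = theta (g 0 1) *: w.

(** Levels are counted from m, so that theta of the upper right entry depends only on a matrix
    modulo p^(m + K). *)
Definition level K w : Prop := fixed_by tau (GL2_cong v (m + K)) w.

Lemma level_le K L w : (K <= L)%N -> level K w -> level L w.
Proof. by move=> KL h g hg; apply: h; apply: GL2_congW hg; rewrite leq_add2l. Qed.

Lemma levelP w : exists K, level K w.
Proof.
have [k hk] := tau_smooth w; exists k => g hg; apply: hk; apply: GL2_congW hg.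
exact: leq_addl.
Qed.

Lemma tau_cong K g h w : level K w -> GLin (ppow v 0) g -> GLin (ppow v 0) h ->
  mxival v (m + K)%N (g - h) -> tau g w = tau h w.
Proof.
move=> hw Gg Gh e; have [ug _ _] := Gg; have [uh _ _] := Gh.
have -> : h = g *m (invmx g *m h) by rewrite mulmxA mulmxV // mul1mx.
rewrite (tauM tau_rep) ?unitmx_mul ?unitmx_inv ?ug //; congr (tau g _); apply/esym/hw.
apply/GL2_congE; split; first by apply: GLinoM => //; apply: GLinV.
rewrite -(mulVmx ug) -mulmxBr; apply: mxivaloM; last exact: mxivalBC.
by case/GLinoP: (GLinV Gg).
Qed.

Lemma level_tau K g w : GLin (ppow v 0) g -> level K w -> level K (tau g w).
Proof.
move=> Gg hw h Gh; have [ug _ _] := Gg; have [uh _ _] := Gh.1.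
rewrite -(tauM tau_rep) //; apply: tau_cong hw _ _ _ => //; first by apply: GLinoM => //; case: Gh.
rewrite -{2}[g]mul1mx -mulmxBl; apply: mxivalMo; first by case/GL2_congE: Gh.
by case/GLinoP: Gg.
Qed.

(** The reflection in the antidiagonal, that is g -> w g^T w with w the permutation matrix. It
    reverses products, preserves H and keeps the entry that theta sees. *)
Definition sig g := mat2 (g 1 1) (g 0 1) (g 1 0) (g 0 0).

Lemma sigM g h : sig (g *m h) = sig h *m sig g.
Proof. by rewrite (mat2_eta g) (mat2_eta h) /sig !mat2M !mxE /=; congr mat2; ring. Qed.

Lemma sigK : involutive sig.
Proof. by move=> g; rewrite /sig !mxE /= -mat2_eta. Qed.

Lemma sig_inH g : inH (sig g) = inH g.
Proof. by rewrite /sig inHE; apply/and4P/and4P => -[]. Qed.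

Lemma sig_unit g : (sig g \in unitmx) = (g \in unitmx).
Proof. by rewrite /sig [in RHS](mat2_eta g) !unit_mat2 [g 1 1 * _]mulrC. Qed.

(** All four entries come from the same representatives of o / p^(m + K), which makes the list
    stable under [sig]; [TT_comm] reindexes a sum along [sig]. *)
Lemma transversalH K : exists R : seq 'M[F]_2,
  [/\ uniq R, forall g, g \in R -> inH g,
      forall g, inH g -> exists2 h, h \in R & mxival v (m + K)%N (g - h),
      forall g h, g \in R -> h \in R -> mxival v (m + K)%N (g - h) -> g = h &
      forall g, g \in R -> sig g \in R].
Proof.
have [s [us so sc si]] := residue_transversal v (m + K).
pose ss := [seq (x, y) | x <- s, y <- s].
pose f (p : (F * F) * (F * F)) := mat2 p.1.1 p.1.2 p.2.1 p.2.2.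
have uss : uniq ss by apply: allpairs_uniq => // -[? ?] [? ?].
pose P := [seq (x, y) | x <- ss, y <- ss].
have uP : uniq P by apply: allpairs_uniq => // -[? ?] [? ?].
have memP a b c d : ((a, b, (c, d)) \in P) = [&& a \in s, b \in s, c \in s & d \in s].
  apply/allpairsP/and4P => [[[? ?] /= [/allpairsP[[? ?] /= [? ? ->]] /allpairsP[[? ?] /= [? ? ->]] [-> -> -> ->]]]//|].
  by move=> [? ? ? ?]; exists ((a, b), (c, d)); split=> //; apply/allpairsP; [exists (a, b)|exists (c, d)].
have memR g : (g \in [seq f p | p <- P]) = [&& g 0 0 \in s, g 0 1 \in s, g 1 0 \in s & g 1 1 \in s].
  apply/mapP/idP => [[[[a b] [c d]]]|h].
    by rewrite memP => h ->; rewrite /f !mxE.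
  by exists ((g 0 0, g 0 1), (g 1 0, g 1 1)); rewrite ?memP //= /f /= -mat2_eta.
have finj : injective f.
  by move=> [[a b] [c d]] [[a' b'] [c' d']] /mat2_inj /= [-> -> -> ->].
exists [seq g <- [seq f p | p <- P] | inH g]; split.
- by rewrite filter_uniq // map_inj_uniq.
- by move=> g; rewrite mem_filter => /andP[].
- move=> g hg; have og := inH_mxival hg.
  have [a as_ ha] := sc _ (og 0 0); have [b bs hb] := sc _ (og 0 1).
  have [c cs hc] := sc _ (og 1 0); have [d ds hd] := sc _ (og 1 1).
  have lift k i z z' : (i : int) <= (m + K)%N -> ival i (z - k) -> ival (m + K)%N (z - z') -> ival i (z' - k).
    by move=> hi h1 h2; have := ivalB h1 (ivalW hi h2); congr (ival _ _); ring.
  exists (mat2 a b c d).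
    rewrite mem_filter memR !mxE /= as_ bs cs ds inHE !andbT.
    have /and4P[h1 h2 h3 h4] := hg; apply/and4P; split.
    - by apply: lift h1 ha; ilia.
    - by rewrite -[b]subr0; apply: lift hb; rewrite ?subr0 //; ilia.
    - by rewrite -[c]subr0; apply: lift hc; rewrite ?subr0 //; ilia.
    - by apply: lift h4 hd; ilia.
  by move=> i j; rewrite (mat2_eta g) !mxE; ord2 i j.
- move=> g h; rewrite !mem_filter !memR => /andP[_ /and4P[? ? ? ?]] /andP[_ /and4P[? ? ? ?]] e.
  rewrite (mat2_eta g) (mat2_eta h); congr mat2; (apply: si => //);
  [have := e 0 0|have := e 0 1|have := e 1 0|have := e 1 1]; by rewrite !mxE.
- move=> g; rewrite !mem_filter !memR sig_inH !mxE /= => /andP[-> /and4P[? ? ? ?]].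
  by rewrite /=; apply/and4P.
Qed.

Definition RH K : seq 'M[F]_2 := projT1 (cid (transversalH K)).

Lemma RHP K : [/\ uniq (RH K), forall g, g \in RH K -> inH g,
      forall g, inH g -> exists2 h, h \in RH K & mxival v (m + K)%N (g - h),
      forall g h, g \in RH K -> h \in RH K -> mxival v (m + K)%N (g - h) -> g = h &
      forall g, g \in RH K -> sig g \in RH K].
Proof. exact: projT2 (cid (transversalH K)). Qed.

Lemma RH_size K : (size (RH K))%:R != 0 :> C.
Proof.
have [_ _ ex _ _] := RHP K; have [h hh _] := ex _ inH1.
by rewrite pnatr_eq0; case: (RH K) hh.
Qed.

(** The average over H against the inverse of theta, as a finite sum over H modulo p^(m + K); it is
    meaningful for vectors of level K. *)
Definition eK K w : V := (size (RH K))%:R^-1 *: \sum_(g <- RH K) (theta (g 0 1))^-1 *: tau g w.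

Lemma eK_lin K a w w' : eK K (a *: w + w') = a *: eK K w + eK K w'.
Proof.
rewrite /eK scalerA [a * _]mulrC -scalerA -scalerDr; congr (_ *: _); rewrite scaler_sumr -big_split.
by apply: eq_bigr => g _ /=; rewrite linearP scalerDr !scalerA mulrC.
Qed.

(** The change of variables that makes the average equivariant; [phi] is left or right translation
    by an element of H. *)
Lemma sum_RH_translate K (phi : 'M[F]_2 -> 'M[F]_2) (c : C) w : level K w -> c != 0 ->
  (forall g, inH g -> inH (phi g) /\ theta (phi g 0 1) = c * theta (g 0 1)) ->
  (forall g g', mxival v (m + K)%N (phi g - phi g') -> mxival v (m + K)%N (g - g')) ->
  \sum_(g <- RH K) (theta (g 0 1))^-1 *: tau (phi g) w = c *: \sum_(g <- RH K) (theta (g 0 1))^-1 *: tau g w.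
Proof.
move=> hw c0 hphi iphi; have [_ RH_ tot inj _] := RHP K; have [uR _ _ _ _] := RHP K.
have Hh g : g \in RH K -> inH (phi g) by move=> /RH_/hphi[].
rewrite scaler_sumr; apply: (sum_rel (E := fun g g' => mxival v (m + K)%N (phi g - g'))) => // [g gR|g1 g2 g' h1 h2 h' e1 e2|g g' gR g'R e].
- exact/tot/Hh.
- apply: inj => //; apply: iphi; rewrite (_ : _ - _ = (phi g1 - g') - (phi g2 - g')); last by rewrite opprB addrA subrK.
  exact: mxivalB.
- have tt : theta (g' 0 1) = c * theta (g 0 1).
    have [_ <-] := hphi _ (RH_ _ gR); apply/esym/theta_cong; have := e 0 1; rewrite !mxE; apply: ivalW; ilia.
  rewrite tt scalerA (tau_cong hw (inH_GL (Hh _ gR)) (inH_GL (RH_ _ g'R)) e).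
  by rewrite invfM mulrA mulfV // mul1r.
Qed.

Lemma eK_isotypic K w : level K w -> isotypic (eK K w).
Proof.
move=> hw h hh; have [_ RH_ _ _ _] := RHP K; have uh := inH_unit hh.
rewrite /eK (tauZ tau) linear_sum scalerA [theta _ * _]mulrC -scalerA; congr (_ *: _).
rewrite -(sum_RH_translate (phi := mulmx h) hw) //; last 2 first.
- by move=> g /(inHM hh).
- move=> g g' e; have := mxivaloM (A := invmx h) (inH_mxival (inHV hh)) e.
  by rewrite -mulmxBr mulKmx.
apply: eq_big_seq => g /RH_ hg.
by rewrite linearZ /= -(tauM tau_rep) ?inH_unit.
Qed.

Lemma eK_tau K h w : level K w -> inH h -> eK K (tau h w) = theta (h 0 1) *: eK K w.
Proof.
move=> hw hh; have [_ RH_ _ _ _] := RHP K; have uh := inH_unit hh.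
rewrite /eK scalerA [theta _ * _]mulrC -scalerA; congr (_ *: _).
rewrite -(sum_RH_translate (phi := mulmx^~ h) hw) //; last 2 first.
- by move=> g /inHM/(_ hh)[? ->]; rewrite mulrC.
- move=> g g' e; have := mxivalMo (B := invmx h) e (inH_mxival (inHV hh)).
  by rewrite -mulmxBl mulmxK.
apply: eq_big_seq => g /RH_ hg.
by rewrite -(tauM tau_rep) ?inH_unit.
Qed.

Lemma eK_id K w : isotypic w -> eK K w = w.
Proof.
move=> hw; have [_ RH_ _ _ _] := RHP K; rewrite /eK (eq_big_seq (fun=> w)).
  by rewrite big_const_seq count_predT iter_addr_0 -scaler_nat scalerA mulVf ?scale1r ?RH_size.
by move=> g /RH_ hg; rewrite hw // scalerA mulVf // scale1r.
Qed.

Lemma eK0 K : eK K 0 = 0.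
Proof. by rewrite /eK big1 ?scaler0 // => g _; rewrite linear0 scaler0. Qed.

Lemma eK_sum K (I : Type) (s : seq I) (f : I -> V) : eK K (\sum_(i <- s) f i) = \sum_(i <- s) eK K (f i).
Proof. by apply: (big_morph (eK K) _ (eK0 K)) => x y; rewrite -[x]scale1r eK_lin !scale1r. Qed.

Lemma eKZ K a w : eK K (a *: w) = a *: eK K w.
Proof. by rewrite -[_ *: w]addr0 eK_lin eK0 addr0. Qed.

(** Compute [eK L (eK K w)] in two ways: the inner average is isotypic, hence fixed by [eK L]; and
    by [eK_tau] each of its terms contributes the same [eK L w]. *)
Lemma eK_indep K L w : (K <= L)%N -> level K w -> eK L w = eK K w.
Proof.
move=> KL hw; rewrite -[RHS](eK_id L (eK_isotypic hw)) [X in _ = eK L X]/eK eKZ eK_sum.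
have [_ RH_ _ _ _] := RHP K.
rewrite (eq_big_seq (fun=> eK L w)) ?big_const_seq ?count_predT ?iter_addr_0.
  by rewrite -scaler_nat scalerA mulVf ?scale1r ?RH_size.
move=> g /RH_ hg; rewrite eKZ eK_tau //; last exact: level_le hw.
by rewrite scalerA mulVf // scale1r.
Qed.

(* By [eK_indep] the level is immaterial: [e_] is the projection onto the isotypic vectors. *)
Definition e_ w : V := eK (projT1 (cid (levelP w))) w.

Lemma eE K w : level K w -> e_ w = eK K w.
Proof.
move=> hw; rewrite /e_; case: cid => L /= hL.
by rewrite -(eK_indep (leq_maxl K L) hw) -(eK_indep (leq_maxr K L) hL).
Qed.

Lemma e_lin a w w' : e_ (a *: w + w') = a *: e_ w + e_ w'.
Proof.
have [K hK] := levelP w; have [L hL] := levelP w'.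
have h1 := level_le (leq_maxl K L) hK; have h2 := level_le (leq_maxr K L) hL.
rewrite (eE h1) (eE h2) (eE (K := maxn K L)) ?eK_lin //.
by move=> g hg; rewrite linearP /= h1 // h2.
Qed.

Lemma e_isotypic w : isotypic (e_ w).
Proof. by have [K hK] := levelP w; rewrite (eE hK); apply: eK_isotypic. Qed.

Lemma e_tau h w : inH h -> e_ (tau h w) = theta (h 0 1) *: e_ w.
Proof.
move=> hh; have [K hK] := levelP w.
by rewrite (eE hK) (eE (level_tau (inH_GL hh) hK)) eK_tau.
Qed.

Lemma e_id w : isotypic w -> e_ w = w.
Proof. by move=> h; have [K hK] := levelP w; rewrite (eE hK) eK_id. Qed.

Lemma e0 : e_ 0 = 0.
Proof. by apply: e_id => g _; rewrite linear0 scaler0. Qed.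

Lemma eZ a w : e_ (a *: w) = a *: e_ w.
Proof. by rewrite -[_ *: w]addr0 e_lin e0 addr0. Qed.

Lemma e_sum (I : Type) (s : seq I) (f : I -> V) : e_ (\sum_(i <- s) f i) = \sum_(i <- s) e_ (f i).
Proof. by apply: (big_morph e_ _ e0) => x y; rewrite -[x]scale1r e_lin !scale1r. Qed.

(** On isotypic vectors this is e tau(g) e, up to normalization the Hecke operator of the double
    coset H g H for the character theta. *)
Definition TT g w := e_ (tau g w).

Lemma TT_mul h g h' w : inH h -> inH h' -> g \in unitmx -> isotypic w ->
  TT (h *m g *m h') w = (theta (h 0 1) * theta (h' 0 1)) *: TT g w.
Proof.
move=> hh hh' ug hw; rewrite /TT !(tauM tau_rep) ?unitmx_mul ?ug ?inH_unit //.
by rewrite (e_tau _ hh) (hw _ hh') tauZ eZ scalerA.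
Qed.

(** T at h g = g h' is both theta(h) T_g and theta(h') T_g. *)
Lemma TT_eq0 h g h' w : inH h -> inH h' -> g \in unitmx -> isotypic w ->
  h *m g = g *m h' -> theta (h 0 1) != theta (h' 0 1) -> TT g w = 0.
Proof.
move=> hh hh' ug hw e th.
have := TT_mul hh inH1 ug hw; rewrite mulmx1 e -[g *m h']mul1mx mulmxA.
rewrite (TT_mul inH1 hh' ug hw) !mxE /= theta0 mul1r mulr1 => /eqP.
by rewrite eq_sym -subr_eq0 -scalerBl scaler_eq0 subr_eq0 (negbTE th) => /eqP.
Qed.

Lemma theta_sig g : theta (sig g 0 1) = theta (g 0 1).
Proof. by rewrite !mxE. Qed.

(** [sig] turns h g = g h' into sig h' sig g = sig g sig h, so T vanishes at g and at sig g
    alike. *)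
Lemma TT_sig_eq0 h g h' w : inH h -> inH h' -> g \in unitmx -> isotypic w ->
  h *m g = g *m h' -> theta (h 0 1) != theta (h' 0 1) -> TT (sig g) w = TT g w.
Proof.
move=> hh hh' ug hw e th; rewrite (TT_eq0 hh hh' ug hw e th).
apply: (@TT_eq0 (sig h') _ (sig h)); rewrite ?sig_inH ?sig_unit //.
  by rewrite -!sigM e.
by rewrite !theta_sig eq_sym.
Qed.

(* Either d / a is 1 mod p ^ m and torus elements exchange a and d, or some h, h' in H with
   h g = g h' and theta h <> theta h' force both sides to vanish. *)
Lemma TT_sig_aux a b c d w : isotypic w -> mat2 a b c d \in unitmx ->
  ~~ ival (val_lf v c) (d - a) || (c == 0) -> a != 0 -> (d == 0) || (val_lf v a <= val_lf v d) ->
  TT (sig (mat2 a b c d)) w = TT (mat2 a b c d) w.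
Proof.
move=> hw ug hc a0 hd; rewrite /sig !mxE /=.
have da : ival 0 (d / a) by rewrite ivalVM // add0r.
have [hda|hda] := boolP (ival m (d / a - 1)).
  have ud := vunit_cong1 (m_gt0 : 0 < m%:Z) hda; have d0 : d != 0.
    by apply: contraTneq ud => ->; rewrite mul0r /(vunit _) eqxx.
  have -> : mat2 d b c a = dg (d / a) 1 *m mat2 a b c d *m dg 1 (a / d).
    by rewrite !mat2M; congr mat2; field; rewrite ?a0 ?d0.
  rewrite (TT_mul _ _ ug hw) ?inHE ?subrr ?ival0 ?hda //.
    by rewrite !mxE /= theta0 mulr1 scale1r.
  have -> : a / d - 1 = - ((d / a - 1) / (d / a)) by field; rewrite a0 d0.
  by rewrite ivalN ivalMu ?vunitV ?hda.
have hca : ival 0 (c / a).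
  rewrite ivalVM // add0r; case/orP: hc => [hc|/eqP->]; last exact: ival0.
  have [->|c0] := eqVneq c 0; first exact: ival0.
  rewrite ival_val //; rewrite leNgt; apply: contra hc => hc.
  by apply: ivalB; [exact: ivalW (ltW hc) hd|rewrite ival_val // ltW].
(* Such a q makes the matrices of [H1] and [H2] below satisfy h g = g h', with the distinct values
   theta(q) and theta(q d / a). If there were none, theta would be trivial on q (d / a - 1) for all
   integral q with q c / a in p^m; primitivity would then put d / a - 1 in p^m or d - a in c o, and
   both are excluded. *)
have [q [hq qca hth]] : exists q, [/\ ival 0 q, ival m (q * (c / a)) & theta q != theta (q * (d / a))].
  apply: contrapT => nex.
  have main i : 0 <= i -> (forall q, ival i q -> ival m (q * (c / a))) -> ival (m%:Z - i) (d / a - 1).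
    move=> i0 hi; apply: theta_primitive => q hq; apply: contrapT => ne; apply: nex; exists q; split.
    - exact: ivalW hq.
    - exact: hi.
    - apply: contra_not_neq ne => e; rewrite mulrBl mul1r mulrC thetaD -e thetaN mulfV //.
  case/orP: hc => [hc|/eqP c0]; last first.
    by move: hda; rewrite -[m%:Z]subr0 main // => q _; rewrite c0 mul0r mulr0 ival0.
  have c0 : c != 0 by apply: contraNneq hda => c0; rewrite -[m%:Z]subr0 main // => q _; rewrite c0 mul0r mulr0 ival0.
  have hca' : 0 <= val_lf v c - val_lf v a by move: hca; rewrite ivalVM // ival_val //; ilia.
  have hmul i q : m%:Z - (val_lf v c - val_lf v a) <= i -> ival i q -> ival m (q * (c / a)).
    move=> hi hq; have := ivalM hq (_ : ival (val_lf v c - val_lf v a) (c / a)).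
    rewrite ivalVM // ival_val //; have -> : val_lf v c - val_lf v a + val_lf v a <= val_lf v c by ilia.
    by move=> /(_ isT); apply: ivalW; ilia.
  have [le|lt] := leP m%:Z (val_lf v c - val_lf v a).
    by move: hda; rewrite -[m%:Z]subr0 main // => q hq; apply: hmul hq; ilia.
  have := main (m%:Z - (val_lf v c - val_lf v a)) _ (fun q => hmul _ q (lexx _)).
  rewrite subr_ge0 (ltW lt) => /(_ isT).
  have -> : d / a - 1 = (d - a) / a by field.
  rewrite ivalVM // => h; move: hc; rewrite (_ : val_lf v c = m%:Z - (m%:Z - (val_lf v c - val_lf v a)) + val_lf v a) ?h //.
  by ilia.
have H1 : inH (mat2 (1 - q * (c / a)) q 0 1).
  rewrite inHE subrr !ival0 hq /= andbT.
  by rewrite (_ : 1 - q * (c / a) - 1 = - (q * (c / a))); [rewrite ivalN|ring].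
have H2 : inH (mat2 1 (q * (d / a)) 0 (1 - q * (c / a))).
  rewrite inHE subrr !ival0 /= (ivalMo hq da) /=.
  by rewrite (_ : 1 - q * (c / a) - 1 = - (q * (c / a))); [rewrite ivalN|ring].
have := TT_sig_eq0 H1 H2 ug hw; rewrite /sig !mxE /=; apply=> //.
by rewrite !mat2M; congr mat2; field.
Qed.

(** If c divides d - a, then up((d - a) / c) conjugates g to sig g, and its two contributions to
    theta cancel. Otherwise [TT_sig_aux] applies, after exchanging a and d when d has the smaller
    valuation. *)
Lemma TT_sig g w : g \in unitmx -> isotypic w -> TT (sig g) w = TT g w.
Proof.
rewrite (mat2_eta g); move: (g 0 0) (g 0 1) (g 1 0) (g 1 1) => a b c d ug hw.
have [/andP[c0 hda]|hn] := boolP ((c != 0) && ival (val_lf v c) (d - a)).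
  have hy : ival 0 ((d - a) / c) by rewrite ivalVM // add0r.
  have -> : sig (mat2 a b c d) = up ((d - a) / c) *m mat2 a b c d *m up (- ((d - a) / c)).
    by rewrite /sig !mxE /= !mat2M; congr mat2; field.
  rewrite (TT_mul _ _ ug hw) ?inHE ?subrr ?ival0 ?ivalN ?hy //.
  by rewrite !mxE /= -thetaD addrN theta0 scale1r.
have hc : ~~ ival (val_lf v c) (d - a) || (c == 0) by move: hn; rewrite negb_and negbK orbC.
have [a0|a0] := eqVneq a 0; have [d0|d0] := eqVneq d 0.
- by rewrite a0 d0 /sig !mxE.
- have us : mat2 d b c a \in unitmx by move: ug; rewrite !unit_mat2 [a * d]mulrC.
  have := @TT_sig_aux d b c a w hw us; rewrite /sig !mxE /= => h; apply/esym/h => //.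
    by rewrite ivalBC.
  by rewrite a0 eqxx.
- by apply: TT_sig_aux; rewrite // d0 eqxx.
have [le|lt] := leP (val_lf v a) (val_lf v d).
  by apply: TT_sig_aux; rewrite // le orbT.
have us : mat2 d b c a \in unitmx by move: ug; rewrite !unit_mat2 [a * d]mulrC.
have := @TT_sig_aux d b c a w hw us; rewrite /sig !mxE /= => h; apply/esym/h => //.
  by rewrite ivalBC.
by rewrite (ltW lt) orbT.
Qed.

Lemma TT_comp g h K w : g \in unitmx -> h \in unitmx -> level K (tau h w) ->
  TT g (TT h w) = (size (RH K))%:R^-1 *: \sum_(t <- RH K) (theta (t 0 1))^-1 *: TT (g *m t *m h) w.
Proof.
move=> ug uh hK; have [_ RH_ _ _ _] := RHP K.
rewrite /TT (eE hK) tauZ eZ linear_sum /= e_sum; congr (_ *: _).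
apply: eq_big_seq => t /RH_/inH_unit ut; rewrite tauZ eZ; congr (_ *: e_ _).
by rewrite !(tauM tau_rep) ?unitmx_mul ?ug.
Qed.

(** By [TT_comp] both products are averages over H, of the T at g t h and at sig h t' sig g
    respectively; t' = sig t matches the terms, as sig (g t h) = sig h sig t sig g. *)
Lemma TT_comm g h w : g \in unitmx -> h \in unitmx -> isotypic w ->
  TT g (TT h w) = TT h (TT g w).
Proof.
move=> ug uh hw.
have [K1 h1] := levelP (tau h w); have [K2 h2] := levelP (tau (sig g) w).
have {}h1 := level_le (leq_maxl K1 K2) h1; have {}h2 := level_le (leq_maxr K1 K2) h2.
rewrite (TT_comp ug uh h1) -(TT_sig ug hw) -(TT_sig uh) ?(TT_comp _ _ h2) ?sig_unit //; last exact: e_isotypic.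
congr (_ *: _); set K := maxn K1 K2; have [uR RH_ _ _ sR] := RHP K.
apply: (sum_rel (E := fun t t' => t' = sig t)) => // [t tR|t1 t2 t' _ _ _ -> /(inv_inj sigK)|t t' tR _ ->] //.
  by exists (sig t) => //; exact: sR.
rewrite theta_sig -!sigM mulmxA TT_sig // !unitmx_mul ug uh andbT /=.
exact/inH_unit/RH_.
Qed.

(* Gelfand's trick: as T_(sig g) = T_g for the anti-involution [sig], the T_g commute, and an
   eigenvector shows that each of them is a scalar. *)
Lemma isotypic_dim1 x y : isotypic x -> x != 0 -> isotypic y -> exists c, y = c *: x.
Proof.
move=> hx x0 hy; have [_ irr] := tau_irr.
have iso_lin a w w' : isotypic w -> isotypic w' -> isotypic (a *: w + w').
  by move=> h h' g hg; rewrite linearP /= h // h' // scalerDr !scalerA mulrC.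
(* The vectors u with every T_g u in E form a tau-stable subspace, which is all of V once it
   contains w. It is applied with E an eigenspace of one T_g, and with E the line through x. *)
have H1 w (E : V -> Prop) : E 0 -> (forall a u u', E u -> E u' -> E (a *: u + u')) ->
    isotypic w -> w != 0 -> (forall g, g \in unitmx -> E (TT g w)) -> forall z, isotypic z -> E z.
  move=> E0 EL hw w0 ETT z hz.
  pose S (u : V) : Prop := forall g, g \in unitmx -> E (TT g u).
  have [|||hS|hS] := irr S.
  - by move=> g _; rewrite /TT linear0 e0.
  - by move=> a u u' hu hu' g ug; rewrite /TT linearP e_lin; apply: EL; [exact: hu|exact: hu'].
  - move=> g u ug hu h uh; rewrite /TT -(tauM tau_rep) //; apply: hu.
    by rewrite unitmx_mul uh.
  - by move: w0; rewrite (hS w) ?eqxx.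
  - by have := hS z 1%:M (unitmx1 _ _); rewrite /TT (tau1 tau_rep) e_id.
have scal g : g \in unitmx -> exists l, forall z, isotypic z -> TT g z = l *: z.
  (* Isotypic vectors are fixed by the principal congruence subgroup of level m, where b lies in p^m
     and theta(b) = 1; admissibility gives the finite dimension that an eigenvector requires. *)
  move=> ug; have [d hd] := tau_fin m.
  have [||||||l [z [hz z0 ez]]] := @eigenvector C V _ isotypic d (TT g) x hd => //.
  - move=> u hu k /GL2_congP[a [b [c [d' [-> [ha hb] [hc hd'] hD]]]]].
    rewrite hu ?inHE ?ha ?hc ?hd' ?(ivalW _ hb) //.
    by rewrite !mxE /= theta_m // scale1r.
  - by move=> u _; exact: e_isotypic.
  - by move=> a u u'; rewrite /TT linearP e_lin.
  exists l; apply: (H1 z (fun u => TT g u = l *: u)) => //.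
  - by rewrite /TT linear0 e0 scaler0.
  - move=> a u u' hu hu'; rewrite {1}/TT linearP e_lin -!/(TT g _) hu hu'.
    by rewrite scalerDr !scalerA mulrC.
  - by move=> h uh; rewrite TT_comm // ez /TT tauZ eZ.
apply: (H1 x (fun u => exists c, u = c *: x)) => //.
- by exists 0; rewrite scale0r.
- by move=> a _ _ [c ->] [c' ->]; exists (a * c + c'); rewrite scalerDl scalerA.
- by move=> g /scal[l hl]; exists l; exact: hl.
Qed.

End Gelfand.

(** * Dimension of the vectors fixed by K1(p^k) *)

Section Newforms.
Variables (F : fieldType) (v : local_field F) (C : numClosedFieldType) (V : lmodType C).
Variable tau : 'M[F]_2 -> {linear V -> V}.
Hypothesis tau_rep : is_rep tau.
Hypothesis tau_adm : admissible v tau.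
Hypothesis tau_irr : irreducible_rep tau.
Hypothesis tau_gen : generic v tau.
Local Notation ival := (ival v).
Local Notation vunit := (vunit v).
Local Notation fx := (fx tau).
Local Notation upi := (upi v).
Local Notation dl := (dl v).
Local Notation VK n := (fixed_by tau (K1 v n)).
Implicit Types (w u : V).

Let tau_smooth := tau_adm.1.

Lemma tau_fin k : exists d, has_dim (fixed_by tau (GL2_cong v k)) d.
Proof.
apply: tau_adm.2; split; last by exists k.
- by move=> g [[]].
- by rewrite -mat2_1; apply: GL2_cong_mat2; rewrite ?subrr ?ival0 // mulr1 mulr0 subr0 vunit1.
- move=> g h /GL2_congE[Gg hg] /GL2_congE[Gh hh]; apply/GL2_congE; split; first exact: GLinoM.
  rewrite (_ : _ - _ = g *m (h - 1%:M) + (g - 1%:M)); last by rewrite mulmxBr mulmx1 addrA subrK.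
  by apply: mxivalD => //; apply: mxivaloM => //; case/GLinoP: Gg.
- move=> g /GL2_congE[Gg hg]; apply/GL2_congE; split; first exact: GLinV.
  have [ug _ _] := Gg; rewrite -[X in _ - X](mulVmx ug) -{1}[invmx g]mulmx1 -mulmxBr.
  by apply: mxivaloM; [case/GLinoP: (GLinV Gg)|exact: mxivalBC].
Qed.

(** The Whittaker character psi is rescaled. As psi is nontrivial at x0, there is a largest ideal
    p^c on which it is trivial; multiplying the argument by pi^(c - m) moves c to m. *)
Lemma primitive_character (m : nat) : exists theta : F -> C,
  [/\ forall x y, theta (x + y) = theta x * theta y, forall x, theta x != 0,
      forall x, ival m x -> theta x = 1 & exists2 z, ival (m%:Z - 1) z & theta z != 1].
Proof.
have [psi [[psi0 psiD [k psik]] [x0 psix0] _]] := tau_gen.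
have {}psik x : ival k x -> psi x = 1 by move=> /ppowP; exact: psik.
pose P (i : nat) := `[< forall x, ival (k%:Z - i%:Z) x -> psi x = 1 >].
have x0n : x0 != 0.
  by apply: contraNneq psix0 => ->; rewrite psik ?ival0.
have [|i hi|i /asboolP hi maxi] := @ex_maxnP P `|k%:Z - val_lf v x0|%N.
- by exists 0%N; apply/asboolP => x; rewrite subr0; exact: psik.
- rewrite leqNgt; apply: contra psix0 => hlt; apply/eqP; move/asboolP: hi; apply.
  by rewrite ival_val //; lia.
pose c := k%:Z - i%:Z.
exists (fun x => psi (upi (c - m%:Z) * x)); split=> //.
- by move=> x y; rewrite mulrDr psiD.
- by move=> x hx; apply: hi; rewrite ival_upiM -/c; apply: ivalW hx; lia.
- apply: contrapT => nex; suff : P i.+1 by move/maxi; rewrite ltnn.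
  apply/asboolP => x hx; apply: contrapT => psix; apply: nex.
  exists (x / upi (c - m%:Z)); last by rewrite mulrC divfK ?upi_neq0 //; apply/eqP.
  by rewrite ivalVM ?upi_neq0 // val_upi; apply: ivalW hx; rewrite /c; lia.
Qed.

Section Projection.
Variables (k : nat) (theta : F -> C).
Hypothesis k_gt0 : (0 < k)%N.
Hypothesis thetaD : forall x y, theta (x + y) = theta x * theta y.
Hypothesis theta_neq0 : forall x, theta x != 0.
Hypothesis theta_k : forall x, ival k x -> theta x = 1.
Hypothesis theta_k1 : exists2 z, ival (k%:Z - 1) z & theta z != 1.

Let theta0 := theta0 theta_k.
Let thetaN := thetaN thetaD theta_neq0 theta_k.
Let theta_cong := theta_cong thetaD theta_k.

Let s := projT1 (cid (residue_transversal v k)).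
Let us : uniq s. Proof. by rewrite /s; case: cid => ? []. Qed.
Let so x : x \in s -> ival 0 x. Proof. by rewrite /s; case: cid => ? /= [_ h _ _]; exact: h. Qed.
Let sc x : ival 0 x -> exists2 y, y \in s & ival k (x - y).
Proof. by rewrite /s; case: cid => ? /= [_ _ h _]; exact: h. Qed.
Let si x y : x \in s -> y \in s -> ival k (x - y) -> x = y.
Proof. by rewrite /s; case: cid => ? /= [_ _ _ h]; exact: h. Qed.

Lemma sum_affine (G : nmodType) (f g : F -> G) a b : vunit a -> ival 0 b ->
  (forall x y, ival 0 x -> ival 0 y -> ival k (a * x + b - y) -> f x = g y) ->
  \sum_(x <- s) f x = \sum_(x <- s) g x.
Proof.
move=> ua ob h; apply: (sum_rel (E := fun x y => ival k (a * x + b - y))) => //.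
- by move=> x /so ox; apply: sc; apply: ivalD => //; apply: ivaloM => //; exact: vunit_ival.
- move=> x1 x2 y h1 h2 _ e1 e2; apply: si => //; rewrite -(ivalMu _ _ ua).
  by have := ivalB e1 e2; congr (ival _ _); ring.
- by move=> x y /so ox /so oy; exact: h.
Qed.

Variable w : V.
Hypothesis w_K1 : VK k w.
(** Conjugation by delta^(-k) exchanges the two depths: w' is fixed by the upper unipotents of p^k
    and the lower ones of o, so sums over o / p^k of its upper translates make sense. *)
Let w' := tau (dl (- k%:Z)) w.

Lemma w'_up x : ival k x -> fx (up x) w'.
Proof.
move=> hx; rewrite /w' -[x](mulfK (upi_neq0 v (- k%:Z))); apply: (fx_up_dl v tau_rep).
apply: (K1_up w_K1); rewrite mulrC ival_upiM; apply: ivalW hx; lia.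
Qed.

Lemma w'_lo x : ival 0 x -> fx (lo x) w'.
Proof.
move=> hx; rewrite /w' -[x](divfK (upi_neq0 v (- k%:Z))) mulrC; apply: (fx_lo_dl v tau_rep).
apply: (K1_lo w_K1); rewrite ivalVM ?upi_neq0 // val_upi; apply: ivalW hx; lia.
Qed.

Lemma w'_dg a d : ival k (a - 1) -> vunit d -> fx (dg a d) w'.
Proof.
move=> ha hd; have ua : vunit a by apply: vunit_cong1 ha; lia.
by rewrite /w'; apply: (fx_dg_dl v tau_rep); rewrite ?(vunit_neq0 ua) ?(vunit_neq0 hd) //; exact: (K1_dg w_K1 ua ha hd).
Qed.

Lemma w'_cong x y : ival k (x - y) -> tau (up x) w' = tau (up y) w'.
Proof.
move=> h; rewrite -[x](subrK y) addrC upD (tauM tau_rep) ?up_unit //.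
by have [_ ->] := w'_up h.
Qed.

(** Up to a scalar, the component of w' on which the upper unipotent of z in o acts by theta(y
    z). *)
Definition fourier y := \sum_(x <- s) theta (- (y * x)) *: tau (up x) w'.

Lemma tau_up_fourier y z : ival 0 y -> ival 0 z -> tau (up z) (fourier y) = theta (y * z) *: fourier y.
Proof.
move=> oy oz; rewrite /fourier linear_sum scaler_sumr.
apply: (sum_affine (a := 1) (b := z)) => // [|x x' ox ox']; first exact: vunit1.
rewrite mul1r => h; rewrite (tauZ tau) -(tauM tau_rep) ?up_unit // -upD scalerA.
rewrite (w'_cong (_ : ival k (z + x - x'))); last by rewrite [z + x]addrC.
congr (_ *: _); rewrite -thetaD; apply: theta_cong.
have -> : - (y * x) - (y * z - y * x') = - (y * (x + z - x')) by ring.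
by rewrite ivalN ivaloM.
Qed.

(** diag(1, y) fixes w' and rescales the variable of summation, so all unit frequencies are
    translates of frequency 1. *)
Lemma fourier_unit y : vunit y -> fourier y = tau (dg 1 y) (fourier 1).
Proof.
move=> uy; have y0 := vunit_neq0 uy; rewrite /fourier linear_sum; apply/esym.
apply: (sum_affine (a := y^-1) (b := 0)); rewrite ?vunitV ?ival0 // => x x' ox ox'.
rewrite addr0 => h; rewrite mul1r (tauZ tau) -(tauM tau_rep) ?up_unit ?dg_unit ?oner_neq0 //.
have -> : dg 1 y *m up x = up (y^-1 * x) *m dg 1 y by rewrite !mat2M; congr mat2; field.
rewrite (tauM tau_rep) ?up_unit ?dg_unit ?oner_neq0 //.
have [_ ->] : fx (dg 1 y) w' by apply: w'_dg; rewrite // subrr ival0.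
rewrite (w'_cong h); congr (_ *: _); apply: theta_cong.
have -> : - x - - (y * x') = - (y * (y^-1 * x - x')) by field.
by rewrite ivalN ivaloM // vunit_ival.
Qed.

(** Orthogonality of characters: for x outside p^k primitivity yields t with theta(t x) <> 1, while
    translation by t shows the sum unchanged under multiplication by theta(- t x). *)
Lemma sum_theta x : ival 0 x -> ~~ ival k x -> \sum_(y <- s) theta (- (y * x)) = 0.
Proof.
move=> ox nx.
have [t [ot ht]] : exists t, ival 0 t /\ theta (t * x) != 1.
  apply: contrapT => nex; move/negP: nx; apply; rewrite -[k%:Z]subr0.
  apply: (theta_primitive k_gt0 theta_k1) => t ot; apply: contrapT => h; apply: nex.
  by exists t; split=> //; apply/eqP; rewrite mulrC.
apply: (mulfI (_ : 1 - theta (- (t * x)) != 0)).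
  by rewrite subr_eq0 eq_sym thetaN invr_eq1.
rewrite mulr0 mulrBl mul1r mulr_sumr; apply/eqP; rewrite subr_eq0; apply/eqP/esym.
apply: (sum_affine (a := 1) (b := t)) => // [|y y' oy oy']; first exact: vunit1.
rewrite mul1r => h; rewrite -thetaD; apply: theta_cong.
have -> : - (t * x) - y * x - - (y' * x) = - ((y + t - y') * x) by ring.
by rewrite ivalN ivalMo.
Qed.

(* Fourier inversion on o / p ^ k: [w'] is recovered from the [fourier y]. *)
Lemma fourier_eq0 : fourier 1 = 0 -> VK k.-1 (tau (dl (- 1)) w).
Proof.
move=> f1.
have hz z : ival (k%:Z - 1) z -> fx (up z) w'.
  move=> hz; have oz : ival 0 z by apply: ivalW hz; lia.
  have [x0 x0s hx0] := sc (ival0 v 0); rewrite sub0r ivalN in hx0.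
  have s0 : (size s)%:R != 0 :> C by rewrite pnatr_eq0; case: {+}s x0s.
  have : \sum_(y <- s) fourier y = (size s)%:R *: w'.
    rewrite /fourier exchange_big /=; under eq_bigr => x _ do rewrite -scaler_suml.
    rewrite (bigD1_seq x0) //= [X in _ + X]big_seq_cond [X in _ + X]big1 ?addr0.
      rewrite (eq_big_seq (fun=> 1)) => [|y /so oy].
        rewrite big_const_seq count_predT iter_addr_0 (w'_cong (y := 0)) ?subr0 //.
        by rewrite /up mat2_1 (tau1 tau_rep).
      by rewrite theta_k // ivalN ivaloM.
    move=> x /andP[xs xx0]; rewrite sum_theta ?scale0r //; first exact: so.
    by apply: contra xx0 => hx; apply/eqP; apply: si => //; exact: ivalB.
  move/esym/(canRL (scalerK s0)) => ->; apply: fxZ; rewrite big_seq.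
  apply: fx_sum; first exact: up_unit.
  move=> y /so oy; split; first exact: up_unit.
  (* Unit frequencies vanish with frequency 1. For y in p and z in p^(k - 1), the factor theta(y z)
     is 1, so the remaining components are fixed by the unipotent of z. *)
  have [uy|nuy] := boolP (vunit y); first by rewrite fourier_unit // f1 !linear0.
  rewrite tau_up_fourier // theta_k ?scale1r //.
  by have := ivalM (nvunit oy nuy) hz; apply: ivalW; lia.
have -> : tau (dl (-1)) w = tau (dl k.-1) w'.
  by rewrite -(tau_dlD v tau_rep); congr (tau (dl _) _); lia.
apply: (K1_gen tau_rep) => [x hx|y hy|d hd].
- rewrite -[x](mulfK (upi_neq0 v k.-1)); apply: (fx_up_dl v tau_rep); apply: hz.
  by rewrite mulrC ival_upiM; apply: ivalW hx; lia.
- rewrite -[y](divfK (upi_neq0 v k.-1)) mulrC; apply: (fx_lo_dl v tau_rep); apply: w'_lo.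
  by rewrite ivalVM ?upi_neq0 // val_upi; apply: ivalW hy; lia.
- apply: (fx_dg_dl v tau_rep); rewrite ?oner_neq0 ?(vunit_neq0 hd) //.
  by apply: w'_dg; rewrite // subrr ival0.
Qed.

(** H is generated by lower unipotents of p^k, a torus and upper unipotents of o. Moving a lower
    unipotent of y past the upper one of x replaces x by x / (1 + y x), which is x modulo p^k and so
    changes nothing. *)
Lemma fourier_isotypic : isotypic v tau k theta (fourier 1).
Proof.
move=> g; rewrite (mat2_eta g) inHE mxE /=.
move: (g 0 0) (g 0 1) (g 1 0) (g 1 1) => a b c d /and4P[ha hb hc hd].
have k0 : 0 < k%:Z by lia.
have ua := vunit_cong1 k0 ha; have a0 := vunit_neq0 ua.
have ud := vunit_cong1 k0 hd.
have aux x x' : ival k (x - x') -> theta (- (1 * x)) *: tau (up x') w' = theta (- (1 * x)) *: tau (up x) w'.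
  by move=> h; congr (_ *: _); apply/esym/w'_cong.
have Hlo y : ival k y -> tau (lo y) (fourier 1) = fourier 1.
  move=> hy; rewrite /fourier linear_sum; apply: eq_big_seq => x /so ox.
  have u1 : vunit (1 + y * x) by apply: vunitD (vunit1 _) _; apply: ivalMo ox; apply: ivalW hy; lia.
  have n1 := vunit_neq0 u1.
  rewrite (tauZ tau) -(tauM tau_rep) ?lo_unit ?up_unit //.
  have -> : lo y *m up x = up (x / (1 + y * x)) *m (dg (1 + y * x)^-1 (1 + y * x) *m lo (y / (1 + y * x))).
    by rewrite !mat2M; congr mat2; field.
  rewrite (tauM tau_rep) ?up_unit ?unitmx_mul ?dg_unit ?lo_unit ?invr_eq0 //.
  have h1 : fx (lo (y / (1 + y * x))) w' by apply: w'_lo; rewrite ivalMu ?vunitV //; exact: ivalWn hy.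
  have h2 : fx (dg (1 + y * x)^-1 (1 + y * x)) w'.
    apply: w'_dg => //; have -> : (1 + y * x)^-1 - 1 = - (y * x / (1 + y * x)) by field.
    by rewrite ivalN ivalMu ?vunitV // ivalMo.
  have [_ ->] := fxM tau_rep h2 h1; apply: aux.
  have -> : x - x / (1 + y * x) = y * x * x / (1 + y * x) by field.
  by rewrite ivalMu ?vunitV // !ivalMo.
have Hdg d' : ival k (d' - 1) -> tau (dg a d') (fourier 1) = fourier 1.
  move=> hd'; have ud' := vunit_cong1 k0 hd'; have d0 := vunit_neq0 ud'.
  rewrite /fourier linear_sum; apply: eq_big_seq => x /so ox.
  rewrite (tauZ tau) -(tauM tau_rep) ?dg_unit ?up_unit //.
  have -> : dg a d' *m up x = up (x * a / d') *m dg a d' by rewrite !mat2M; congr mat2; field.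
  rewrite (tauM tau_rep) ?up_unit ?dg_unit //.
  have [_ ->] := w'_dg ha ud'; apply: aux.
  have -> : x - x * a / d' = x * ((d' - 1) - (a - 1)) / d' by field.
  by rewrite ivalMu ?vunitV // ivaloM // ivalB.
have -> : mat2 a b c d = lo (c / a) *m (dg a (d - b * c / a) *m up (b / a)).
  by rewrite !mat2M; congr mat2; field.
have hd' : ival k (d - b * c / a - 1).
  have -> : d - b * c / a - 1 = (d - 1) - b * c / a by ring.
  by apply: ivalB => //; rewrite ivalMu ?vunitV // ivaloM.
have d'0 := vunit_neq0 (vunit_cong1 k0 hd').
rewrite (tauM tau_rep) ?lo_unit ?unitmx_mul ?dg_unit ?up_unit //.
rewrite (tauM tau_rep) ?dg_unit ?up_unit // tau_up_fourier ?ival1 ?ivalMu ?vunitV // !(tauZ tau).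
rewrite Hdg // Hlo ?ivalMu ?vunitV // mul1r; congr (_ *: _); apply: theta_cong.
have -> : b / a - b = - (b * (a - 1)) / a by field.
by rewrite ivalMu ?vunitV // ivalN ivaloM.
Qed.

End Projection.

(* V^K1(k) / delta V^K1(k-1) embeds, by w |-> [fourier w 1], into a space of dimension at most 1. *)
Lemma K1_quotient k w u : (0 < k)%N -> VK k w -> VK k u -> ~ VK k.-1 (tau (dl (- 1)) w) ->
  exists c, VK k.-1 (tau (dl (- 1)) (u - c *: w)).
Proof.
move=> k0 hw hu nw; have [theta [thD th0 thk thk1]] := primitive_character k.
have [c hc] : exists c, fourier k theta u 1 = c *: fourier k theta w 1.
  apply: (isotypic_dim1 tau_rep tau_smooth tau_fin tau_irr k0 thD th0 thk thk1).
  - exact: fourier_isotypic.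
  - by apply/eqP => /fourier_eq0; apply: contra_not nw; apply.
  - exact: fourier_isotypic.
exists c; apply: (fourier_eq0 k0 thD th0 thk thk1).
  by move=> g hg; rewrite linearB /= (tauZ tau) hw // hu.
transitivity (fourier k theta u 1 - c *: fourier k theta w 1); last by rewrite hc subrr.
rewrite /fourier scaler_sumr -sumrB; apply: eq_bigr => x _.
by rewrite !(tauB tau, tauZ tau) scalerBr !scalerA [c * _]mulrC.
Qed.

(** The vector is fixed by GL_2(o) and by its conjugate under delta. Together they contain
    diag(1/pi, pi), and conjugation by it enlarges the fixed unipotents until [up_fixed_eq0]
    applies. *)
Lemma K1_0_dl w : VK 0 w -> VK 0 (tau (dl (- 1)) w) -> w = 0.
Proof.
move=> hw hw'; apply: (up_fixed_eq0 tau_rep tau_smooth tau_irr tau_gen) => x.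
pose p := upi 1; have p0 : p != 0 := upi_neq0 v 1.
have hup y : ival (-1) y -> fx (up y) w.
  move=> hy; rewrite -(tau_dlVK v tau_rep 1 w) -[y](mulfK p0); apply: (fx_up_dl v tau_rep).
  by apply: (K1_up hw'); rewrite mulrC ival_upiM; apply: ivalW hy; lia.
have hT : fx (dg p^-1 p) w.
  have -> : dg p^-1 p = up p^-1 *m (lo (- p) *m (up p^-1 *m mat2 0 (-1) 1 0)).
    by rewrite !mat2M; congr mat2; field.
  have hp : fx (up p^-1) w by apply: hup; rewrite /p -upiN ival_upi.
  apply: (fxM tau_rep) => //; apply: (fxM tau_rep).
    by apply: (K1_lo hw); rewrite ivalN; apply: (@ivalW _ v 1); rewrite ?ival_upi.
  apply: (fxM tau_rep) => //; move/fixed_K1: hw; apply; apply: K1_mat2; rewrite ?sub0r ?ivalN ?ival0 ?ival1 //.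
  by rewrite mul0r mulN1r opprK add0r vunit1.
have hj (j : nat) : forall y, ival (- j%:Z) y -> fx (up y) w.
  elim: j => [|j IH] y hy; first by apply: hup; apply: ivalW hy; lia.
  have [uT eT] := hT; rewrite -eT.
  apply: (fx_conj tau_rep uT (up_unit _) _ (IH (y * p ^+ 2) _)).
    by rewrite !mat2M; congr mat2; field.
  by rewrite /p expr2 mulrA !(mulrC _ (upi 1)) !ival_upiM; apply: ivalW hy; lia.
have [->|x0] := eqVneq x 0; first exact: (hj 0%N _ (ival0 _ _)).
by apply: (hj `|val_lf v x|%N); rewrite ival_val //; lia.
Qed.

Section Oldforms.
Variables (n : nat) (w : V).
Hypothesis w_neq0 : w != 0.
Hypothesis w_K1 : VK n w.
Hypothesis n_min : forall k u, u != 0 -> VK k u -> (n <= k)%N.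

(** [K1_quotient] is used with the newform w itself: were delta^(-1) w fixed at the level below,
    induction would write w as a combination of delta w, delta^2 w, ..., against [dl_rel_eq0]. Thus
    u - c w = delta u' with u' of lower level. *)
Lemma oldforms_span j u : VK (n + j) u ->
  exists c : nat -> C, u = \sum_(i < j.+1) c i *: tau (dl i) w.
Proof.
elim: j u => [|j IH] u hu.
  suff [c hc] : exists c, u - c *: w = 0.
    exists (fun=> c); rewrite big_ord1 (dl0 v) (tau1 tau_rep).
    by apply/eqP; rewrite -subr_eq0 hc.
  rewrite addn0 in hu.
  have dlI x : tau (dl (-1)) x = 0 -> x = 0.
    by move/(congr1 (tau (dl 1))); rewrite (tau_dlVK v tau_rep 1) linear0.
  (* At level n = 0 there is no level below: the vectors are viewed at level 1, and [K1_0_dl] says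
     that level 0 meets its translate by delta only in 0. For n > 0 minimality of n makes level n -
     1 zero. *)
  have [n0|npos] := posnP n.
    have h0 x : VK n x -> VK 0 (tau (dl (-1)) x) -> x = 0 by rewrite n0; exact: K1_0_dl.
    have h1 x : VK n x -> VK 1 x by move=> hx; apply: (K1_mono tau_rep _ hx); rewrite n0.
    have [|c hc] := K1_quotient (ltn0Sn _) (h1 _ w_K1) (h1 _ hu).
      by move/(h0 _ w_K1) => w0; move: w_neq0; rewrite w0 eqxx.
    exists c; apply: h0 hc => g hg; by rewrite linearB /= (tauZ tau) hu // w_K1.
  have h0 x : VK n.-1 x -> x = 0.
    by move=> hx; apply/eqP; apply: contraT => /n_min/(_ hx); rewrite -ltnS prednK // ltnn.
  have [|c hc] := K1_quotient npos w_K1 hu.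
    by move/h0/dlI => w0; move: w_neq0; rewrite w0 eqxx.
  by exists c; apply: dlI; exact: h0.
rewrite addnS in hu.
have hw : VK (n + j).+1 w by apply: (K1_mono tau_rep _ w_K1); lia.
have [|c /IH[c' hc']] := K1_quotient (ltn0Sn _) hw hu.
  move=> /IH[c hc]; move/eqP: w_neq0; apply.
  apply: (dl_rel_eq0 tau_rep tau_smooth tau_irr tau_gen (N := j.+1) (c := c) w_K1).
  rewrite -{1}(tau_dlVK v tau_rep 1 w) hc linear_sum; apply: eq_bigr => i _ /=.
  by rewrite (tauZ tau) -(tau_dlD v tau_rep); congr (_ *: tau (dl _) _); lia.
exists (fun i => if i is i'.+1 then c' i' else c).
rewrite big_ord_recl (dl0 v) (tau1 tau_rep) -[LHS](subrK (c *: w)) addrC; congr (_ + _).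
rewrite -(tau_dlVK v tau_rep 1 (u - _)) hc' linear_sum; apply: eq_bigr => i _ /=.
by rewrite (tauZ tau) -(tau_dlD v tau_rep); congr (_ *: tau (dl _) _); rewrite /bump /=; lia.
Qed.

Lemma oldforms_dim j : has_dim (VK (n + j)) j.+1.
Proof.
exists (fun i : 'I_j.+1 => tau (dl i) w); split.
  move=> c hc j0; have /= h := @dl_free _ v _ _ _ tau_rep tau_smooth tau_irr tau_gen n w j.+1 (fun i => c (inord i)) w_K1 w_neq0.
  rewrite -[j0]inord_val; apply: h => //; rewrite -[RHS]hc; apply: eq_bigr => i' _.
  by rewrite inord_val.
move=> u; split=> [/oldforms_span[c ->]|[c ->]]; first by exists (fun i : 'I__ => c i).
move=> g hg; rewrite linear_sum; apply: eq_bigr => i _ /=; rewrite (tauZ tau); congr (_ *: _).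
have le_ij : (n + i <= n + j)%N by rewrite leq_add2l -ltnS.
exact: (K1_mono tau_rep le_ij (@K1_raise _ v _ _ _ tau_rep n i w w_K1) hg).
Qed.

End Oldforms.

(** The truncated subtraction also covers k < n, where minimality of the conductor leaves only 0. *)
Theorem K1_dim n k : has_conductor v tau n -> has_dim (VK k) (k.+1 - n).
Proof.
move=> [[w w0 hw] nmin]; have n_min j u : u != 0 -> VK j u -> (n <= j)%N.
  by move=> u0 hu; apply: nmin; exists u.
have [le|lt] := leqP n k.
  by have := oldforms_dim w0 hw n_min (k - n); rewrite subnKC // subSn.
have -> : (k.+1 - n = 0)%N by lia.
exists (fun=> 0); split=> [c _ []//|u]; split=> [hu|[c ->]].
  exists (fun=> 0); rewrite big_ord0; apply/eqP; apply: contraT => u0.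
  by have := n_min _ _ u0 hu; rewrite leqNgt lt.
by rewrite big_ord0 => g _; rewrite linear0.
Qed.

End Newforms.

(** * Quadratic algebras *)

Section QuadraticAlgebraStructure.
Variables (F : fieldType) (charF : [pchar F] =i pred0).
Variables (L : comUnitAlgType F) (conj : {lrmorphism L -> L}).

Lemma two_neq0 : 2%:R != 0 :> F.
Proof. by have := charF 2%N; rewrite !inE /= => /negbT. Qed.

Lemma algD (a b : F) : (a + b)%:A = a%:A + b%:A :> L. Proof. exact: scalerDl. Qed.
Lemma algN (a : F) : (- a)%:A = - a%:A :> L. Proof. exact: scaleNr. Qed.
Lemma algB (a b : F) : (a - b)%:A = a%:A - b%:A :> L. Proof. exact: scalerBl. Qed.
Lemma algM (a b : F) : (a * b)%:A = a%:A * b%:A :> L.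
Proof. by rewrite mulr_algl scalerA. Qed.
Lemma alg1 : 1%:A = 1 :> L. Proof. exact: scale1r. Qed.
Lemma alg0 : 0%:A = 0 :> L. Proof. exact: scale0r. Qed.
Lemma algX (a : F) n : (a ^+ n)%:A = a%:A ^+ n :> L.
Proof. by elim: n => [|n IH]; rewrite ?expr0 ?alg1 // !exprS algM IH. Qed.
Definition algE := (algD, algN, algB, algM, alg1, alg0, algX).

Lemma alg_inj (a b : F) : a%:A = b%:A :> L -> a = b.
Proof.
move=> /eqP; rewrite -subr_eq0 -algB scaler_eq0 => /orP[|h]; first by rewrite subr_eq0 => /eqP.
by move: h; rewrite oner_eq0.
Qed.

Lemma conj_alg (a : F) : conj a%:A = a%:A. Proof. by rewrite linearZ rmorph1. Qed.

Lemma conjZ (a : F) x : conj (a *: x) = a *: conj x. Proof. exact: linearZ. Qed.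

Lemma alg_unit (a : F) : a != 0 -> (a%:A : L) \is a GRing.unit.
Proof. by move=> a0; apply/unitrP; exists a^-1%:A; rewrite -!algM mulVf ?mulfV // alg1. Qed.

Lemma invr_eq (x y : L) : x * y = 1 -> x \is a GRing.unit /\ x^-1 = y.
Proof.
move=> e; have ux : x \is a GRing.unit by apply/unitrP; exists y; rewrite mulrC e.
by split=> //; rewrite -[LHS]mulr1 -e mulKr.
Qed.

(* The common structure of both cases: L = F + F b with b^2 = D and conj b = - b. *)
Definition quad_basis (b : L) (D : F) : Prop :=
  [/\ D != 0, conj b = - b, b * b = D%:A &
      forall x, exists x0 x1, x = x0%:A + x1 *: b].

(** Completing the square in the equation of an x moved by conj gives y with y^2 in F, and (conj y -
    y) (conj y + y) = 0 forces conj y = - y. *)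
Lemma quad_basis_field : quadratic_field conj -> exists b D, quad_basis b D.
Proof.
move=> [unitL dimL [x cx]].
have xF a : x != a%:A by apply: contraNneq cx => ->; rewrite conj_alg.
have span (z : L) : exists z0 z1, z = z0%:A + z1 *: x.
  pose f (i : 'I_3) : L := nth 0 [:: 1; x; z] i.
  have [//|c [[i ci] e]] := dependent (x := f) dimL.
  move: e; rewrite !big_ord_recl big_ord0 /f /= addr0.
  set c0 := c _; set c1 := c _; set c2 := c _ => e.
  have c2n : c2 != 0.
    apply: contraNneq ci => c20; move: e; rewrite c20 scale0r addr0 => e.
    have c1n : c1 = 0.
      apply: contraTeq isT => c1n; have := xF (- c0 / c1); rewrite -(inj_eq (scalerI c1n)) scalerA mulrC divfK //.
      by rewrite algN -[X in _ != X]addr0 -[X in _ != _ + X]e addKr eqxx.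
    have c0n : c0 = 0.
      by move/eqP: e; rewrite c1n scale0r addr0 scaler_eq0 oner_eq0 orbF => /eqP.
    have [-> | [-> | ->]] : i = ord0 \/ i = lift ord0 ord0 \/ i = lift ord0 (lift ord0 ord0).
      by case: i => [[|[|[|//]]] ?]; [left|right; left|right; right]; apply/val_inj.
    - by rewrite -/c0 c0n.
    - by rewrite -/c1 c1n.
    - by rewrite -/c2 c20.
  exists (- c0 / c2), (- c1 / c2); apply: (scalerI c2n).
  rewrite scalerDr !scalerA ![c2 * _]mulrC !divfK // !scaleNr -opprD.
  by apply/eqP; rewrite -addr_eq0 addrC -addrA e.
have [a [b xx]] := span (x * x); have n2 := two_neq0.
pose y := x - (b / 2%:R)%:A.
have yy : y * y = (a + (b / 2%:R) ^+ 2)%:A.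
  rewrite /y mulrBr mulrBl xx -[b *: x]mulr_algl (_ : b%:A = (b / 2%:R)%:A *+ 2); last first.
    by rewrite -scaler_nat scalerA mulrC divfK.
  by rewrite algD algX; ring.
have y0 : y != 0 by rewrite subr_eq0.
have uy := unitL _ y0.
have cyy : conj y != y.
  by rewrite /y rmorphB /= conj_alg; apply: contraNneq cx => /addIr ->.
exists y, (a + (b / 2%:R) ^+ 2); split=> //.
- apply/eqP => e; have : y * y \is a GRing.unit by rewrite unitrM uy.
  by rewrite yy e alg0 unitr0.
- have e : (conj y - y) * (conj y + y) = 0.
    have -> : (conj y - y) * (conj y + y) = conj (y * y) - y * y by rewrite rmorphM /=; ring.
    by rewrite yy conj_alg subrr.
  have u : conj y - y \is a GRing.unit by apply: unitL; rewrite subr_eq0.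
  by apply/eqP; rewrite -addr_eq0 -(mulKr u (_ + _)) e mulr0.
- move=> z; have [z0 [z1 ->]] := span z; exists (z0 + z1 * (b / 2%:R)), z1.
  by rewrite /y scalerBr scalerA algD -addrA; congr (_ + _); rewrite addrCA subrr addr0.
Qed.

Lemma quad_basis_split : split_quadratic conj -> exists b D, quad_basis b D.
Proof.
move=> [phi [psi phiK psiK] phic]; have phi_inj := can_inj phiK.
have n2 := two_neq0.
pose b := psi (1, -1); exists b, 1; rewrite /quad_basis oner_neq0 alg1; split=> //.
- by apply: phi_inj; rewrite phic rmorphN /= psiK /=; congr pair; rewrite /= opprK.
- by apply: phi_inj; rewrite rmorphM rmorph1 /= psiK; congr pair => /=; rewrite ?mulr1 // mulrNN mulr1.
- move=> x; case e : (phi x) => [p q]; exists ((p + q) / 2%:R), ((p - q) / 2%:R).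
  apply: phi_inj; rewrite rmorphD /= !linearZ /= rmorph1 psiK e.
  by congr pair; rewrite /= ?mulr1 ?mulrN1 /GRing.scale /=; field; exact: n2.
Qed.

Lemma quad_basisP : quadratic_algebra conj -> exists b D, quad_basis b D.
Proof. by case=> [/quad_basis_field|/quad_basis_split]. Qed.

End QuadraticAlgebraStructure.

Lemma hornerAE (F : fieldType) (L : comUnitAlgType F) (x : L) (p : {poly F}) :
  horner_alg x p = \sum_(i < size p) p`_i *: x ^+ i.
Proof.
rewrite [in LHS]/horner_alg /= /horner_morph horner_coef size_map_poly.
by apply: eq_bigr => i _; rewrite coef_map /= mulr_algl.
Qed.

(** * Integral elements and an integral basis *)

Section IntegralBasis.
Variables (F : fieldType) (v : local_field F) (charF : [pchar F] =i pred0).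
Variables (L : comUnitAlgType F) (conj : {lrmorphism L -> L}).
Variables (b : L) (D : F).
Hypothesis qb : quad_basis conj b D.
Local Notation ival := (ival v).
Local Notation upi := (upi v).

Let D_neq0 : D != 0. Proof. by case: qb. Qed.
Let conj_b : conj b = - b. Proof. by case: qb. Qed.
Let bb : b * b = D%:A. Proof. by case: qb. Qed.
Let span x : exists x0 x1, x = x0%:A + x1 *: b. Proof. by case: qb => _ _ _. Qed.
Let n2 : 2%:R != 0 :> F := two_neq0 charF.

Definition re x : F := projT1 (cid (span x)).
Definition im x : F := projT1 (cid (projT2 (cid (span x)))).

Lemma reim x : x = (re x)%:A + im x *: b.
Proof. exact: projT2 (cid (projT2 (cid (span x)))). Qed.

Lemma coord_b_eq0 (x0 x1 : F) : x0%:A + x1 *: b = 0 -> x0 = 0 /\ x1 = 0.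
Proof.
move=> e; have e' : x0%:A - x1 *: b = 0.
  by rewrite -[RHS](rmorph0 conj) -e rmorphD /= conj_alg conjZ conj_b scalerN.
have b0 : b != 0.
  apply/eqP => b0; have := bb; rewrite b0 mul0r => /esym/eqP.
  by rewrite scaler_eq0 oner_eq0 orbF (negbTE D_neq0).
have x00 : x0 = 0.
  have : (x0 * 2%:R)%:A = 0 :> L.
    by rewrite mulr_natr mulr2n algD -{2}[x0%:A](addrK (x1 *: b)) e sub0r -e'.
  by move/eqP; rewrite scaler_eq0 oner_eq0 orbF mulf_eq0 (negbTE n2) orbF => /eqP.
split=> //; have bu : b \is a GRing.unit.
  by have := alg_unit L D_neq0; rewrite -bb unitrM andbb.
move: e; rewrite x00 alg0 add0r => /(congr1 ( *%R^~ b^-1)); rewrite -scalerAl mulrV // mul0r.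
by move/eqP; rewrite scaler_eq0 oner_eq0 orbF => /eqP.
Qed.

Lemma reimE (x0 x1 : F) : re (x0%:A + x1 *: b) = x0 /\ im (x0%:A + x1 *: b) = x1.
Proof.
set x := (X in re X); have e : (x0 - re x)%:A + (x1 - im x) *: b = 0.
  by rewrite algB scalerBl addrACA -opprD -reim subrr.
by case: (coord_b_eq0 e) => /eqP h1 /eqP h2; move: h1 h2; rewrite !subr_eq0 => /eqP <- /eqP <-.
Qed.

Lemma re_im_eq x (x0 x1 : F) : x = x0%:A + x1 *: b -> re x = x0 /\ im x = x1.
Proof. by move=> ->; exact: reimE. Qed.

Lemma reimD x y : re (x + y) = re x + re y /\ im (x + y) = im x + im y.
Proof. by apply: re_im_eq; rewrite {1}(reim x) {1}(reim y) algD scalerDl addrACA. Qed.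

Lemma reimM x y : re (x * y) = re x * re y + D * im x * im y /\ im (x * y) = re x * im y + im x * re y.
Proof.
apply: re_im_eq; rewrite {1}(reim x) {1}(reim y) -[im x *: b]mulr_algl -[im y *: b]mulr_algl.
rewrite -[(_ + _) *: b]mulr_algl !algE -bb; ring.
Qed.

Lemma reimZ a x : re (a *: x) = a * re x /\ im (a *: x) = a * im x.
Proof. by apply: re_im_eq; rewrite {1}(reim x) scalerDr !scalerA. Qed.

Lemma reim_conj x : re (conj x) = re x /\ im (conj x) = - im x.
Proof. by apply: re_im_eq; rewrite {1}(reim x) rmorphD /= conj_alg conjZ conj_b scalerN scaleNr. Qed.

Lemma reim_alg a : re a%:A = a /\ im a%:A = 0.
Proof. by apply: re_im_eq; rewrite scale0r addr0. Qed.

Definition bnd (c : nat) x := ival (- c%:Z) (re x) && ival (- c%:Z) (im x).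

Lemma bndD c x y : bnd c x -> bnd c y -> bnd c (x + y).
Proof. by move=> /andP[? ?] /andP[? ?]; rewrite /bnd; case: (reimD x y) => -> ->; rewrite !ivalD. Qed.

Lemma bnd0 c : bnd c 0.
Proof. by rewrite /bnd -(alg0 L); case: (reim_alg 0) => -> ->; rewrite !ival0. Qed.

Lemma bnd_sum c (I : Type) (s : seq I) (P : pred I) (f : I -> L) :
  (forall i, P i -> bnd c (f i)) -> bnd c (\sum_(i <- s | P i) f i).
Proof. by move=> h; elim/big_ind: _ => //; [exact: bnd0|exact: bndD]. Qed.

Lemma bndZ c a x : ival 0 a -> bnd c x -> bnd c (a *: x).
Proof. by move=> ha /andP[? ?]; rewrite /bnd; case: (reimZ a x) => -> ->; rewrite !ivaloM. Qed.

Lemma bnd_le c c' x : (c <= c')%N -> bnd c x -> bnd c' x.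
Proof. by move=> cc /andP[h1 h2]; rewrite /bnd (ivalW _ h1) ?(ivalW _ h2) //; ilia. Qed.

Lemma bndM c c' x y : bnd c x -> bnd c' y -> bnd (c + c' + `|val_lf v D|) (x * y).
Proof.
move=> /andP[h1 h2] /andP[h3 h4]; rewrite /bnd; case: (reimM x y) => -> ->.
have hD : ival (- `|val_lf v D|%:Z) D by rewrite ival_val //; lia.
have w k z : - (c + c' + `|val_lf v D|)%N%:Z <= k -> ival k z -> ival (- (c + c' + `|val_lf v D|)%N%:Z) z.
  by move=> hk; apply: ivalW.
by apply/andP; split; apply: ivalD;
  [ apply: w (ivalM h1 h3) | apply: w (ivalM (ivalM hD h2) h4)
  | apply: w (ivalM h1 h4) | apply: w (ivalM h2 h3)]; ilia.
Qed.

Lemma bndP x : exists c, bnd c x.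
Proof.
have [c1 h1] := ival_bound v (re x); have [c2 h2] := ival_bound v (im x).
by exists (maxn c1 c2); rewrite /bnd h1 ?leq_maxl // h2 // leq_maxr.
Qed.

(* Integral elements are those with bounded powers; unlike the definition,
   this is visibly stable under sums and products. *)
Definition pow_bnd x := exists c, forall k : nat, bnd c (x ^+ k).

Lemma pow_bnd_alg a : pow_bnd a%:A <-> ival 0 a.
Proof.
split=> [[c hc]|ha]; last first.
  exists 0%N => k; rewrite -algX /bnd; case: (reim_alg (a ^+ k)) => -> ->.
  by rewrite oppr0 ivalX ?ival0.
have [->|a0] := eqVneq a 0; first exact: ival0.
rewrite ival_val // leNgt; apply/negP => va.
have := hc c.+1; rewrite -algX /bnd; case: (reim_alg (a ^+ c.+1)) => -> _ /andP[+ _].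
rewrite ival_val ?expf_neq0 // valX // -mulr_natr natz => h.
have : val_lf v a * c.+1%:Z <= - 1 * c.+1%:Z by rewrite ler_pM2r //; lia.
by lia.
Qed.

Lemma pow_bndM x y : pow_bnd x -> pow_bnd y -> pow_bnd (x * y).
Proof.
move=> [c hc] [c' hc']; exists (c + c' + `|val_lf v D|)%N => k.
by rewrite exprMn; apply: bndM.
Qed.

Lemma pow_bndD x y : pow_bnd x -> pow_bnd y -> pow_bnd (x + y).
Proof.
move=> [c hc] [c' hc']; exists (c + c' + `|val_lf v D|)%N => k.
rewrite exprDn; apply: bnd_sum => i _; rewrite -scaler_nat; apply: bndZ; first exact: ival_nat.
exact: bndM.
Qed.

Lemma pow_bnd_conj x : pow_bnd x -> pow_bnd (conj x).
Proof.
move=> [c hc]; exists c => k; have := hc k; rewrite /bnd -rmorphXn /=.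
by case: (reim_conj (x ^+ k)) => -> ->; rewrite ivalN.
Qed.

Definition trL x := 2%:R * re x.
Definition nmL x := re x ^+ 2 - D * im x ^+ 2.

Lemma trLE x : (trL x)%:A = x + conj x.
Proof.
rewrite [in RHS](reim x) rmorphD /= conj_alg conjZ conj_b scalerN addrACA subrr addr0.
by rewrite /trL mulrDl mul1r algD.
Qed.

Lemma nmLE x : (nmL x)%:A = x * conj x.
Proof.
rewrite [in RHS](reim x) rmorphD /= conj_alg conjZ conj_b scalerN -[im x *: b]mulr_algl.
by rewrite /nmL !algE -bb; ring.
Qed.

(** x is a root of X^2 - tr(x) X + N(x). *)
Lemma oL_TN x : ival 0 (trL x) -> ival 0 (nmL x) -> oL v x.
Proof.
move=> ht hn; exists ('X^2 - trL x *: 'X + (nmL x)%:P); split.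
- apply/monicP; rewrite /lead_coef.
  have -> : size ('X^2 - trL x *: 'X + (nmL x)%:P) = 3.
    rewrite -addrA size_polyDl ?size_polyXn // (leq_ltn_trans (size_polyD _ _)) //.
    rewrite size_polyN gtn_max (leq_ltn_trans (size_scale_leq _ _)) ?size_polyX //=.
    by rewrite (leq_ltn_trans (size_polyC_leq1 _)).
  by rewrite !coefD coefN coefZ coefXn coefX coefC /= mulr0 subr0 addr0.
- move=> i; apply/ppowP; rewrite !coefD coefN coefZ coefXn coefX coefC.
  apply: ivalD; last by case: eqP => // _; rewrite ival0.
  by apply: ivalB; [exact: ival_nat|apply: ivalMo => //; exact: ival_nat].
- rewrite rmorphD rmorphB /= linearZ /= rmorphXn /= !horner_algX horner_algC -mulr_algl trLE nmLE; ring.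
Qed.

Lemma pow_bnd_TN x : pow_bnd x -> ival 0 (trL x) /\ ival 0 (nmL x).
Proof.
move=> hx; split; apply/pow_bnd_alg; rewrite ?trLE ?nmLE.
  by apply: pow_bndD => //; exact: pow_bnd_conj.
by apply: pow_bndM => //; exact: pow_bnd_conj.
Qed.

(** A monic equation of degree d writes every power of x as an o-combination of the powers below d.
    Conversely the trace and norm also have bounded powers, and in F this means integral. *)
Lemma oL_pow_bnd x : oL v x <-> pow_bnd x.
Proof.
split.
  move=> [p [pm po px]]; set d := (size p).-1.
  have sp : size p = d.+1 by rewrite prednK // lt0n size_poly_eq0 monic_neq0.
  have xd : x ^+ d = - \sum_(i < d) p`_i *: x ^+ i.
    move/eqP: px; rewrite hornerAE sp big_ord_recr /= -[p`_d]/(p`_(d.+1.-1)) -sp -lead_coefE.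
    by rewrite (monicP pm) scale1r addrC addr_eq0 => /eqP.
  have pow (k : nat) : exists a : nat -> F, (forall i, ival 0 (a i)) /\ x ^+ k = \sum_(i < d) a i *: x ^+ i.
    elim: k => [|k [a [ha e]]].
      have [d0|d0] := posnP d.
        exists (fun=> 0); split=> [i|]; first exact: ival0.
        rewrite d0 big_ord0; have := xd; rewrite d0 big_ord0 oppr0 expr0 => h.
        by rewrite h.
      exists (fun i => (i == 0%N)%:R); split=> [i|]; first exact: ival_nat.
      rewrite (bigD1 (Ordinal d0)) //= expr0 scale1r big1 ?addr0 // => i.
      by rewrite -val_eqE /= => /negbTE ->; rewrite scale0r.
    case: d xd e {sp} => [|d'] xd e.
      by exists a; split=> //; rewrite exprS e !big_ord0 mulr0.
    exists (fun i => (if i is i'.+1 then a i' else 0) - a d' * p`_i); split=> [i|].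
      apply: ivalB; first by case: i => [|i]; rewrite ?ival0.
      by apply: ivalMo => //; apply/ppowP/po.
    rewrite exprS e mulr_sumr big_ord_recr /= -scalerAr -exprS xd scalerN.
    under [RHS]eq_bigr => i _ do rewrite scalerBl.
    rewrite sumrB scaler_sumr; congr (_ - _); last by apply: eq_bigr => i _; rewrite scalerA.
    rewrite [RHS]big_ord_recl scale0r add0r; apply: eq_bigr => i _.
    by rewrite -scalerAr -exprS lift0.
  have [c hc] : exists c, forall i, (i < d)%N -> bnd c (x ^+ i).
    elim: (d) => [|m [c hc]]; first by exists 0%N.
    have [c' hc'] := bndP (x ^+ m); exists (maxn c c') => i; rewrite ltnS leq_eqVlt => /orP[/eqP->|hi].
      by apply: bnd_le hc'; rewrite leq_maxr.
    by apply: bnd_le (hc _ hi); rewrite leq_maxl.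
  by exists c => k; have [a [ha ->]] := pow k; apply: bnd_sum => i _; apply: bndZ => //; exact: hc.
by move=> /pow_bnd_TN[ht hn]; exact: oL_TN.
Qed.

(** From the discriminant: (2 im(x))^2 D = tr(x)^2 - 4 N(x) is integral. *)
Lemma pow_bnd_im x : pow_bnd x -> ival (- `|val_lf v D|%:Z - `|val_lf v 2%:R|%:Z) (im x).
Proof.
move=> /pow_bnd_TN[ht hn]; have [->|i0] := eqVneq (im x) 0; first exact: ival0.
have e : (2%:R * im x) ^+ 2 * D = trL x ^+ 2 - 4%:R * nmL x by rewrite /trL /nmL; ring.
have : ival 0 ((2%:R * im x) ^+ 2 * D).
  by rewrite e; apply: ivalB; [exact: ivalX|apply: ivalMo => //; exact: ival_nat].
rewrite !ival_val ?mulf_neq0 ?expf_neq0 // val_lfM ?expf_neq0 ?mulf_neq0 // valX ?mulf_neq0 //.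
by rewrite val_lfM // mulr2n; lia.
Qed.

(* An integral element whose [b]-coordinate has minimal valuation completes 1
   to a basis of o_L. *)
Lemma integral_basis_exists : exists al : L, [/\ im al != 0, pow_bnd al &
  forall x, pow_bnd x -> ival (val_lf v (im al)) (im x)].
Proof.
(* The bound of [pow_bnd_im]; shifted by B, the valuations become natural numbers and a minimum
   exists. *)
set B := (`|val_lf v D| + `|val_lf v 2%:R|)%N.
pose P (i : nat) := `[< exists2 x : L, pow_bnd x & im x != 0 /\ val_lf v (im x) = i%:Z - B%:Z >].
have toP x : pow_bnd x -> im x != 0 -> P (absz (val_lf v (im x) + B%:Z)).
  move=> hx i0; apply/asboolP; exists x => //; split=> //.
  by have := pow_bnd_im hx; rewrite ival_val // /B; lia.
have exP : exists i, P i.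
  (* This multiple of b has trace 0 and integral norm, so the minimum is taken over a nonempty
     set. *)
  pose x := upi `|val_lf v D|%:Z *: b.
  have [h1 h2] : re x = 0 /\ im x = upi `|val_lf v D|%:Z.
    by apply: re_im_eq; rewrite alg0 add0r.
  exists (absz (val_lf v (im x) + B%:Z)); apply: toP; last by rewrite h2 upi_neq0.
  apply/oL_pow_bnd/oL_TN; first by rewrite /trL h1 mulr0 ival0.
  rewrite /nmL h1 h2 expr0n /= sub0r ivalN mulrC expr2 -mulrA !ival_upiM ival_val //; lia.
case: (ex_minnP exP) => i /asboolP[al hal [i0 vi]] mini.
exists al; split=> // x hx; have [->|x0] := eqVneq (im x) 0; first exact: ival0.
rewrite ival_val // vi; have := mini _ (toP _ hx x0).
by have := pow_bnd_im hx; rewrite ival_val // /B; lia.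
Qed.

End IntegralBasis.

(** * Coordinates, units and lattices in L *)

Section QuadraticIntegers.
Variables (F : fieldType) (v : local_field F).
Variables (L : comUnitAlgType F) (conj : {lrmorphism L -> L}).
Local Notation ival := (ival v).

(* 1, al is a basis of o_L over o; al has trace t and norm nu. *)
Record integral_basis (al : L) (t nu : F) : Prop := IntegralBasis {
  ib_sqr : al * al = t *: al - nu%:A;
  ib_conj : conj al = t%:A - al;
  ib_span : forall x, exists x0 x1, x = x0%:A + x1 *: al;
  ib_free : forall x0 x1, x0%:A + x1 *: al = 0 -> x0 = 0 /\ x1 = 0;
  ib_t : ival 0 t;
  ib_nu : ival 0 nu;
  ib_disc : t ^+ 2 - 4%:R * nu != 0;
  ib_oL : forall x0 x1, oL v (x0%:A + x1 *: al) <-> ival 0 x0 /\ ival 0 x1;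
  ib_TN : forall x0 x1, ival 0 (2%:R * x0 + t * x1) ->
    ival 0 (x0 ^+ 2 + t * x0 * x1 + nu * x1 ^+ 2) -> ival 0 x0 /\ ival 0 x1 }.

Lemma integral_basisP : [pchar F] =i pred0 -> quadratic_algebra conj ->
  exists al t nu, integral_basis al t nu.
Proof.
move=> charF /(quad_basisP charF)[b [D qb]].
have [D0 cb bb _] := qb; have n2 := two_neq0 charF.
have [al [i0 pal mini]] := integral_basis_exists v charF qb.
set re := re qb in i0 mini *; set im := im qb in i0 mini *.
have tE := trLE qb al; have nE := nmLE qb al.
set t := trL qb al in tE; set nu := nmL qb al in nE.
have [ht hn] := pow_bnd_TN charF pal.
have ca : conj al = t%:A - al by rewrite tE addrC addKr.
have alE := reim qb al; rewrite -/re -/im in alE.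
have co x0 x1 : im (x0%:A + x1 *: al) = x1 * im al /\ re (x0%:A + x1 *: al) = x0 + x1 * re al.
  have e : x0%:A + x1 *: al = (x0 + x1 * re al)%:A + (x1 * im al) *: b.
    by rewrite {1}alE scalerDr !scalerA algD addrA.
  by have [h1 h2] := re_im_eq charF qb e.
have oLE x0 x1 : oL v (x0%:A + x1 *: al) <-> ival 0 x0 /\ ival 0 x1.
  rewrite (oL_pow_bnd v charF qb); split=> [h|[h0 h1]]; last first.
    apply: (pow_bndD charF); first exact/(pow_bnd_alg v charF qb).
    by rewrite -mulr_algl; apply: (pow_bndM charF) => //; apply/(pow_bnd_alg v charF qb).
  have h1 : ival 0 x1.
    by have := mini _ h; rewrite (co _ _).1 -[x1 in ival 0 x1](mulfK i0) ivalVM // add0r.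
  split=> //; apply/(pow_bnd_alg v charF qb).
  have -> : x0%:A = (x0%:A + x1 *: al) + (- x1)%:A * al by rewrite mulr_algl scaleNr addrK.
  apply: (pow_bndD charF) => //; apply: (pow_bndM charF) => //; apply/(pow_bnd_alg v charF qb).
  by rewrite ivalN.
exists al, t, nu; split=> //.
- by rewrite -{2}[al](subKr t%:A) -ca mulrBr -nE mulr_algr.
- move=> x; exists (re x - im x / im al * re al), (im x / im al).
  have e c : c *: al = (c * re al)%:A + (c * im al) *: b by rewrite {1}alE scalerDr !scalerA.
  by rewrite e divfK // algB addrA subrK -/re -/im; exact: reim.
- move=> x0 x1 e; have [h1 h0] := co x0 x1; rewrite e in h1 h0.
  have [z0 z1] := reim_alg charF qb 0; rewrite alg0 in z0 z1; move: h1 h0; rewrite /re /im z0 z1.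
  move/esym/eqP; rewrite mulf_eq0 (negbTE i0) orbF => /eqP ->.
  by rewrite mul0r addr0.
- have -> : t ^+ 2 - 4%:R * nu = (2%:R * im al) ^+ 2 * D.
    by rewrite /t /nu /trL /nmL -/im -/re; ring.
  by rewrite mulf_neq0 // expf_neq0 // mulf_neq0.
- move=> x0 x1 hT hN; apply/oLE; apply: (oL_TN (qb := qb)).
    by rewrite /trL -/re (co x0 x1).2; move: hT; rewrite /t /trL -/re; congr (ival _ _); ring.
  by rewrite /nmL -/re -/im (co x0 x1).1 (co x0 x1).2; move: hN; rewrite /t /nu /trL /nmL -/re -/im; congr (ival _ _); ring.
Qed.

Variables (al : L) (t nu : F).
Hypothesis ib : integral_basis al t nu.

Definition la x : F := projT1 (cid (ib_span ib x)).
Definition lb x : F := projT1 (cid (projT2 (cid (ib_span ib x)))).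

Lemma lab x : x = (la x)%:A + lb x *: al.
Proof. exact: projT2 (cid (projT2 (cid (ib_span ib x)))). Qed.

Lemma labP x (x0 x1 : F) : x = x0%:A + x1 *: al -> la x = x0 /\ lb x = x1.
Proof.
move=> e; have : (x0 - la x)%:A + (x1 - lb x) *: al = 0.
  by rewrite algB scalerBl addrACA -opprD -lab -e subrr.
by case/(ib_free ib) => /eqP h1 /eqP h2; move: h1 h2; rewrite !subr_eq0 => /eqP <- /eqP <-.
Qed.

Lemma laD x y : la (x + y) = la x + la y.
Proof. by case: (@labP (x + y) (la x + la y) (lb x + lb y)) => //; rewrite {1}(lab x) {1}(lab y) algD scalerDl addrACA. Qed.
Lemma lbD x y : lb (x + y) = lb x + lb y.
Proof. by case: (@labP (x + y) (la x + la y) (lb x + lb y)) => //; rewrite {1}(lab x) {1}(lab y) algD scalerDl addrACA. Qed.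

Lemma labZ a x : la (a *: x) = a * la x /\ lb (a *: x) = a * lb x.
Proof. by apply: labP; rewrite {1}(lab x) scalerDr !scalerA. Qed.
Lemma laZ a x : la (a *: x) = a * la x. Proof. by case: (labZ a x). Qed.
Lemma lbZ a x : lb (a *: x) = a * lb x. Proof. by case: (labZ a x). Qed.

Lemma laN x : la (- x) = - la x. Proof. by rewrite -scaleN1r laZ mulN1r. Qed.
Lemma lbN x : lb (- x) = - lb x. Proof. by rewrite -scaleN1r lbZ mulN1r. Qed.

Lemma lab_alg a : la a%:A = a /\ lb a%:A = 0.
Proof. by apply: labP; rewrite scale0r addr0. Qed.
Lemma la_alg a : la a%:A = a. Proof. by case: (lab_alg a). Qed.
Lemma lb_alg a : lb a%:A = 0. Proof. by case: (lab_alg a). Qed.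

Lemma lab_al : la al = 0 /\ lb al = 1.
Proof. by apply: labP; rewrite alg0 add0r scale1r. Qed.

Lemma labM x y : la (x * y) = la x * la y - nu * lb x * lb y /\
  lb (x * y) = la x * lb y + lb x * la y + t * lb x * lb y.
Proof.
apply: labP; rewrite {1}(lab x) {1}(lab y) -[lb x *: al]mulr_algl -[lb y *: al]mulr_algl.
have e := ib_sqr ib; rewrite -[t *: al]mulr_algl in e.
rewrite -[(_ + _) *: al]mulr_algl !algE.
have -> : ((la x)%:A + (lb x)%:A * al) * ((la y)%:A + (lb y)%:A * al) =
  (la x)%:A * (la y)%:A + ((la x)%:A * (lb y)%:A + (lb x)%:A * (la y)%:A) * al
  + (lb x)%:A * (lb y)%:A * (al * al) by ring.
by rewrite e; ring.
Qed.
Lemma laM x y : la (x * y) = la x * la y - nu * lb x * lb y. Proof. by case: (labM x y). Qed.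
Lemma lbM x y : lb (x * y) = la x * lb y + lb x * la y + t * lb x * lb y. Proof. by case: (labM x y). Qed.

Lemma lab_conj x : la (conj x) = la x + t * lb x /\ lb (conj x) = - lb x.
Proof.
apply: labP; rewrite {1}(lab x) rmorphD /= conj_alg conjZ (ib_conj ib) scalerBr scalerA.
by rewrite algD scaleNr [t * _]mulrC addrA.
Qed.
Lemma la_conj x : la (conj x) = la x + t * lb x. Proof. by case: (lab_conj x). Qed.
Lemma lb_conj x : lb (conj x) = - lb x. Proof. by case: (lab_conj x). Qed.

Lemma lab_inj x y : la x = la y -> lb x = lb y -> x = y.
Proof. by move=> h1 h2; rewrite (lab x) (lab y) h1 h2. Qed.

Lemma conjK : involutive conj.
Proof. by move=> x; apply: lab_inj; rewrite ?la_conj ?lb_conj ?opprK //; ring. Qed.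

(** The coordinates of conj x - x are t lb(x) and - 2 lb(x); since the discriminant is nonzero, one
    of the two factors can always be cancelled. *)
Lemma two_ib : 2%:R != 0 :> F \/ t != 0.
Proof.
have [t0|] := eqVneq t 0; [left|by right].
have e : 4%:R = 2%:R * 2%:R :> F by rewrite -natrM.
by apply: contraNneq (ib_disc ib) => h; rewrite t0 expr0n /= e h !mul0r subrr.
Qed.

Lemma conj_fix x : conj x = x -> x = (la x)%:A.
Proof.
move=> e; suff h : lb x = 0 by rewrite {1}(lab x) h scale0r addr0.
have h1 : 2%:R * lb x = 0.
  by have := lb_conj x; rewrite e mulr_natl mulr2n => {1}->; rewrite addNr.
have h2 : t * lb x = 0 by have := la_conj x; rewrite e -{1}[la x]addr0 => /addrI.
by have [n0|n0] := two_ib; apply: (mulfI n0); rewrite mulr0.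
Qed.

Definition nrm x := la x ^+ 2 + t * la x * lb x + nu * lb x ^+ 2.

Lemma nrmE x : x * conj x = (nrm x)%:A.
Proof. by apply: lab_inj; rewrite ?laM ?lbM la_conj lb_conj ?la_alg ?lb_alg /nrm; ring. Qed.

Lemma nrmM x y : nrm (x * y) = nrm x * nrm y.
Proof. by apply: (@alg_inj _ L); rewrite algM -!nrmE rmorphM /=; ring. Qed.

Lemma nrm_alg a : nrm a%:A = a ^+ 2.
Proof. by rewrite /nrm la_alg lb_alg; ring. Qed.

Lemma nrm_conj x : nrm (conj x) = nrm x.
Proof. by rewrite /nrm la_conj lb_conj; ring. Qed.

Lemma nrm1 : nrm 1 = 1. Proof. by rewrite -(alg1 L) nrm_alg expr1n. Qed.

Lemma unitL x : (x \is a GRing.unit) = (nrm x != 0).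
Proof.
apply/idP/idP => [ux|n0].
  have := nrm1; rewrite -(mulrV ux) nrmM => h.
  by apply: contra_eq_neq h => ->; rewrite mul0r eq_sym oner_neq0.
have [] := @invr_eq _ L x (conj x * (nrm x)^-1%:A) => //.
by rewrite mulrA nrmE -algM mulfV // alg1.
Qed.

Lemma normLE x : normL conj x = nrm x.
Proof.
rewrite /normL; case: xgetP => [a _ /= h|h]; last by case: (h (nrm x)); rewrite /= nrmE.
by apply: (@alg_inj _ L); rewrite h nrmE.
Qed.

Lemma conj_unit x : (conj x \is a GRing.unit) = (x \is a GRing.unit).
Proof. by rewrite !unitL nrm_conj. Qed.

(** The discriminant times lb(x)^2 is tr(x)^2 - 4 N(x). When L is split, this replaces the absence
    of zero divisors. *)
Lemma reducedL x : nrm x = 0 -> la x * 2%:R + t * lb x = 0 -> x = 0.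
Proof.
move=> n0 t0; have h : (t ^+ 2 - 4%:R * nu) * lb x ^+ 2 = 0.
  have -> : (t ^+ 2 - 4%:R * nu) * lb x ^+ 2 = (la x * 2%:R + t * lb x) ^+ 2 - 4%:R * nrm x.
    by rewrite /nrm; ring.
  by rewrite n0 t0; ring.
have b0 : lb x = 0.
  by move/eqP: h; rewrite mulf_eq0 (negbTE (ib_disc ib)) expf_eq0 /= => /eqP.
have a0 : la x ^+ 2 = 0 by rewrite -[RHS]n0 /nrm b0; ring.
apply: lab_inj; rewrite -(alg0 L) ?la_alg ?lb_alg //.
by move/eqP: a0; rewrite expf_eq0 /= => /eqP.
Qed.

Definition lval (k : int) (x : L) : bool := ival k (la x) && ival k (lb x).

Lemma lvalD k x y : lval k x -> lval k y -> lval k (x + y).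
Proof. by move=> /andP[? ?] /andP[? ?]; rewrite /lval laD lbD !ivalD. Qed.

Lemma lvalN k x : lval k (- x) = lval k x.
Proof. by rewrite /lval laN lbN !ivalN. Qed.

Lemma lvalB k x y : lval k x -> lval k y -> lval k (x - y).
Proof. by move=> hx hy; rewrite lvalD ?lvalN. Qed.

Lemma lvalBC k x y : lval k (x - y) = lval k (y - x).
Proof. by rewrite -lvalN opprB. Qed.

Lemma lvalM k l x y : lval k x -> lval l y -> lval (k + l) (x * y).
Proof.
move=> /andP[h1 h2] /andP[h3 h4]; rewrite /lval laM lbM.
have ht := ib_t ib; have hn := ib_nu ib.
by rewrite ivalB ?ivalD ?ivalM // ?(ivaloM ht, ivaloM hn) // -mulrA ivaloM // ivalM.
Qed.

Lemma lvalMo k x y : lval k x -> lval 0 y -> lval k (x * y).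
Proof. by move=> hx hy; rewrite -[k]addr0 lvalM. Qed.

Lemma lvaloM k x y : lval 0 x -> lval k y -> lval k (x * y).
Proof. by move=> hx hy; rewrite -[k]add0r lvalM. Qed.

Lemma lvalW l k x : k <= l -> lval l x -> lval k x.
Proof. by move=> kl /andP[h1 h2]; rewrite /lval (ivalW kl h1) (ivalW kl h2). Qed.

Lemma lval_alg k a : lval k a%:A = ival k a.
Proof. by rewrite /lval la_alg lb_alg ival0 andbT. Qed.

Lemma lval0 k : lval k 0. Proof. by rewrite -(alg0 L) lval_alg ival0. Qed.
Lemma lval1 : lval 0 1. Proof. by rewrite -(alg1 L) lval_alg ival1. Qed.

Lemma lvalZ k l a x : ival k a -> lval l x -> lval (k + l) (a *: x).
Proof. by move=> ha hx; rewrite -mulr_algl lvalM ?lval_alg. Qed.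

Lemma lval_conj k x : lval k (conj x) = lval k x.
Proof.
have aux y : lval k y -> lval k (conj y).
  move=> /andP[h1 h2]; rewrite /lval la_conj lb_conj ivalN h2 andbT.
  by rewrite ivalD // ivaloM // (ib_t ib).
by apply/idP/idP => h; first rewrite -[x]conjK; exact: aux.
Qed.

Lemma lval_sum k (I : Type) (s : seq I) (P : pred I) (f : I -> L) :
  (forall i, P i -> lval k (f i)) -> lval k (\sum_(i <- s | P i) f i).
Proof. by move=> h; elim/big_ind: _ => //; [exact: lval0|exact: lvalD]. Qed.

Lemma oLE x : oL v x <-> lval 0 x.
Proof. by rewrite {1}(lab x) (ib_oL ib); split=> [[? ?]|/andP[]]; [apply/andP|]. Qed.

Lemma lval_al : lval 0 al.
Proof. by rewrite /lval; case: lab_al => -> ->; rewrite ival0 ival1. Qed.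

Lemma PLpowE (k : nat) x : PLpow v k x <-> lval k x.
Proof.
split=> [[a [y [/ppowP ha /oLE hy ->]]]|/andP[h1 h2]].
  by rewrite -[k%:Z]addr0 lvalZ.
exists (upi v k), ((upi v k)^-1 *: x); split; first by apply/ppowP/ival_upi.
  by apply/oLE; rewrite /lval laZ lbZ -upiN !ival_upiM opprK add0r h1.
by rewrite scalerA mulfV ?scale1r ?upi_neq0.
Qed.

Lemma lval_nrm k x : lval k x -> ival (k + k) (nrm x).
Proof. by move=> h; rewrite -lval_alg -nrmE lvalM ?lval_conj. Qed.

Definition lunit x := lval 0 x && vunit v (nrm x).

Lemma lunit_unit x : lunit x -> x \is a GRing.unit.
Proof. by case/andP=> _ h; rewrite unitL (vunit_neq0 h). Qed.

Lemma lunit_lval x : lunit x -> lval 0 x. Proof. by case/andP. Qed.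

Lemma invLE x : x \is a GRing.unit -> x^-1 = (nrm x)^-1 *: conj x.
Proof.
move=> ux; have := ux; rewrite unitL => n0; have [|_] // := @invr_eq _ L x ((nrm x)^-1 *: conj x).
by rewrite -scalerAr nrmE scalerA mulVf // alg1.
Qed.

Lemma lunitV x : lunit x -> lunit x^-1.
Proof.
move=> hx; have ux := lunit_unit hx; case/andP: hx => hx hn.
have hV : nrm x^-1 = (nrm x)^-1.
  by apply: (mulfI (vunit_neq0 hn)); rewrite -nrmM mulrV // nrm1 mulfV ?(vunit_neq0 hn).
rewrite /lunit hV vunitV // andbT invLE // -[0]addr0 lvalZ ?lval_conj //.
exact/vunit_ival/vunitV.
Qed.

Lemma lunitM x y : lunit x -> lunit y -> lunit (x * y).
Proof. by move=> /andP[h1 h2] /andP[h3 h4]; rewrite /lunit nrmM vunitM // lvalMo. Qed.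

Lemma lunit_conj x : lunit (conj x) = lunit x.
Proof. by rewrite /lunit lval_conj nrm_conj. Qed.

Lemma lunitP x y : lval 0 x -> lval 0 y -> x * y = 1 -> lunit x.
Proof.
move=> hx hy e; rewrite /lunit hx; apply: (@vunit_mulr1 _ _ _ (nrm y)); rewrite ?(lval_nrm hx) ?(lval_nrm hy) //.
by rewrite -nrmM e nrm1.
Qed.

Lemma lunitPV x : x \is a GRing.unit -> lval 0 x -> lval 0 x^-1 -> lunit x.
Proof. by move=> ux h1 h2; apply: lunitP h1 h2 _; rewrite mulrV. Qed.

Lemma lunit1 : lunit 1. Proof. by rewrite /lunit lval1 nrm1 vunit1. Qed.

Lemma lunit_alg a : lunit a%:A = vunit v a.
Proof.
rewrite /lunit lval_alg nrm_alg /vunit expf_eq0 /=; case: eqVneq => [->|a0] /=; first by rewrite andbF.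
by rewrite ival_val // valX // mulr2n; lia.
Qed.

Lemma lunitMr k x y : lunit y -> lval k (x * y) = lval k x.
Proof.
move=> hy; apply/idP/idP => h; last exact: lvalMo (lunit_lval hy).
by rewrite -[x](mulrK (lunit_unit hy)) lvalMo ?lunit_lval ?lunitV.
Qed.

Lemma oL_unitE x : oL_unit v x <-> lunit x.
Proof.
split=> [[ux /oLE h1 /oLE h2]|h]; first exact: lunitPV.
by split; [exact: lunit_unit|apply/oLE/lunit_lval|apply/oLE/lunit_lval/lunitV].
Qed.

Lemma nrm_cong1 k x : 0 <= k -> lval k (x - 1) -> ival k (nrm x - 1).
Proof.
move=> k0 h; rewrite -lval_alg algB alg1 -nrmE.
have -> : x * conj x - 1 = (x - 1) * conj (x - 1) + (x - 1) + conj (x - 1).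
  by rewrite rmorphB rmorph1 /=; ring.
have hc : lval k (conj (x - 1)) by rewrite lval_conj.
by apply: lvalD => //; apply: lvalD => //; apply: lvalMo => //; exact: lvalW hc.
Qed.

Lemma lunit_cong1 k x : 0 < k -> lval k (x - 1) -> lunit x.
Proof.
move=> k0 h; rewrite /lunit (vunit_cong1 k0 (nrm_cong1 (ltW k0) h)) andbT.
by rewrite -[x](subrK 1) lvalD ?lval1 // (lvalW _ h) // ltW.
Qed.

Local Notation upi := (upi v).

Definition trc x := la x * 2%:R + t * lb x.

Lemma trcE x : (trc x)%:A = x + conj x.
Proof.
by apply: (lab_inj); rewrite ?(laD, lbD) ?(la_conj, lb_conj) ?(la_alg, lb_alg) /trc; ring.
Qed.

Lemma trc0 : trc 0 = 0.
Proof. by rewrite /trc -(alg0 L) la_alg lb_alg; ring. Qed.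

Lemma nrmD x y : nrm (x + y) = nrm x + nrm y + trc (x * conj y).
Proof.
apply: (@alg_inj _ L); rewrite (algD L (nrm x + nrm y)) (algD L (nrm x)) trcE -!nrmE rmorphD /= rmorphM /= conjK; ring.
Qed.

Lemma nrmZ a x : nrm (a *: x) = a ^+ 2 * nrm x.
Proof. by rewrite -mulr_algl nrmM nrm_alg. Qed.

Lemma sqrL_eq0 (x : L) : x * x = 0 -> x = 0.
Proof.
move=> e; have ha : la x * la x - nu * lb x * lb x = 0 by rewrite -laM e -(alg0 L) la_alg.
have hb : lb x * trc x = 0.
  by rewrite -[RHS](lb_alg 0) (alg0 L) -e lbM /trc; ring.
have [b0|b0] := eqVneq (lb x) 0.
  apply: (lab_inj); rewrite -(alg0 L) ?la_alg ?lb_alg //.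
  by move/eqP: ha; rewrite b0 mulr0 subr0 mulf_eq0 orbb => /eqP.
have tr0 : trc x = 0 by apply: (mulfI b0); rewrite hb mulr0.
apply: (reducedL) => //.
have -> : nrm x = la x * trc x - (la x * la x - nu * lb x * lb x).
  by rewrite /nrm /trc; ring.
by rewrite tr0 ha; ring.
Qed.

Lemma lvalP x : exists c : nat, lval (- c%:Z) x.
Proof.
have [c1 h1] := ival_bound v (la x); have [c2 h2] := ival_bound v (lb x).
by exists (maxn c1 c2); rewrite /lval h1 ?leq_maxl // h2 // leq_maxr.
Qed.

(** Needed because w1 and w2 may both be zero divisors. If w1, w2 and w1 + w2 have norm 0, then w1
    conj w2 has trace and norm 0, hence vanishes, and expanding the norm of u1 w1 + u2 w2 = 1 gives
    0. *)
Lemma nrm_unimodular (u1 u2 w1 w2 : L) : u1 * w1 + u2 * w2 = 1 ->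
  exists x y, [/\ ival 0 x, ival 0 y & nrm (x *: w1 + y *: w2) != 0].
Proof.
move=> e; apply: contrapT => nex.
have N0 x y : ival 0 x -> ival 0 y -> nrm (x *: w1 + y *: w2) = 0.
  by move=> hx hy; apply/eqP; apply: contraT => h; case: nex; exists x, y.
have n1 : nrm w1 = 0 by have := N0 1 0 (ival1 _) (ival0 _ _); rewrite scale1r scale0r addr0.
have n2 : nrm w2 = 0 by have := N0 0 1 (ival0 _ _) (ival1 _); rewrite scale1r scale0r add0r.
have tr0 : trc (w1 * conj w2) = 0.
  by have := N0 1 1 (ival1 _) (ival1 _); rewrite !scale1r nrmD n1 n2 !add0r.
have z0 : w1 * conj w2 = 0 by apply: (reducedL) => //; rewrite nrmM n1 mul0r.
have := nrm1; rewrite -e nrmD !nrmM n1 n2 !mulr0 !add0r rmorphM /=.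
rewrite (_ : u1 * w1 * _ = u1 * conj u2 * (w1 * conj w2)); last by ring.
by rewrite z0 mulr0 trc0 => /esym/eqP; rewrite oner_eq0.
Qed.

(* The o-lattice spanned by w1 and w2 is homothetic to o + p ^ m al or to o:
   divide by an element of minimal norm. *)
Lemma lattice_reduce (u1 u2 w1 w2 : L) : u1 * w1 + u2 * w2 = 1 ->
  exists k a b c d, [/\ k \is a GRing.unit, GLin (ppow v 0) (mat2 a b c d),
    a *: w1 + c *: w2 = k &
    b *: w1 + d *: w2 = 0 \/ exists m : nat, b *: w1 + d *: w2 = k * (upi m *: al)].
Proof.
move=> e; have [c1 hc1] := lvalP w1; have [c2 hc2] := lvalP w2; pose c := maxn c1 c2.
have hN x y : ival 0 x -> ival 0 y -> ival (- (c + c)%N%:Z) (nrm (x *: w1 + y *: w2)).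
  move=> hx hy; have h1 : lval (- c%:Z) w1 by apply: lvalW hc1; rewrite lerN2 lez_nat leq_maxl.
  have h2 : lval (- c%:Z) w2 by apply: lvalW hc2; rewrite lerN2 lez_nat leq_maxr.
  have h : lval (- c%:Z) (x *: w1 + y *: w2).
    by rewrite -[- _]add0r lvalD // lvalZ.
  by have := lval_nrm h; rewrite PoszD opprD.
pose P (i : nat) := `[< exists x y, [/\ ival 0 x, ival 0 y, nrm (x *: w1 + y *: w2) != 0 &
  val_lf v (nrm (x *: w1 + y *: w2)) = i%:Z - (c + c)%N%:Z] >].
have toP x y : ival 0 x -> ival 0 y -> nrm (x *: w1 + y *: w2) != 0 ->
    P (absz (val_lf v (nrm (x *: w1 + y *: w2)) + (c + c)%N%:Z)).
  move=> hx hy n0; apply/asboolP; exists x, y; split=> //.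
  by have := hN _ _ hx hy; rewrite ival_val //; lia.
have exP : exists i, P i.
  by have [x [y [hx hy n0]]] := nrm_unimodular e; eexists; exact: toP hx hy n0.
case: (ex_minnP exP) => i /asboolP[x [y [hx hy n0 vi]]] mini.
have {}mini x' y' : ival 0 x' -> ival 0 y' -> ival (val_lf v (nrm (x *: w1 + y *: w2))) (nrm (x' *: w1 + y' *: w2)).
  move=> hx' hy'; have [->|n0'] := eqVneq (nrm (x' *: w1 + y' *: w2)) 0; first exact: ival0.
  rewrite ival_val // vi; have := mini _ (toP _ _ hx' hy' n0').
  by have := hN _ _ hx' hy'; rewrite ival_val //; lia.
set k := x *: w1 + y *: w2 in n0 vi mini.
have uk : k \is a GRing.unit by rewrite unitL.
(* If both coefficients were in p, dividing them by pi would lower the norm of k. *)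
have xy : vunit v x || vunit v y.
  apply: contraT; rewrite negb_or => /andP[/(nvunit hx) hx1 /(nvunit hy) hy1].
  have hd z : ival 1 z -> ival 0 (z / upi 1) by move=> hz; rewrite ivalVM ?upi_neq0 // val_upi add0r.
  have := mini _ _ (hd _ hx1) (hd _ hy1).
  have -> : (x / upi 1) *: w1 + (y / upi 1) *: w2 = (upi 1)^-1 *: k.
    by rewrite /k scalerDr !scalerA ![(upi 1)^-1 * _]mulrC.
  rewrite nrmZ ival_val ?mulf_neq0 ?expf_neq0 ?invr_eq0 ?upi_neq0 //.
  rewrite val_lfM ?expf_neq0 ?invr_eq0 ?upi_neq0 // valX ?invr_eq0 ?upi_neq0 // valV ?upi_neq0 // val_upi mulr2n.
  by set z := val_lf v _; lia.
have [x' [y' [hx' hy' hdet]]] : exists x' y', [/\ ival 0 x', ival 0 y' & vunit v (x * y' - x' * y)].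
  case/orP: xy => h; [exists 0, 1|exists 1, 0]; rewrite ?ival0 ?ival1; split=> //.
    by rewrite mulr1 mul0r subr0.
  by rewrite mulr0 mul1r sub0r vunitN.
(* In units of k the lattice is o + o bt, and by minimality all its elements have integral norm. The
   norms of bt and 1 + bt make the trace of bt integral, so bt lies in o_L. *)
pose bt := (x' *: w1 + y' *: w2) / k.
have kbt : k * bt = x' *: w1 + y' *: w2 by rewrite mulrC divrK.
have hbt a' b' : ival 0 a' -> ival 0 b' -> ival 0 (nrm (a'%:A + b' *: bt)).
  move=> ha hb.
  have h := mini (a' * x + b' * x') (a' * y + b' * y') _ _.
  have {h} : ival (val_lf v (nrm k)) (nrm (k * (a'%:A + b' *: bt))).
    rewrite mulrDr mulr_algr -scalerAr kbt /k !scalerDr !scalerA addrACA -!scalerDl.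
    by apply: h; apply: ivalD; apply: ivalMo.
  by rewrite nrmM -[val_lf v _]add0r -ivalVM // mulrC mulKf.
have nbt : ival 0 (nrm bt).
  by have := hbt 0 1 (ival0 _ _) (ival1 _); rewrite alg0 add0r scale1r.
have tbt : ival 0 (trc bt).
  have := hbt 1 1 (ival1 _) (ival1 _); rewrite !scale1r addrC nrmD nrm1 rmorph1 mulr1 => h.
  have -> : trc bt = nrm bt + 1 + trc bt - nrm bt - 1 by ring.
  by rewrite !ivalB ?ival1.
have [h0 h1] : ival 0 (la bt) /\ ival 0 (lb bt).
  by apply: (ib_TN ib) => //; move: tbt; rewrite /trc mulrC.
(* Subtracting la(bt) times the first vector leaves k times a multiple of al; the unit part of its
   coefficient is divided out below. *)
have eb : (x' - la bt * x) *: w1 + (y' - la bt * y) *: w2 = k * (lb bt *: al).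
  have -> : (x' - la bt * x) *: w1 + (y' - la bt * y) *: w2 = k * bt - la bt *: k.
    by rewrite kbt /k !scalerBl scalerDr !scalerA opprD addrACA.
  by rewrite {1}(lab bt) mulrDr mulr_algr addrC addKr.
have ho1 : ival 0 (x' - la bt * x) by rewrite ivalB // ivalMo.
have ho2 : ival 0 (y' - la bt * y) by rewrite ivalB // ivalMo.
have [b0|b0] := eqVneq (lb bt) 0.
  exists k, x, (x' - la bt * x), y, (y' - la bt * y); split=> //.
    apply: GLin_mat2 => //; move: hdet; congr (vunit _ _); ring.
  by left; rewrite eb b0 scale0r mulr0.
have hm : lb bt = upi (absz (val_lf v (lb bt))) * (lb bt / upi (absz (val_lf v (lb bt)))).
  by rewrite mulrC divfK ?upi_neq0.
set m := absz _ in hm; set q := lb bt / upi m in hm.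
have uq : vunit v q.
  rewrite /vunit mulf_neq0 ?invr_eq0 ?upi_neq0 //= val_lfM ?invr_eq0 ?upi_neq0 // valV ?upi_neq0 // val_upi.
  move: h1; rewrite ival_val // /m => h1; rewrite gez0_abs //; apply/eqP; exact: addrN.
have q0 := vunit_neq0 uq.
exists k, x, (q^-1 * (x' - la bt * x)), y, (q^-1 * (y' - la bt * y)); split=> //.
  apply: GLin_mat2; rewrite // ?ivaloM // ?(vunit_ival (vunitV uq)) //.
  have -> : x * (q^-1 * (y' - la bt * y)) - q^-1 * (x' - la bt * x) * y = q^-1 * (x * y' - x' * y) by ring.
  by rewrite vunitM ?vunitV.
right; exists m; rewrite -!scalerA -scalerDr eb hm -[_ *: al]scalerA -!scalerAr !scalerA.
by congr (_ *: _); field.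
Qed.

Lemma embed_mat2 (a b c d : F) : embed L (mat2 a b c d) = mat2 a%:A b%:A c%:A d%:A.
Proof.
by apply/matrixP=> i j; rewrite !mxE; ord2 i j.
Qed.

Lemma G1_mat2 (b : 'M[L]_2) (mu : F) : conjT conj b *m J2 L *m b = mu%:A *: J2 L <->
  [/\ conj (b 0 0) * b 1 0 = conj (b 1 0) * b 0 0, conj (b 0 1) * b 1 1 = conj (b 1 1) * b 0 1,
      conj (b 0 0) * b 1 1 - conj (b 1 0) * b 0 1 = mu%:A &
      conj (b 1 1) * b 0 0 - conj (b 0 1) * b 1 0 = mu%:A].
Proof.
have -> : conjT conj b = mat2 (conj (b 0 0)) (conj (b 1 0)) (conj (b 0 1)) (conj (b 1 1)).
  by rewrite [LHS]mat2_eta !mxE.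
have -> : mu%:A *: J2 L = mat2 0 mu%:A (- mu%:A) 0.
  by rewrite [LHS]mat2_eta !mxE /= !mulr0 mulr1 mulrN1.
rewrite {5}(mat2_eta b) /J2 !mat2M !mulr0 !mulr1 !add0r !addr0 !mulrN1; split.
  case/mat2_inj; rewrite !mulNr => /eqP e1 e2 e3 /eqP e4; split.
  - by apply/eqP; rewrite -subr_eq0 addrC.
  - by apply/eqP; rewrite -subr_eq0 addrC.
  - by rewrite -e2 addrC.
  - by apply: oppr_inj; rewrite -e3 opprB addrC.
case=> e1 e2 e3 e4; rewrite !mulNr -e1 -e2 -{2}e4 -e3; congr mat2; ring.
Qed.

(** Each entry e satisfies conj(e) det b = mu e. Hence a nonzero entry l is a unit, as norm 0 would
    give mu l^2 = 0 and L is reduced; and all quotients e / l are fixed by conj, so they lie in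
    F. *)
Lemma G1_decomposition (b : 'M[L]_2) : G1 conj b ->
  exists l g, [/\ l \is a GRing.unit, g \in unitmx & b = l *: embed L g].
Proof.
move=> [ub [mu mu0 /G1_mat2]]; move: ub; rewrite (mat2_eta b) unit_mat2 !mxE /=.
move: (b 0 0) (b 0 1) (b 1 0) (b 1 1) => {b} a b c d ub [e1 e2 e3 e4].
set D := a * d - b * c in ub.
have key e : e \in [:: a; b; c; d] -> conj e * D = mu%:A * e.
  rewrite !inE /D => /or4P[] /eqP ->.
  - by rewrite -e3; transitivity (a * (conj a * d) - b * (conj a * c)); [ring|rewrite e1; ring].
  - by rewrite -e4; transitivity (a * (conj b * d) - b * (conj b * c)); [ring|rewrite e2; ring].
  - by rewrite -e3; transitivity (d * (conj c * a) - b * conj c * c); [ring|rewrite -e1; ring].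
  - by rewrite -e4; transitivity (d * conj d * a - c * (conj d * b)); [ring|rewrite -e2; ring].
have eu e : e \in [:: a; b; c; d] -> e != 0 -> e \is a GRing.unit.
  move=> he; apply: contraNT; rewrite unitL negbK => /eqP n0.
  apply/eqP/sqrL_eq0; apply: (mulrI (alg_unit L mu0)).
  by rewrite mulrA -key // mulrC mulrA nrmE n0 alg0 mul0r mulr0.
have [l [hl l0]] : exists l, l \in [:: a; b; c; d] /\ l != 0.
  have [a0|a0] := eqVneq a 0; last by exists a; rewrite !inE eqxx.
  have [b0|b0] := eqVneq b 0; last by exists b; rewrite !inE eqxx orbT.
  by move: ub; rewrite /D a0 b0 !mul0r subrr unitr0.
have ul := eu _ hl l0.
have fix_ e : e \in [:: a; b; c; d] -> e = l * (la (e / l))%:A.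
  move=> he; have ucl : conj l \is a GRing.unit by rewrite conj_unit.
  have hc : conj (e / l) = e / l.
    rewrite rmorphM /= rmorphV //; apply: (mulIr ucl); rewrite divrK //.
    apply: (mulIr ul); rewrite mulrAC divrK //; apply: (mulIr ub).
    by rewrite mulrAC (key e he) -[e * _ * D]mulrA (key l hl); ring.
  by have h := conj_fix hc; rewrite -h mulrC divrK.
exists l, (mat2 (la (a / l)) (la (b / l)) (la (c / l)) (la (d / l))).
have e : mat2 a b c d = l *: embed L (mat2 (la (a / l)) (la (b / l)) (la (c / l)) (la (d / l))).
  rewrite embed_mat2 [RHS]mat2_eta !mxE /=.
  by congr mat2; apply: fix_; rewrite !inE eqxx ?orbT.
split=> //; rewrite unitmxE unitfE; apply: contraTneq ub => h.
by rewrite /D -det_mat2 e detZ det_map_mx h rmorph0 mulr0 unitr0.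
Qed.

Lemma embedZ_inj (l l' : L) (g g' : 'M[F]_2) : l \is a GRing.unit -> l' \is a GRing.unit ->
  g \in unitmx -> l *: embed L g = l' *: embed L g' ->
  exists a, [/\ a != 0, l' = l * a%:A & g = a *: g'].
Proof.
move=> ul ul' ug e.
have eij i j : l * (g i j)%:A = l' * (g' i j)%:A by move/matrixP/(_ i j): e; rewrite !mxE.
have [i [j gij]] : exists i j, g i j != 0.
  by apply/matrix0Pn; apply: contraTneq ug => ->; rewrite unitmxE det0 unitr0.
have gij' : g' i j != 0.
  apply: contraTneq (alg_unit L gij) => h; apply/negP => u.
  by have := unitrM l (g i j)%:A; rewrite eij h alg0 mulr0 unitr0 ul u.
have ll : l' = l * (g i j / g' i j)%:A.
  by rewrite algM mulrA eij -mulrA -algM mulfV // alg1 mulr1.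
exists (g i j / g' i j); split=> //; first by rewrite mulf_neq0 ?invr_eq0.
apply/matrixP=> x y; rewrite !mxE; apply: (@alg_inj _ L); apply: (mulrI ul).
by rewrite eij ll (algM L (_ / _)) mulrA.
Qed.

Lemma embedM n (g h : 'M[F]_n) : embed L (g *m h) = embed L g *m embed L h.
Proof. exact: map_mxM. Qed.

End QuadraticIntegers.

(** * Unitary similitudes *)

Section Mat4.

Definition o0 : 'I_4 := @Ordinal 4 0 isT.
Definition o1 : 'I_4 := @Ordinal 4 1 isT.
Definition o2 : 'I_4 := @Ordinal 4 2 isT.
Definition o3 : 'I_4 := @Ordinal 4 3 isT.

Lemma ord4P (P : 'I_4 -> Prop) : P o0 -> P o1 -> P o2 -> P o3 -> forall i, P i.
Proof.
move=> h0 h1 h2 h3 [[|[|[|[|//]]]] hi].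
- by rewrite (_ : Ordinal hi = o0) //; apply/val_inj.
- by rewrite (_ : Ordinal hi = o1) //; apply/val_inj.
- by rewrite (_ : Ordinal hi = o2) //; apply/val_inj.
- by rewrite (_ : Ordinal hi = o3) //; apply/val_inj.
Qed.

Lemma matrix4P (T : Type) (A B : 'M[T]_4) :
  [/\ A o0 o0 = B o0 o0, A o0 o1 = B o0 o1, A o0 o2 = B o0 o2 & A o0 o3 = B o0 o3] ->
  [/\ A o1 o0 = B o1 o0, A o1 o1 = B o1 o1, A o1 o2 = B o1 o2 & A o1 o3 = B o1 o3] ->
  [/\ A o2 o0 = B o2 o0, A o2 o1 = B o2 o1, A o2 o2 = B o2 o2 & A o2 o3 = B o2 o3] ->
  [/\ A o3 o0 = B o3 o0, A o3 o1 = B o3 o1, A o3 o2 = B o3 o2 & A o3 o3 = B o3 o3] -> A = B.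
Proof.
by move=> [? ? ? ?] [? ? ? ?] [? ? ? ?] [? ? ? ?]; apply/matrixP; apply: ord4P; apply: ord4P.
Qed.

Lemma sum4E (V : nmodType) (f : 'I_4 -> V) : \sum_i f i = f o0 + f o1 + f o2 + f o3.
Proof.
rewrite !big_ord_recl big_ord0 addr0 !addrA.
by congr (f _ + f _ + f _ + f _); apply/val_inj.
Qed.

Lemma mulmx4E (A : pzRingType) (m p : nat) (X : 'M[A]_(m, 4)) (Y : 'M[A]_(4, p)) i j :
  (X *m Y) i j = X i o0 * Y o0 j + X i o1 * Y o1 j + X i o2 * Y o2 j + X i o3 * Y o3 j.
Proof. by rewrite mxE sum4E. Qed.

Lemma J4_sqr (A : pzRingType) : J4 A *m J4 A = - 1%:M.
Proof.
by apply: matrix4P; rewrite !mulmx4E !mxE /= ?(mul0r, mulr0, add0r, addr0, mulr1, mul1r, oppr0, mulrN1).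
Qed.

Lemma J4_mulE (A : comPzRingType) (X Y : 'M[A]_4) i j :
  (X *m J4 A *m Y) i j = X i o0 * Y o2 j + X i o1 * Y o3 j - X i o2 * Y o0 j - X i o3 * Y o1 j.
Proof. by rewrite !mulmx4E !mxE /=; ring. Qed.

Lemma mat4_eta (A : pzRingType) (g : 'M[A]_4) :
  g = mat4 [:: [:: g o0 o0; g o0 o1; g o0 o2; g o0 o3]; [:: g o1 o0; g o1 o1; g o1 o2; g o1 o3];
               [:: g o2 o0; g o2 o1; g o2 o2; g o2 o3]; [:: g o3 o0; g o3 o1; g o3 o2; g o3 o3]].
Proof. by apply: matrix4P; rewrite !mxE. Qed.

End Mat4.

Ltac mat4_ring := apply: matrix4P; split; rewrite !(mulmx4E, mxE) /=; ring.

Section ParabolicProducts.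
Variable A : comPzRingType.
Implicit Types a b c d k x y z yb zb : A.

Lemma unipotent_prod x y yb z zb :
  mat4 [:: [:: 1; z; 0; 0]; [:: 0; 1; 0; 0]; [:: 0; 0; 1; 0]; [:: 0; 0; - zb; 1]] *m
  mat4 [:: [:: 1; 0; x; y]; [:: 0; 1; yb; 0]; [:: 0; 0; 1; 0]; [:: 0; 0; 0; 1]] =
  mat4 [:: [:: 1; z; x + z * yb; y]; [:: 0; 1; yb; 0]; [:: 0; 0; 1; 0]; [:: 0; 0; - zb; 1]].
Proof. by mat4_ring. Qed.

Lemma levi_prod a b c d k z zb :
  mat4 [:: [:: z; 0; 0; 0]; [:: 0; 1; 0; 0]; [:: 0; 0; zb; 0]; [:: 0; 0; 0; 1]] *m
  mat4 [:: [:: 1; 0; 0; 0]; [:: 0; a; 0; b]; [:: 0; 0; k; 0]; [:: 0; c; 0; d]] =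
  mat4 [:: [:: z; 0; 0; 0]; [:: 0; a; 0; b]; [:: 0; 0; zb * k; 0]; [:: 0; c; 0; d]].
Proof. by mat4_ring. Qed.

Lemma parabolic_prod a b c d k x y yb z zz zb :
  mat4 [:: [:: z; 0; 0; 0]; [:: 0; a; 0; b]; [:: 0; 0; k; 0]; [:: 0; c; 0; d]] *m
  mat4 [:: [:: 1; zz; x; y]; [:: 0; 1; yb; 0]; [:: 0; 0; 1; 0]; [:: 0; 0; - zb; 1]] =
  mat4 [:: [:: z; z * zz; z * x; z * y]; [:: 0; a; a * yb - b * zb; b]; [:: 0; 0; k; 0];
           [:: 0; c; c * yb - d * zb; d]].
Proof. by mat4_ring. Qed.

End ParabolicProducts.

(** * The similitude group and its parabolic subgroup P *)

Section Similitudes.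
Variables (F : fieldType) (L : comUnitAlgType F) (conj : {lrmorphism L -> L}).
Hypothesis conjK : involutive conj.
Hypothesis conj_fixed : forall x, conj x = x -> exists a, x = a%:A.
Local Notation conjT := (conjT conj).
Local Notation inG2 := (similitude_group conj (J4 L)).
Implicit Types g h p : 'M[L]_4.

Lemma conjTM n (g h : 'M[L]_n) : conjT (g *m h) = conjT h *m conjT g.
Proof. by rewrite /Defs.conjT map_mxM trmx_mul. Qed.

Lemma conjTE n (g : 'M[L]_n) i j : conjT g i j = conj (g j i).
Proof. by rewrite !mxE. Qed.

Lemma conjT1 n : conjT 1%:M = 1%:M :> 'M[L]_n.
Proof. by rewrite /Defs.conjT map_mx1 trmx1. Qed.

Lemma conjT_embed n (h : 'M[F]_n) : conjT (embed L h) = embed L h^T.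
Proof. by apply/matrixP=> i j; rewrite !mxE /= conj_alg. Qed.

Definition simil g (mu : F) := conjT g *m J4 L *m g = mu%:A *: J4 L.

Lemma simil1 : simil 1%:M 1.
Proof. by rewrite /simil conjT1 mul1mx mulmx1 alg1 scale1r. Qed.

Lemma similM g h mu mu' : simil g mu -> simil h mu' -> simil (g *m h) (mu * mu').
Proof.
rewrite /simil conjTM => eg eh; rewrite -!mulmxA [J4 L *m (g *m h)]mulmxA.
by rewrite (mulmxA (conjT g)) (mulmxA (conjT g)) eg -scalemxAl -scalemxAr mulmxA eh scalerA algM.
Qed.

Lemma simil_mulN g mu : simil g mu -> (- (J4 L *m conjT g *m J4 L)) *m g = mu%:A%:M.
Proof.
by move=> e; rewrite mulNmx -!mulmxA (mulmxA (conjT g)) e -scalemxAr J4_sqr scalerN opprK scalemx1.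
Qed.

Lemma simil_unit g mu : mu != 0 -> simil g mu -> g \in unitmx.
Proof.
move=> mu0 e; have u := alg_unit L mu0.
have : (mu%:A^-1 *: - (J4 L *m conjT g *m J4 L)) *m g = 1%:M.
  by rewrite -scalemxAl (simil_mulN e) -[mu%:A%:M]scalemx1 scalerA mulVr // scale1r.
by move/mulmx1_unit => [].
Qed.

Lemma simil_inv g mu : mu != 0 -> simil g mu ->
  invmx g = mu^-1%:A *: - (J4 L *m conjT g *m J4 L).
Proof.
move=> mu0 e; have ug := simil_unit mu0 e; apply: (can_inj (mulmxK ug)).
by rewrite mulVmx // -scalemxAl (simil_mulN e) -[mu%:A%:M]scalemx1 scalerA -algM mulVf // alg1 scale1r.
Qed.

Lemma simil_rows g mu : mu != 0 -> simil g mu -> g *m J4 L *m conjT g = mu%:A *: J4 L.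
Proof.
move=> mu0 e; have ug := simil_unit mu0 e.
have := mulmxV ug; rewrite (simil_inv mu0 e) -scalemxAr mulmxN !mulmxA.
move/(congr1 (fun X => mu%:A *: (X *m J4 L))); rewrite -scalemxAl scalerA -algM mulfV // alg1 scale1r.
by rewrite mulNmx -[_ *m J4 L *m J4 L]mulmxA J4_sqr mulmxN opprK mulmx1 mul1mx.
Qed.

Lemma inG2P g : inG2 g <-> exists2 mu : F, mu != 0 & simil g mu.
Proof. by split=> [[_ h]|[mu mu0 e]] //; split; [exact: simil_unit e|exists mu]. Qed.

Lemma inG2_unit g : inG2 g -> g \in unitmx. Proof. by case. Qed.

Lemma inG2M g h : inG2 g -> inG2 h -> inG2 (g *m h).
Proof.
move=> /inG2P[mu mu0 e] /inG2P[mu' mu0' e']; apply/inG2P; exists (mu * mu').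
  by rewrite mulf_neq0.
exact: similM.
Qed.

Lemma inG2_1 : inG2 1%:M.
Proof. by apply/inG2P; exists 1; [exact: oner_neq0|exact: simil1]. Qed.

Lemma similV g mu : mu != 0 -> simil g mu -> simil (invmx g) mu^-1.
Proof.
move=> mu0 e; have ug := simil_unit mu0 e.
have := e; move/(congr1 (fun X => mu^-1%:A *: (conjT (invmx g) *m X *m invmx g))).
rewrite !mulmxA -conjTM mulmxV // conjT1 mul1mx -mulmxA mulmxV // mulmx1 -scalemxAr -scalemxAl scalerA.
by rewrite -algM mulVf // alg1 scale1r => h; exact: esym h.
Qed.

Lemma inG2V g : inG2 g -> inG2 (invmx g).
Proof.
move=> /inG2P[mu mu0 e]; apply/inG2P; exists mu^-1; first by rewrite invr_eq0.
exact: similV.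
Qed.

(* The parabolic subgroup P, as the stabilizer of the line spanned by the third basis row
   vector; [zof] and [bof] recover zeta and b from m_1(zeta) m_2(b) n. *)
Definition Q p := inG2 p /\ [/\ p o2 o0 = 0, p o2 o1 = 0 & p o2 o3 = 0].

Definition zof p := p o0 o0.
Definition bof p := mat2 (p o1 o1) (p o1 o3) (p o3 o1) (p o3 o3).

(** Pairing the rows with the third one, whose only nonzero entry is [p o2 o2], gives the multiplier
    and clears the first column below its top entry. *)
Lemma Q_rel p : Q p -> exists mu, [/\ mu != 0, simil p mu, p o0 o0 * conj (p o2 o2) = mu%:A,
  [/\ p o1 o0 = 0, p o2 o0 = 0 & p o3 o0 = 0] & p o0 o0 \is a GRing.unit /\ p o2 o2 \is a GRing.unit].
Proof.
move=> [/inG2P[mu mu0 e] [p20 p21 p23]]; exists mu; have /matrixP r := simil_rows mu0 e.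
have r02 : p o0 o0 * conj (p o2 o2) = mu%:A.
  have := r o0 o2; rewrite J4_mulE !conjTE p20 p21 p23 !rmorph0 !mulr0 !subr0 addr0 => ->.
  by rewrite !mxE /= mulr1.
have u : p o0 o0 * conj (p o2 o2) \is a GRing.unit by rewrite r02 alg_unit.
have [u0 u2] : p o0 o0 \is a GRing.unit /\ conj (p o2 o2) \is a GRing.unit.
  by apply/andP; rewrite -unitrM.
split=> //.
  split=> //; apply: (mulIr u2); rewrite mul0r.
    by have := r o1 o2; rewrite J4_mulE !conjTE p20 p21 p23 !rmorph0 !mulr0 !subr0 addr0 => ->; rewrite !mxE /= mulr0.
  by have := r o3 o2; rewrite J4_mulE !conjTE p20 p21 p23 !rmorph0 !mulr0 !subr0 addr0 => ->; rewrite !mxE /= mulr0.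
by split=> //; rewrite -[p o2 o2]conjK rmorph_unit.
Qed.

Lemma bof_rel p mu : Q p -> simil p mu -> conjT (bof p) *m J2 L *m bof p = mu%:A *: J2 L.
Proof.
move=> [_ [p20 p21 p23]] e; apply/G1_mat2; have /matrixP r := e; rewrite !mxE /=.
have E i j : conj (p o1 i) * p o3 j - conj (p o3 i) * p o1 j =
    conj (p o0 i) * - p o2 j + conj (p o2 i) * p o0 j + mu%:A * J4 L i j.
  by have := r i j; rewrite J4_mulE !conjTE [RHS]mxE => <-; ring.
split.
- by have := E o1 o1; rewrite !mxE /= p21 oppr0 rmorph0 !mulr0 mul0r !addr0 => /eqP; rewrite subr_eq0 => /eqP.
- by have := E o3 o3; rewrite !mxE /= p23 oppr0 rmorph0 !mulr0 mul0r !addr0 => /eqP; rewrite subr_eq0 => /eqP.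
- by rewrite E !mxE /= p21 p23 oppr0 rmorph0 mulr0 mul0r !add0r mulr1.
- by rewrite -opprB E !mxE /= p21 p23 oppr0 rmorph0 mulr0 mul0r !add0r mulrN1 opprK.
Qed.

Lemma mu1E (b : 'M[L]_2) mu : conjT b *m J2 L *m b = mu%:A *: J2 L -> mu1 conj b = mu.
Proof.
move=> e; rewrite /mu1 /multiplier; case: xgetP => [mu' _ /= e'|h]; last by case: (h mu).
apply: (@alg_inj _ L); have /matrixP/(_ 0 1) : mu'%:A *: J2 L = mu%:A *: J2 L by rewrite -e -e'.
by rewrite !mxE /= !mulr1.
Qed.

Lemma bof_unit p : Q p -> bof p \in unitmx.
Proof.
move=> hQ; have [mu [mu0 e _ _ _]] := Q_rel hQ; have := congr1 determinant (bof_rel hQ e).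
rewrite !det_mulmx detZ det_mat2 mulr0 mulrN1 sub0r opprK !mulr1 unitmxE => h.
have : \det (conjT (bof p)) * \det (bof p) \is a GRing.unit by rewrite h unitrX // alg_unit.
by rewrite unitrM => /andP[].
Qed.

Lemma bof_G1 p : Q p -> G1 conj (bof p).
Proof.
move=> hQ; have [mu [mu0 e _ _ _]] := Q_rel hQ.
by split; [exact: bof_unit|exists mu => //; exact: bof_rel].
Qed.

Lemma QM p p' : Q p -> Q p' ->
  [/\ Q (p *m p'), zof (p *m p') = zof p * zof p' & bof (p *m p') = bof p *m bof p'].
Proof.
move=> hQ hQ'; have [_ [_ _ _ [p10 _ p30] _]] := Q_rel hQ.
have [_ [_ _ _ [p10' _ p30'] _]] := Q_rel hQ'.
have [G [p20 p21 p23]] := hQ; have [G' [p20' p21' p23']] := hQ'.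
split.
- split; first exact: inG2M.
  by split; rewrite mulmx4E p20 p21 p23 ?p20' ?p21' ?p23' !mul0r mulr0 !addr0.
- by rewrite /zof mulmx4E p10' p20' p30' !mulr0 !addr0.
- rewrite /bof mat2M !mulmx4E p21' p23' p10 p30 !mul0r !mulr0 !add0r !addr0 //.
Qed.

Lemma Q1 : [/\ Q 1%:M, zof 1%:M = 1 & bof 1%:M = 1%:M].
Proof.
split; first by split; [exact: inG2_1|split; rewrite mxE].
  by rewrite /zof mxE.
by rewrite /bof !mxE /= mat2_1.
Qed.

Lemma QV p : Q p -> Q (invmx p).
Proof.
move=> hQ; have [mu [mu0 e r02 [p10 p20 p30] [u0 u2]]] := Q_rel hQ; have [G [_ p21 p23]] := hQ.
split; first exact: inG2V.
have h j : j != o2 -> (invmx p) o2 j = 0.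
  move=> jn; apply: (mulrI u2); rewrite mulr0.
  have := mulmxV (inG2_unit G); move/matrixP/(_ o2 j); rewrite mulmx4E p20 p21 p23 !mul0r addr0 !add0r => ->.
  by rewrite mxE eq_sym (negbTE jn).
by split; apply: h.
Qed.

(* Explicit coordinates on the unipotent radical, read off from the first row. *)
Lemma Q_form p : Q p -> exists u, NF conj u /\ p = m1 conj (zof p) *m m2 conj (bof p) *m u.
Proof.
move=> hQ; have [mu [mu0 e r02 [p10 p20 p30] [u0 u2]]] := Q_rel hQ; have [G [_ p21 p23]] := hQ.
have /matrixP r := simil_rows mu0 e; have := bof_rel hQ e => /G1_mat2; rewrite !mxE /= => -[_ _ eb _].
set z := p o0 o0 in u0 r02.
have ucz : conj z \is a GRing.unit by rewrite rmorph_unit.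
have cV : conj z^-1 = (conj z)^-1 by rewrite rmorphV.
(* The second and fourth rows are orthogonal to the first, which determines their third entries. *)
have R i : i = o1 \/ i = o3 -> p i o2 = p i o1 * conj (p o0 o3 / z) - p i o3 * conj (p o0 o1 / z).
  move=> hi; have hi0 : p i o0 = 0 by case: hi => ->.
  have hJ : J4 L i o0 = 0 by case: hi => ->; rewrite !mxE.
  apply: (mulIr ucz); rewrite !rmorphM /= cV mulrBl -!mulrA mulVr // !mulr1.
  have := r i o0; rewrite J4_mulE !conjTE hi0 mul0r add0r mxE hJ mulr0 => /eqP.
  by rewrite subr_eq0 subr_eq => /eqP ->; rewrite addrC addKr.
(* Isotropy of the first row says that this element is fixed by conj. *)
have [x hx] : exists x, p o0 o2 / z - p o0 o1 / z * conj (p o0 o3 / z) = x%:A.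
  apply: conj_fixed; apply: (mulIr u0); apply: (mulIr ucz).
  rewrite rmorphB !rmorphM /= conjK cV [conj (conj z)^-1]rmorphV //= conjK !mulrBl.
  have k1 a : a / z * z = a by rewrite divrK.
  have k2 a : a / conj z * conj z = a by rewrite divrK.
  have -> : conj (p o0 o2) / conj z * z * conj z = conj (p o0 o2) / conj z * conj z * z by ring.
  have -> : conj (p o0 o1) / conj z * (p o0 o3 / z) * z * conj z
    = conj (p o0 o1) / conj z * conj z * (p o0 o3 / z * z) by ring.
  have -> : p o0 o1 / z * (conj (p o0 o3) / conj z) * z * conj z
    = p o0 o1 / z * z * (conj (p o0 o3) / conj z * conj z) by ring.
  rewrite !k1 !k2; have := r o0 o0; rewrite J4_mulE !conjTE !mxE /= mulr0 -/z => e0.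
  by apply/eqP; rewrite -subr_eq0 -[X in _ == X]e0; apply/eqP; ring.
have k1 a : z * (a / z) = a by rewrite mulrC divrK.
exists (mat4 [:: [:: 1; p o0 o1 / z; 0; 0]; [:: 0; 1; 0; 0];
              [:: 0; 0; 1; 0]; [:: 0; 0; - conj (p o0 o1 / z); 1]] *m
     mat4 [:: [:: 1; 0; x%:A; p o0 o3 / z]; [:: 0; 1; conj (p o0 o3 / z); 0];
              [:: 0; 0; 1; 0]; [:: 0; 0; 0; 1]]).
split; first by exists x, (p o0 o3 / z), (p o0 o1 / z).
have p22 : p o2 o2 = (conj z)^-1 * mu%:A.
  by apply: (mulrI ucz); rewrite mulrA mulrV // mul1r -(conj_alg conj mu) -r02 rmorphM /= conjK.
rewrite unipotent_prod /m1 levi_prod parabolic_prod -/z !mxE /= -hx subrK !k1.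
by rewrite {1}(mat4_eta p) p10 p20 p30 p21 p23 p22 -eb (R o1 (or_introl erefl)) (R o3 (or_intror erefl)) [p o1 o3 * conj (p o3 o1)]mulrC.
Qed.

Lemma simil_entries (g : 'M[L]_4) mu : (forall i j, conj (g o0 i) * g o2 j + conj (g o1 i) * g o3 j
    - conj (g o2 i) * g o0 j - conj (g o3 i) * g o1 j = mu%:A * J4 L i j) -> simil g mu.
Proof. by move=> h; apply/matrixP=> i j; rewrite J4_mulE !conjTE h [RHS]mxE. Qed.

Lemma simil_m1 z : z \is a GRing.unit -> simil (m1 conj z) 1.
Proof.
move=> uz; have ucz : conj z \is a GRing.unit by rewrite rmorph_unit.
have e : conj (conj z)^-1 = z^-1 by rewrite rmorphV //= conjK.
apply: simil_entries; rewrite /m1; apply: ord4P; apply: ord4P; rewrite !mxE /= ?rmorph0 ?rmorph1 ?e alg1;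
  rewrite ?(mul0r, mulr0, add0r, addr0, subr0, mul1r, mulr1, sub0r, oppr0, mulrV, mulVr) //.
Qed.

Lemma simil_m2 (b : 'M[L]_2) mu : conjT b *m J2 L *m b = mu%:A *: J2 L -> simil (m2 conj b) mu.
Proof.
case/G1_mat2 => e1 e2 e3 e4; have e5 : conj (b 0 0) * b 1 1 - b 0 1 * conj (b 1 0) = mu%:A.
  by rewrite -e3 [b 0 1 * _]mulrC.
apply: simil_entries; rewrite /m2 e5; apply: ord4P; apply: ord4P; rewrite !mxE /= ?rmorph0 ?rmorph1 ?conj_alg;
  rewrite ?(mul0r, mulr0, add0r, addr0, subr0, mul1r, mulr1, sub0r, oppr0, mulrN1) //.
- by rewrite e1 subrr.
- by rewrite -e4 opprB.
- by rewrite e2 subrr.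
Qed.

Lemma simil_NF u : NF conj u -> simil u 1.
Proof.
move=> [x [y [z ->]]]; rewrite unipotent_prod.
apply: simil_entries; apply: ord4P; apply: ord4P; rewrite !mxE /= ?(rmorph0, rmorph1, rmorphD, rmorphN, rmorphM, conjK) /= ?conj_alg alg1 ?conjK; ring.
Qed.

Lemma Q_m1m2u z b u : z \is a GRing.unit -> G1 conj b -> NF conj u ->
  [/\ Q (m1 conj z *m m2 conj b *m u), zof (m1 conj z *m m2 conj b *m u) = z &
      bof (m1 conj z *m m2 conj b *m u) = b].
Proof.
move=> uz [ub [mu mu0 e]] hu.
have : inG2 (m1 conj z *m m2 conj b *m u).
  apply/inG2P; exists (1 * mu * 1); first by rewrite mul1r mulr1.
  by apply: similM; [apply: similM; [exact: simil_m1|exact: simil_m2]|exact: simil_NF].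
have [x [y [zz ->]]] := hu; rewrite unipotent_prod /m1 levi_prod parabolic_prod => G.
split; first by split; rewrite // !mxE.
  by rewrite /zof !mxE.
by rewrite /bof !mxE /= -mat2_eta.
Qed.

(** A unipotent element of the Siegel Levi subgroup. Its third row is (0, 0, 1, x), so its coset
    modulo P stands for the line of that vector. *)
Definition eta_mx (x : L) : 'M[L]_4 :=
  mat4 [:: [:: 1; 0; 0; 0]; [:: - conj x; 1; 0; 0]; [:: 0; 0; 1; x]; [:: 0; 0; 0; 1]].

Lemma simil_eta x : simil (eta_mx x) 1.
Proof.
apply: simil_entries; apply: ord4P; apply: ord4P; rewrite !mxE /= ?(rmorph0, rmorph1, rmorphN) /= ?conjK alg1; ring.
Qed.

Lemma inG2_eta x : inG2 (eta_mx x).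
Proof. by apply/inG2P; exists 1; [exact: oner_neq0|exact: simil_eta]. Qed.

Lemma etaD x y : eta_mx (x + y) = eta_mx x *m eta_mx y.
Proof. by rewrite /eta_mx rmorphD /=; mat4_ring. Qed.

Lemma eta0 : eta_mx 0 = 1%:M.
Proof. by rewrite /eta_mx rmorph0 oppr0; apply: matrix4P; rewrite !mxE. Qed.

Lemma etaVK x : eta_mx x *m eta_mx (- x) = 1%:M. Proof. by rewrite -etaD addrN eta0. Qed.

End Similitudes.

(** For m_2(g) with g over F, conjugation by eta_x adds only terms with a factor x or conj x times 1
    - a, y or D - d; these three lie in p^(r - m) for g in K1(p^(r - m)). *)
Lemma eta_conj_levi (A : comPzRingType) (a b y d D x xb : A) :
  mat4 [:: [:: 1; 0; 0; 0]; [:: xb; 1; 0; 0]; [:: 0; 0; 1; - x]; [:: 0; 0; 0; 1]] *m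
  mat4 [:: [:: 1; 0; 0; 0]; [:: 0; a; 0; b]; [:: 0; 0; D; 0]; [:: 0; y; 0; d]] *m
  mat4 [:: [:: 1; 0; 0; 0]; [:: - xb; 1; 0; 0]; [:: 0; 0; 1; x]; [:: 0; 0; 0; 1]] =
  mat4 [:: [:: 1; 0; 0; 0]; [:: xb * (1 - a); a; 0; b];
    [:: x * (xb * y); - (x * y); D; x * (D - d)]; [:: - (xb * y); y; 0; d]].
Proof.
transitivity (mat4 [:: [:: 1; 0; 0; 0]; [:: xb; a; 0; b]; [:: 0; - (x * y); D; - (x * d)]; [:: 0; y; 0; d]] *m
  mat4 [:: [:: 1; 0; 0; 0]; [:: - xb; 1; 0; 0]; [:: 0; 0; 1; x]; [:: 0; 0; 0; 1]]); last by mat4_ring.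
by congr (_ *m _); mat4_ring.
Qed.

(** * Double cosets of P and K^H Gamma(P^r) *)

Section CompactGroup.
Variables (F : fieldType) (v : local_field F).
Variables (L : comUnitAlgType F) (conj : {lrmorphism L -> L}).
Variables (al : L) (t nu : F).
Hypothesis ib : integral_basis v conj al t nu.
Local Notation ival := (ival v).
Local Notation upi := (upi v).
Local Notation la := (la ib).
Local Notation lb := (lb ib).
Local Notation lval := (lval ib).
Local Notation lunit := (lunit ib).
Local Notation inG2 := (similitude_group conj (J4 L)).
Local Notation Q := (Q conj).
Local Notation simil := (simil conj).
Let cK := conjK ib.

Definition mxlval (k : int) m n (A : 'M[L]_(m, n)) : Prop := forall i j, lval k (A i j).

Lemma mxlvalM k l m n p (A : 'M[L]_(m, n)) (B : 'M[L]_(n, p)) :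
  mxlval k A -> mxlval l B -> mxlval (k + l) (A *m B).
Proof. by move=> hA hB i j; rewrite mxE; apply: lval_sum => x _; apply: lvalM. Qed.

Lemma mxlvalMo k m n p (A : 'M[L]_(m, n)) (B : 'M[L]_(n, p)) :
  mxlval k A -> mxlval 0 B -> mxlval k (A *m B).
Proof. by move=> hA hB; rewrite -[k]addr0; apply: mxlvalM. Qed.

Lemma mxlvaloM k m n p (A : 'M[L]_(m, n)) (B : 'M[L]_(n, p)) :
  mxlval 0 A -> mxlval k B -> mxlval k (A *m B).
Proof. by move=> hA hB; rewrite -[k]add0r; apply: mxlvalM. Qed.

Lemma mxlvalD k m n (A B : 'M[L]_(m, n)) : mxlval k A -> mxlval k B -> mxlval k (A + B).
Proof. by move=> hA hB i j; rewrite mxE lvalD. Qed.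

Lemma mxlvalBC k m n (A B : 'M[L]_(m, n)) : mxlval k (A - B) -> mxlval k (B - A).
Proof. by move=> h i j; have := h i j; rewrite !mxE lvalBC. Qed.

Lemma mxlval_embed k m (h : 'M[F]_m) : mxlval k (embed L h) <-> mxival v k h.
Proof. by split=> H i j; have := H i j; rewrite mxE /= lval_alg. Qed.

Lemma GLoLP n (g : 'M[L]_n) : GLin (@oL F v L) g <-> [/\ g \in unitmx, mxlval 0 g & mxlval 0 (invmx g)].
Proof. by split=> -[u h hi]; split=> // i j; apply/(oLE ib)/h || apply/(oLE ib)/hi. Qed.

Lemma GLoLM n (g h : 'M[L]_n) : GLin (@oL F v L) g -> GLin (@oL F v L) h -> GLin (@oL F v L) (g *m h).
Proof.
apply: GLinM => [|x y /(oLE ib) hx /(oLE ib) hy|x y /(oLE ib) hx /(oLE ib) hy]; apply/(oLE ib).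
- exact: lval0.
- exact: lvalD.
- exact: lvalMo.
Qed.

Lemma mxlval_J4 : mxlval 0 (J4 L).
Proof. by apply: ord4P; apply: ord4P; rewrite !mxE /= ?lvalN ?lval0 ?lval1. Qed.

Lemma simil_GLoL g mu : vunit v mu -> simil g mu -> mxlval 0 g -> GLin (@oL F v L) g.
Proof.
move=> umu e hg; have mu0 := vunit_neq0 umu; apply/GLoLP; split=> //; first exact: simil_unit mu0 e.
have hJ := mxlval_J4; have hc : mxlval 0 (conjT conj g) by move=> i j; rewrite conjTE lval_conj.
rewrite (simil_inv mu0 e) => i j; rewrite mxE lvaloM //.
  by rewrite lval_alg vunit_ival // vunitV.
by rewrite mxE lvalN; apply: mxlvalMo => //; apply: mxlvalMo.
Qed.

(** mu is an entry of the integral matrix conj(g)^T J g, and 1 / mu is one for the inverse of g. *)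
Lemma GLoL_simil g mu : mu != 0 -> simil g mu -> GLin (@oL F v L) g -> vunit v mu.
Proof.
have half h m : simil h m -> mxlval 0 h -> ival 0 m.
  move=> e hh; rewrite -(lval_alg ib); have /matrixP/(_ o0 o2) := e.
  rewrite [RHS]mxE [J4 L _ _]mxE /= mulr1 => <-; apply: mxlvalMo => //; apply: mxlvalMo.
    by move=> i j; rewrite conjTE lval_conj.
  exact: mxlval_J4.
move=> mu0 e /GLoLP[_ hg hi]; apply: vunitP (half _ _ e hg) (half _ _ (similV mu0 e) hi) mu0.
Qed.

Lemma simil_embed (h : 'M[F]_4) mu : h^T *m J4 F *m h = mu *: J4 F -> simil (embed L h) mu.
Proof.
have J4E : J4 L = embed L (J4 F).
  by apply: matrix4P; rewrite !mxE /= ?algN ?alg0 ?alg1.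
move=> e; rewrite /(simil _ _) conjT_embed J4E -!embedM e; apply/matrixP=> i j.
by rewrite !mxE /= algM.
Qed.

Lemma KHP (k : 'M[L]_4) : KH v k -> inG2 k /\ GLin (@oL F v L) k.
Proof.
move=> [h [-> Gh [mu mu0 e]]]; have s := simil_embed e.
split; first by apply/inG2P; exists mu.
have /GLinoP[uh hh ih] := Gh; apply/GLoLP; split.
- exact: simil_unit mu0 s.
- exact/mxlval_embed.
- have -> : invmx (embed L h) = embed L (invmx h).
    by apply: invmx_eq; rewrite -embedM mulmxV // /embed map_mx1.
  exact/mxlval_embed.
Qed.

Lemma KHM (k k' : 'M[L]_4) : KH v k -> KH v k' -> KH v (k *m k').
Proof.
move=> [h [-> Gh [mu mu0 e]]] [h' [-> Gh' [mu' mu0' e']]].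
exists (h *m h'); split; [by rewrite embedM|exact: GLinoM|].
exists (mu * mu'); first by rewrite mulf_neq0.
rewrite trmx_mul -!mulmxA [J4 F *m (h *m h')]mulmxA (mulmxA h^T) (mulmxA h^T) e.
by rewrite -scalemxAl -scalemxAr mulmxA e' scalerA.
Qed.

Lemma KHV (k : 'M[L]_4) : KH v k -> KH v (invmx k).
Proof.
move=> [h [-> Gh [mu mu0 e]]]; have [uh _ _] := Gh; exists (invmx h); split.
- by apply: invmx_eq; rewrite -embedM mulmxV // /embed map_mx1.
- exact: GLinV.
exists mu^-1; first by rewrite invr_eq0.
have := congr1 (fun X => mu^-1 *: ((invmx h)^T *m X *m invmx h)) e.
rewrite !mulmxA -trmx_mul mulmxV // trmx1 mul1mx -mulmxA mulmxV // mulmx1 -scalemxAr -scalemxAl scalerA.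
by rewrite mulVf // scale1r => ->.
Qed.

Lemma KH1 : KH v (1%:M : 'M[L]_4).
Proof.
exists 1%:M; split; first by rewrite /embed map_mx1.
  apply/GLinoP; split; [exact: unitmx1|exact: mxival1|].
  by rewrite invmx1; exact: mxival1.
by exists 1; [exact: oner_neq0|rewrite trmx1 mul1mx mulmx1 scale1r].
Qed.

Lemma GLoL_eta x : lval 0 x -> GLin (@oL F v L) (eta_mx conj x).
Proof.
move=> hx; apply: simil_GLoL (vunit1 v) (simil_eta cK x) _.
by apply: ord4P; apply: ord4P; rewrite !mxE /= ?lvalN ?lval_conj ?lval0 ?lval1.
Qed.

Variable r : nat.

(* The group K^H Gamma(P^r), as the elements congruent to one of K^H. *)
Definition CC (c : 'M[L]_4) := [/\ inG2 c, GLin (@oL F v L) c & exists2 k, KH v k & mxlval r (c - k)].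

Lemma CCM c c' : CC c -> CC c' -> CC (c *m c').
Proof.
move=> [G Gc [k hk e]] [G' Gc' [k' hk' e']]; split; [exact: inG2M|exact: GLoLM|].
exists (k *m k'); first exact: KHM.
have -> : c *m c' - k *m k' = c *m (c' - k') + (c - k) *m k'.
  by rewrite mulmxBr mulmxBl addrA subrK.
have [_ Gk'] := KHP hk'; apply: mxlvalD; [apply: mxlvaloM|apply: mxlvalMo] => //.
  by case/GLoLP: Gc.
by case/GLoLP: Gk'.
Qed.

Lemma CCV c : CC c -> CC (invmx c).
Proof.
move=> [G Gc [k hk e]]; split; [exact: inG2V|exact: GLinV|].
exists (invmx k); first exact: KHV.
have [[uk _] Gk] := KHP hk; have [uc _] := G.
have -> : invmx c - invmx k = invmx c *m (k - c) *m invmx k.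
  by rewrite mulmxBr mulmxBl mulmxK // mulVmx // mul1mx.
apply: mxlvalMo; last by case/GLoLP: (GLinV Gk).
by apply: mxlvaloM; [case/GLoLP: (GLinV Gc)|exact: mxlvalBC].
Qed.

Lemma CC_KH k : KH v k -> CC k.
Proof.
by move=> hk; have [? ?] := KHP hk; split=> //; exists k => // i j; rewrite !mxE subrr lval0.
Qed.

Lemma CC1 : CC 1%:M. Proof. exact/CC_KH/KH1. Qed.

Lemma GammaE (u : 'M[L]_4) : Gamma v conj r u <-> [/\ inG2 u, GLin (@oL F v L) u & mxlval r (u - 1%:M)].
Proof. by split=> -[h1 h2 h3]; split=> // i j; apply/(PLpowE ib)/h3. Qed.

Lemma CC_Gamma u : Gamma v conj r u -> CC u.
Proof. by move=> /GammaE[? ? ?]; split=> //; exists 1%:M => //; exact: KH1. Qed.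

Lemma CC_decomposition c : CC c -> exists k u, [/\ KH v k, Gamma v conj r u & c = k *m u].
Proof.
move=> [G Gc [k hk e]]; have [[uk _] Gk] := KHP hk; have [Gk2 _] := KHP hk.
exists k, (invmx k *m c); split=> //; last by rewrite mulKVmx.
apply/GammaE; split; [by apply: inG2M => //; exact: inG2V|by apply: GLoLM => //; exact: GLinV|].
rewrite -(mulVmx uk) -mulmxBr; apply: mxlvaloM => //.
by case/GLoLP: (GLinV Gk).
Qed.

Lemma CC_eta x : lval r x -> CC (eta_mx conj x).
Proof.
move=> hx; apply: CC_Gamma; apply/GammaE; split; [exact: inG2_eta|apply: GLoL_eta; exact: lvalW hx|].
by apply: ord4P; apply: ord4P; rewrite !mxE /= ?subrr ?subr0 ?lvalN ?lval_conj ?lval0.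
Qed.

Lemma KH_intro (h : 'M[F]_4) mu : vunit v mu -> h^T *m J4 F *m h = mu *: J4 F -> mxival v 0 h ->
  KH v (embed L h).
Proof.
move=> hmu e hh; have mu0 := vunit_neq0 hmu; exists h; split=> //; last by exists mu.
have hJ : mxival v 0 (J4 F) by apply: ord4P; apply: ord4P; rewrite !mxE /= ?ivalN ?ival0 ?ival1.
have e1 : (mu^-1 *: - (J4 F *m h^T *m J4 F)) *m h = 1%:M.
  rewrite -scalemxAl mulNmx -!mulmxA (mulmxA h^T) e -scalemxAr J4_sqr !scalerN opprK scalerA.
  by rewrite mulVf // scale1r.
have e2 := mulmx1C e1; apply/GLinoP; split=> //; first by case: (mulmx1_unit e1).
rewrite (invmx_eq e2) => i j; rewrite mxE ivaloM //; first by rewrite vunit_ival ?vunitV.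
rewrite mxE ivalN; apply: mxivalMo => //; apply: mxivalMo => //.
by move=> i' j'; rewrite mxE.
Qed.

Lemma SL2_kill (x y : F) : exists a b c d,
  [/\ [/\ ival 0 a, ival 0 b, ival 0 c & ival 0 d], a * d - b * c = 1 & a * x + c * y = 0].
Proof.
have [->|x0] := eqVneq x 0.
  by exists 1, 0, 0, 1; rewrite !ival0 !ival1; split=> //; ring.
have [le|lt] := boolP (ival (val_lf v x) y).
  exists (- y / x), (-1), 1, 0; rewrite !ivalN !ival0 !ival1; split; [split=> //|ring|by field].
  by rewrite ivalVM // add0r ivalN.
have y0 : y != 0 by apply: contraNneq lt => ->; exact: ival0.
exists 1, 0, (- x / y), 1; rewrite !ival0 !ival1; split; [split=> //|ring|by field].
rewrite ivalVM // add0r ivalN ival_val //; move: lt; rewrite ival_val //; lia.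
Qed.

Definition k13 (a b c d : F) := mat4 [:: [:: a; 0; b; 0]; [:: 0; 1; 0; 0]; [:: c; 0; d; 0]; [:: 0; 0; 0; 1]].
Definition k24 (a b c d : F) := mat4 [:: [:: 1; 0; 0; 0]; [:: 0; a; 0; b]; [:: 0; 0; 1; 0]; [:: 0; c; 0; d]].
(** With e the inverse of the determinant, the upper block is the inverse transpose of the lower
    one: the Siegel Levi subgroup of Sp_4. *)
Definition klevi (a b c d e : F) :=
  mat4 [:: [:: d * e; - (c * e); 0; 0]; [:: - (b * e); a * e; 0; 0]; [:: 0; 0; a; b]; [:: 0; 0; c; d]].

Lemma trmx_J4E (h : 'M[F]_4) : (forall i j, h o0 i * h o2 j + h o1 i * h o3 j - h o2 i * h o0 j - h o3 i * h o1 j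
  = J4 F i j) -> h^T *m J4 F *m h = 1 *: J4 F.
Proof. by move=> e; apply/matrixP=> i j; rewrite scale1r J4_mulE -e !mxE. Qed.

Ltac symplectic e := apply: trmx_J4E; apply: ord4P; apply: ord4P; rewrite !mxE /=;
  first [ring | rewrite -e; ring].

Lemma KH_k13 a b c d : ival 0 a -> ival 0 b -> ival 0 c -> ival 0 d -> a * d - b * c = 1 ->
  KH v (embed L (k13 a b c d)).
Proof.
move=> ha hb hc hd e; apply: (KH_intro (vunit1 v)); last by apply: ord4P; apply: ord4P; rewrite !mxE /= ?ival0 ?ival1.
by symplectic e.
Qed.

Lemma KH_k24 a b c d : ival 0 a -> ival 0 b -> ival 0 c -> ival 0 d -> a * d - b * c = 1 ->
  KH v (embed L (k24 a b c d)).
Proof.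
move=> ha hb hc hd e; apply: (KH_intro (vunit1 v)); last by apply: ord4P; apply: ord4P; rewrite !mxE /= ?ival0 ?ival1.
by symplectic e.
Qed.

Lemma KH_klevi a b c d : GLin (ppow v 0) (mat2 a b c d) ->
  KH v (embed L (klevi a b c d (a * d - b * c)^-1)).
Proof.
move=> /GLin_mat2P[a' [b' [c' [d' [/mat2_inj[<- <- <- <-] [ha hb] [hc hd] hD]]]]].
have D0 := vunit_neq0 hD; set e := _^-1; have oe : ival 0 e by apply/vunit_ival/vunitV.
have De : (a * d - b * c) * e = 1 by rewrite mulfV.
apply: (KH_intro (vunit1 v)); last by apply: ord4P; apply: ord4P; rewrite !mxE /= ?ivalN ?ival0 // ivalMo.
by symplectic De.
Qed.

Lemma mul_embedE (g : 'M[L]_4) (h : 'M[F]_4) i j :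
  (g *m embed L h) i j = h o0 j *: g i o0 + h o1 j *: g i o1 + h o2 j *: g i o2 + h o3 j *: g i o3.
Proof. by rewrite mulmx4E !mxE /= !mulr_algr. Qed.

Section Kill.
Variable phi : L -> F.
Hypothesis phiD : forall x y, phi (x + y) = phi x + phi y.
Hypothesis phiZ : forall a x, phi (a *: x) = a * phi x.

(** phi will be [la] or [lb]. The two changed entries are recorded as F-combinations of the old
    ones, so that coordinates cleared earlier can be seen to stay zero. *)
Lemma kill (e : bool) (g : 'M[L]_4) (i := if e then o1 else o0) (j := if e then o3 else o2) :
  exists k a b c d, [/\ KH v k, phi ((g *m k) o2 i) = 0,
  (g *m k) o2 i = a *: g o2 i + c *: g o2 j /\ (g *m k) o2 j = b *: g o2 i + d *: g o2 j &
  forall i', i' != i -> i' != j -> (g *m k) o2 i' = g o2 i'].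
Proof.
have [a [b [c [d [[ha hb hc hd] e1 h]]]]] := SL2_kill (phi (g o2 i)) (phi (g o2 j)).
pose k := embed L ((if e then k24 else k13) a b c d); exists k, a, b, c, d.
have [Ei Ej] : (g *m k) o2 i = a *: g o2 i + c *: g o2 j /\ (g *m k) o2 j = b *: g o2 i + d *: g o2 j.
  by rewrite /k /i /j; case: (e); split; rewrite mul_embedE !mxE /= !scale0r ?(add0r, addr0).
split=> //; last 1 first.
- rewrite /k /i /j; apply: ord4P; case: (e) => // _ _;
    by rewrite mul_embedE !mxE /= ?(scale0r, add0r, addr0, scale1r).
- by rewrite /k; case: (e); [apply: KH_k24|apply: KH_k13].
- by rewrite Ei phiD !phiZ.
Qed.

Lemma kill_levi (g : 'M[L]_4) : exists k, [/\ KH v k, phi ((g *m k) o2 o3) = 0,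
  (exists x y, (g *m k) o2 o0 = x *: g o2 o0 + y *: g o2 o1) &
  exists x y, (g *m k) o2 o1 = x *: g o2 o0 + y *: g o2 o1].
Proof.
have [d [c [b [a [[hd hc hb ha] e h]]]]] := SL2_kill (phi (g o2 o3)) (phi (g o2 o2)).
have G : GLin (ppow v 0) (mat2 a b c d).
  have e' : a * d - b * c = 1 by rewrite -e; ring.
  by apply: GLin_mat2 => //; rewrite e' vunit1.
exists (embed L (klevi a b c d (a * d - b * c)^-1)); split; first exact: KH_klevi.
- by rewrite mul_embedE !mxE /= !scale0r !add0r phiD !phiZ addrC.
- by eexists; eexists; rewrite mul_embedE !mxE /= !scale0r !addr0.
- by eexists; eexists; rewrite mul_embedE !mxE /= !scale0r !addr0.
Qed.
End Kill.

(* The coordinates x, y of the third row x + y al are orthogonal for the symplectic form. *)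
Lemma row_isotropic g : inG2 g ->
  lb (g o2 o0) * la (g o2 o2) - la (g o2 o0) * lb (g o2 o2)
  + (lb (g o2 o1) * la (g o2 o3) - la (g o2 o1) * lb (g o2 o3)) = 0.
Proof.
move=> /inG2P[mu mu0 e]; have /matrixP/(_ o2 o2) := simil_rows mu0 e.
rewrite J4_mulE !conjTE [RHS]mxE [J4 L _ _]mxE /= mulr0.
set x0 := g o2 o0; set x1 := g o2 o1; set x2 := g o2 o2; set x3 := g o2 o3 => E.
set S := (X in X = 0); have h1 : la 0 = t * - S.
  rewrite -E !(laD, laN) !laM !la_conj !lb_conj /S; ring.
have h2 : lb 0 = 2%:R * S.
  rewrite -E !(lbD, lbN) !lbM !la_conj !lb_conj /S; ring.
have z1 : la 0 = 0 by rewrite -(alg0 L) la_alg.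
have z2 : lb 0 = 0 by rewrite -(alg0 L) lb_alg.
rewrite z1 in h1; rewrite z2 in h2.
have [n0|n0] := two_ib ib; first by apply: (mulfI n0); rewrite mulr0 -h2.
by apply: oppr_inj; apply: (mulfI n0); rewrite oppr0 mulr0 -h1.
Qed.

Lemma inG2_KH g k : inG2 g -> KH v k -> inG2 (g *m k).
Proof. by move=> hg hk; apply: inG2M => //; case: (KHP hk). Qed.

Lemma row_reduce g : inG2 g -> exists k, [/\ KH v k, (g *m k) o2 o0 = 0 & (g *m k) o2 o1 = 0].
Proof.
move=> hg; have laZ' := laZ ib; have lbZ' := lbZ ib; have laD' := laD ib; have lbD' := lbD ib.
have [k1 [_ [_ [_ [_ [K1 e1 _ _]]]]]] := kill laD' laZ' false g.
have [k2 [_ [_ [_ [_ [K2 e2 _ /(_ o0 isT isT) e2']]]]]] := kill laD' laZ' true (g *m k1).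
have [k3 [K3 e3 [x0 [y0 f0]] [x1 [y1 f1]]]] := kill_levi laD' laZ' (g *m k1 *m k2).
set g3 := g *m k1 *m k2 *m k3 in e3 f0 f1.
have K123 : KH v (k1 *m (k2 *m k3)) by apply: (KHM) => //; apply: KHM.
have a0 : la (g3 o2 o0) = 0 by rewrite f0 laD' !laZ' e2' e1 e2 !mulr0 addr0.
have a1 : la (g3 o2 o1) = 0 by rewrite f1 laD' !laZ' e2' e1 e2 !mulr0 addr0.
have hg3 : inG2 g3 by do 3 apply: inG2_KH => //.
suff [k [hk h0 h1]] : exists k, [/\ KH v k, (g3 *m k) o2 o0 = 0 & (g3 *m k) o2 o1 = 0].
  exists (k1 *m (k2 *m k3) *m k); split; first exact: KHM.
    by rewrite !mulmxA in h0 *.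
  by rewrite !mulmxA in h1 *.
have z (x : L) : la x = 0 -> lb x = 0 -> x = 0.
  by move=> h0 h1; rewrite (lab ib x) h0 h1 alg0 scale0r addr0.
(* Among the [la] coordinates only the third may survive. If it is zero, the [lb] coordinates are
   cleared in the same way. If not, isotropy kills [lb] of the first entry, and SL_2 on the second
   and fourth columns, where [la] vanishes, clears the second. *)
have [a2|a2] := eqVneq (la (g3 o2 o2)) 0.
  have [k4 [a [b [c [d [K4 e4 [e40 _] e4']]]]]] := kill lbD' lbZ' false g3.
  have [k5 [a' [b' [c' [d' [K5 e5 [e51 _] /(_ o0 isT isT) e50]]]]]] := kill lbD' lbZ' true (g3 *m k4).
  exists (k4 *m k5); split; first exact: KHM.
    by rewrite mulmxA; apply: z; rewrite e50 // e40 laD' !laZ' a0 a2 !mulr0 addr0.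
  rewrite mulmxA; apply: z; last exact: e5.
  by rewrite e51 !e4' // laD' !laZ' a1 e3 !mulr0 addr0.
have b0 : lb (g3 o2 o0) = 0.
  have := row_isotropic hg3; rewrite a0 a1 e3 !mul0r mulr0 !subr0 addr0 => /eqP.
  by rewrite mulf_eq0 (negbTE a2) orbF => /eqP.
have [k5 [a' [b' [c' [d' [K5 e5 [e51 _] /(_ o0 isT isT) e50]]]]]] := kill lbD' lbZ' true g3.
exists k5; split=> //; first by apply: z; rewrite e50.
by apply: z => //; rewrite e51 laD' !laZ' a1 e3 !mulr0 addr0.
Qed.

Lemma row_normal_form g : inG2 g -> exists k x u, [/\ KH v k,
  [/\ (g *m k) o2 o0 = 0, (g *m k) o2 o1 = 0, (g *m k) o2 o2 = u & (g *m k) o2 o3 = u * x] &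
  x = 0 \/ exists m : nat, x = upi m *: al].
Proof.
move=> hg; have [k [hk h0 h1]] := row_reduce hg; have hgk := inG2_KH hg hk.
have [g1 eg1] : exists g1, g1 = g *m k by eexists.
rewrite -eg1 in h0 h1 hgk.
(* The diagonal entry of g1 times its inverse: the relation required by [lattice_reduce]. *)
have e : invmx g1 o2 o2 * g1 o2 o2 + invmx g1 o3 o2 * g1 o2 o3 = 1.
  have := mulmxV (inG2_unit hgk); move/matrixP/(_ o2 o2); rewrite mulmx4E h0 h1 !mul0r !add0r [RHS]mxE eqxx => E.
  by rewrite -[RHS]E; ring.
have [u [a [b [c [d [uu G e1 e2]]]]]] := lattice_reduce ib e.
pose k' := embed L (klevi a b c d (a * d - b * c)^-1).
have E0 : (g1 *m k') o2 o0 = 0 by rewrite mul_embedE !mxE /= h0 h1 !scaler0 !scale0r !addr0.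
have E1 : (g1 *m k') o2 o1 = 0 by rewrite mul_embedE !mxE /= h0 h1 !scaler0 !scale0r !addr0.
have E2 : (g1 *m k') o2 o2 = u by rewrite mul_embedE !mxE /= !scale0r !add0r e1.
have E3 : (g1 *m k') o2 o3 = b *: g1 o2 o2 + d *: g1 o2 o3 by rewrite mul_embedE !mxE /= !scale0r !add0r.
have [x [hx ex]] : exists x, (x = 0 \/ exists m : nat, x = upi m *: al) /\ b *: g1 o2 o2 + d *: g1 o2 o3 = u * x.
  case: e2 => [e2|[m e2]]; first by exists 0; rewrite mulr0; split=> //; left.
  by exists (upi m *: al); split=> //; right; exists m.
exists (k *m k'), x, u; rewrite !mulmxA -eg1; split=> //; last by split=> //; rewrite E3.
by apply: KHM => //; exact: KH_klevi.
Qed.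

Definition xm (m : nat) : L := upi m *: al.

Lemma lval_xm (m : nat) : lval m (xm m).
Proof. by rewrite -[m%:Z]addr0; apply: lvalZ; [exact: ival_upi|exact: lval_al]. Qed.

(** The parameters 0 and pi^m al with m > r are congruent modulo P^r to pi^r al, and changing the
    parameter by an element of P^r multiplies eta on the right by an element of K^H Gamma(P^r). *)
Lemma double_coset_decomposition g : inG2 g -> exists m p c,
  [/\ (m <= r)%N, Q p, CC c & g = p *m eta_mx conj (xm m) *m c].
Proof.
move=> hg; have [k [x [u [hk [e0 e1 e2 e3] hx]]]] := row_normal_form hg.
have [m [lemr hm]] : exists m, (m <= r)%N /\ lval r (x - xm m).
  case: hx => [->|[m ->]].
    by exists r; split=> //; rewrite sub0r lvalN lval_xm.
  have [le|lt] := leqP m r; first by exists m; split=> //; rewrite subrr lval0.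
  exists r; split=> //; apply: lvalB; last exact: lval_xm.
  by apply: lvalW (lval_xm m); rewrite lez_nat ltnW.
have hgk := inG2_KH hg hk.
exists m, (g *m k *m eta_mx conj (- x)), (eta_mx conj (x - xm m) *m invmx k); split=> //.
- split; first by apply: inG2M => //; exact: inG2_eta.
  by split; rewrite mulmx4E e0 e1 e2 e3 !mxE /= ?(mul0r, mulr0, add0r, addr0, mulr1) // mulrN addNr.
- by apply: CCM; [exact: CC_eta|apply: CC_KH; exact: KHV].
transitivity (g *m k *m (eta_mx conj (- x) *m (eta_mx conj (xm m) *m eta_mx conj (x - xm m))) *m invmx k).
  rewrite -!etaD (_ : - x + (xm m + (x - xm m)) = 0); last by ring.
  by rewrite eta0 mulmx1 mulmxK //; case: (KHP hk) => -[].
by rewrite !mulmxA.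
Qed.

Local Notation eta m := (eta_mx conj (xm m)).

Lemma GLoL_etam m : GLin (@oL F v L) (eta m).
Proof. by apply: GLoL_eta; apply: lvalW (lval_xm m). Qed.

Lemma lb_xm m : lb (xm m) = upi m.
Proof. by rewrite lbZ (lab_al ib).2 mulr1. Qed.

Lemma la_xm m : la (xm m) = 0.
Proof. by rewrite laZ (lab_al ib).1 mulr0. Qed.

Section Relation.
Variables (p c : 'M[L]_4) (m m' : nat).
Hypotheses (hQ : Q p) (hC : CC c) (e : p *m eta m = eta m' *m c).
Local Notation kap := (p o2 o2).

Lemma rel_GLoL : GLin (@oL F v L) p.
Proof.
have -> : p = eta m' *m c *m eta_mx conj (- xm m) by rewrite -e -mulmxA etaVK mulmx1.
have h : GLin (@oL F v L) (eta_mx conj (- xm m)) by apply: GLoL_eta; rewrite lvalN; apply: lvalW (lval_xm m).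
by apply: GLoLM => //; apply: GLoLM; [exact: GLoL_etam|case: hC].
Qed.

Lemma rel_lunit : lunit (p o0 o0) /\ lunit kap.
Proof.
have [mu [_ _ _ [p10 p20 p30] [u0 u2]]] := Q_rel cK hQ; have [_ [_ p21 p23]] := hQ.
have [up hp ip] := (GLoLP p).1 rel_GLoL.
split.
  apply: (lunitP (hp _ _) (ip o0 o0)); have /matrixP/(_ o0 o0) := mulVmx up.
  by rewrite mulmx4E p10 p20 p30 !mulr0 !addr0 [X in _ = X -> _]mxE eqxx mulrC => ->.
apply: (lunitP (hp _ _) (ip o2 o2)); have /matrixP/(_ o2 o2) := mulmxV up.
by rewrite mulmx4E p20 p21 p23 !mul0r !add0r addr0 [X in _ = X -> _]mxE eqxx => ->.
Qed.

(** Compare the third rows. On the right c is congruent to a matrix h over F, so [lb] sees only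
    pi^m' times the fourth row of h; on the left the row is (0, 0, kap, kap pi^m al). *)
Lemma rel_row : exists h : 'M[F]_4, mxival v 0 h /\
  [/\ mxlval r (c - embed L h), ival r (upi m' * h o3 o1),
      ival r (upi m' * h o3 o2 - lb kap) & ival r (upi m' * h o3 o3 - upi m * (la kap + t * lb kap))].
Proof.
have [_ _ [_ [h [-> /GLinoP[_ hh _] _]] hck]] := hC; exists h; split=> //.
have [_ [p20 p21 p23]] := hQ.
have key j : ival r (upi m' * h o3 j - lb ((p *m eta m) o2 j)).
  have h1 : lval r ((eta m' *m (c - embed L h)) o2 j).
    by apply: mxlvaloM => //; case/(GLoLP): (GLoL_etam m').
  have e1 : (eta m' *m (c - embed L h)) o2 j = (p *m eta m) o2 j - (eta m' *m embed L h) o2 j.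
    by rewrite mulmxBr -e !mxE.
  have e2 : (eta m' *m embed L h) o2 j = (h o2 j)%:A + h o3 j *: xm m'.
    by rewrite mulmx4E !mxE /= !mul0r !add0r mul1r mulr_algr.
  move: h1; rewrite e1 e2 lvalBC => /andP[_].
  by rewrite lbD lbN lbD lb_alg add0r lbZ lb_xm mulrC.
split=> //.
- by have := key o1; rewrite mulmx4E !mxE /= p20 p21 p23 !(mul0r, mulr0, addr0) -(alg0 L) lb_alg subr0.
- by have := key o2; rewrite mulmx4E !mxE /= p20 p21 p23 !(mul0r, mulr0, add0r, addr0) mulr1.
- have := key o3; rewrite mulmx4E !mxE /= p20 p21 p23 !(mul0r, mulr0, add0r, addr0) lbM la_xm lb_xm.
  by congr (ival _ _); ring.
Qed.

(** If m < m', the congruences of [rel_row] put both coordinates of kap in p, but kap is a unit of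
    o_L. *)
Lemma rel_le : (m <= r)%N -> (m' <= r)%N -> (m' <= m)%N.
Proof.
move=> hm hm'; rewrite leqNgt; apply/negP => lt.
have [h [hh [_ _ h2 h3]]] := rel_row; have [_ hk] := rel_lunit.
have aux (a b : F) : ival 0 a -> ival r (upi m' * a - b) -> ival m' b.
  move=> ha hb; have h4 : ival m' (upi m' * a) by rewrite ival_upiM subrr.
  have h5 : ival m' (upi m' * a - b) by apply: ivalW hb; rewrite lez_nat.
  by rewrite -[b](subKr (upi m' * a)); apply: ivalB.
have hb := aux _ _ (hh o3 o2) h2; have := aux _ _ (hh o3 o3) h3; rewrite ival_upiM => ha.
have hb1 : ival 1 (lb kap) by apply: ivalW hb; lia.
have ha1 : ival 1 (la kap).
  have -> : la kap = (la kap + t * lb kap) - t * lb kap by ring.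
  by apply: ivalB; [apply: ivalW ha; lia|apply: ivaloM (ib_t ib) hb1].
have /lval_nrm h4 : lval 1 kap by apply/andP.
have h5 : ival 1 (nrm ib kap) by apply: ivalW h4.
by case/andP: hk => _; rewrite (negbTE (ival1N h5)).
Qed.

End Relation.

Lemma rel_eq p c m m' : (m <= r)%N -> (m' <= r)%N -> Q p -> CC c ->
  p *m eta m = eta m' *m c -> m = m'.
Proof.
move=> hm hm' hQ hC e; apply/eqP; rewrite eqn_leq (rel_le hQ hC e hm hm') andbT.
apply: (rel_le (QV cK hQ) (CCV hC) _ hm' hm).
have up := inG2_unit hQ.1; have [/inG2_unit uc _ _] := hC.
by apply: (can_inj (mulKmx up)); rewrite !mulmxA mulmxV // mul1mx e mulmxK.
Qed.

(* With j = r - m, comparing third and fourth rows gives p_42 = 0 and p_44 = conj p_33 mod P ^ j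
   (1-based indices); the similitude relations then give p_22 = conj zeta mod P ^ j. *)
Lemma stabilizer p c m : (m <= r)%N -> Q p -> CC c -> p *m eta m = eta m *m c ->
  exists l g, [/\ bof p = l *: embed L g, lunit l, K1 v (r - m) g & lval (r - m)%N (l / conj (zof p) - 1)].
Proof.
move=> hm hQ hC e; set j := (r - m)%N; have hj : j%:Z = r%:Z - m%:Z by rewrite /j; lia.
have [mu [mu0 es r02 [p10 p20 p30] [u0 u2]]] := Q_rel cK hQ; have [G [_ p21 p23]] := hQ.
have Gp := rel_GLoL hC e; have [hz hk] := rel_lunit hQ hC e.
have [up hp ip] := (GLoLP p).1 Gp.
have [h [hh [hc h1 h2 h3]]] := rel_row hQ hC e.
have jr : j%:Z <= r%:Z by rewrite hj; lia.
have cE i k : lval r (c i k - (h i k)%:A) by have := hc i k; rewrite !mxE.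
have oh i k : ival 0 (h i k) by exact: hh.
have eE k : (p *m eta m) o3 k = c o3 k by rewrite e mulmx4E !mxE /= !mul0r !add0r mul1r.
have p31 : p o3 o1 = c o3 o1.
  by rewrite -eE mulmx4E !mxE /= !(mulr0, addr0, add0r) mulr1.
have p32 : p o3 o2 = c o3 o2.
  by rewrite -eE mulmx4E !mxE /= !(mulr0, addr0, add0r) mulr1.
have p33 : p o3 o3 = c o3 o3 - c o3 o2 * xm m.
  by rewrite -[c o3 o3]eE mulmx4E !mxE /= p32 !(mulr0, addr0, add0r) mulr1 addrC addKr.
have hp31 : lval j (p o3 o1).
  rewrite p31 -[c o3 o1](subrK (h o3 o1)%:A); apply: lvalD; first exact: lvalW (cE _ _).
  by rewrite lval_alg hj; move: h1; rewrite ival_upiM.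
set kp := p o2 o2 in hk h2 h3.
have hp33 : lval j (p o3 o3 - conj kp).
  have ck : conj kp = (la kp + t * lb kp)%:A - lb kp *: al.
    by apply: (lab_inj (ib := ib)); rewrite !(laD, lbD, laN, lbN, la_alg, lb_alg, laZ, lbZ, la_conj, lb_conj)
      ?(lab_al ib).1 ?(lab_al ib).2; ring.
  have -> : p o3 o3 - conj kp = (c o3 o3 - (h o3 o3)%:A) - (c o3 o2 - (h o3 o2)%:A) * xm m
     + (h o3 o3 - (la kp + t * lb kp))%:A - (upi m * h o3 o2 - lb kp) *: al.
    have -> : (upi m * h o3 o2 - lb kp) *: al = (h o3 o2)%:A * xm m - lb kp *: al.
      by rewrite scalerBl mulr_algl /xm scalerA [_ * h _ _]mulrC.
    by rewrite p33 ck !algE; ring.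
  apply: lvalB; last by rewrite -[j%:Z]addr0; apply: lvalZ (lval_al ib); exact: ivalW h2.
  apply: lvalD.
    apply: lvalB; first exact: lvalW (cE _ _).
    by apply: lvalMo; [exact: lvalW (cE _ _)|apply: lvalW (lval_xm m)].
  by rewrite lval_alg hj; move: h3; rewrite -mulrBr ival_upiM.
have hp11 : lval j (p o1 o1 - conj (p o0 o0)).
  have /G1_mat2 := bof_rel hQ es; rewrite !mxE /= => -[_ _ eb _].
  have lck : lunit (conj kp) by rewrite lunit_conj.
  rewrite -(lval_conj ib) rmorphB /= cK -(lunitMr _ _ lck).
  have -> : (conj (p o1 o1) - p o0 o0) * conj kp = conj (p o3 o1) * p o1 o3 - conj (p o1 o1) * (p o3 o3 - conj kp).
    have -> : conj (p o3 o1) * p o1 o3 = conj (p o1 o1) * p o3 o3 - mu%:A by rewrite -eb; ring.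
    by rewrite -r02; ring.
  apply: lvalB; first by apply: lvalMo => //; rewrite lval_conj.
  by apply: lvaloM => //; rewrite lval_conj.
have ucz : lunit (conj (p o0 o0)) by rewrite lunit_conj.
set z := p o0 o0 in hp11 ucz *; have uz := lunit_unit ucz.
have [l [g [ul ug eb]]] := G1_decomposition ib (bof_G1 cK hQ).
have hb i k : lval 0 (bof p i k).
  by rewrite mxE; ord2 i k; rewrite /=; exact: hp.
have bE i k : bof p i k = l * (g i k)%:A by rewrite eb !mxE.
have lunit_det : lunit (\det (bof p)).
  have hQV := QV cK hQ; have [_ _ ebb] := QM cK hQ hQV; rewrite mulmxV // in ebb.
  have [_ _ eb1] := Q1 conj; rewrite eb1 in ebb.
  have hbV i k : lval 0 (bof (invmx p) i k).
    by rewrite mxE; ord2 i k; rewrite /=; exact: ip.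
  have hdet (B : 'M[L]_2) : (forall i k, lval 0 (B i k)) -> lval 0 (\det B).
    by move=> hB; rewrite (mat2_eta B) det_mat2; apply: lvalB; apply: lvalMo.
  by apply: (lunitP (hdet _ hb) (hdet _ hbV)); rewrite -det_mulmx -ebb det1.
(* The factorization of [bof p] is rescaled by a pivot entry of g that divides the others: the upper
   left one if j > 0, a unit multiple of conj zeta up to l, and otherwise one of minimal valuation.
   Then l' is an entry of [bof p], and l' and det g' are integral with l'^2 det g' a unit, so both
   are units. *)
have [i0 [k0 [gn gint gj]]] : exists i0 k0, [/\ g i0 k0 != 0, forall i k, ival 0 (g i k / g i0 k0)
    & (0 < j)%N -> i0 = 0 /\ k0 = 0].
  have [j0|j0] := posnP j.
    pose P (q : 'I_2 * 'I_2) := g q.1 q.2 != 0.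
    have [[i1 k1] hq] : exists q, P q.
      have /matrix0Pn[i1 [k1 h1']] : g != 0 by apply: contraTneq ug => ->; rewrite unitmxE det0 unitr0.
      by exists (i1, k1).
    case: (@Order.TotalTheory.arg_minP _ _ _ (i1, k1) P (fun q => val_lf v (g q.1 q.2)) hq) => -[i0 k0] hP mini.
    exists i0, k0; split=> // i k; rewrite ivalVM // add0r.
    have [->|gn] := eqVneq (g i k) 0; first exact: ival0.
    by rewrite ival_val //; apply: (mini (i, k)).
  have ub : lunit (p o1 o1).
    rewrite -[p o1 o1](mulrK uz) (_ : p o1 o1 * conj z / conj z = (p o1 o1 / conj z) * conj z); last by rewrite mulrAC.
    apply: lunitM => //; apply: (@lunit_cong1 _ _ _ _ _ _ _ ib j); first by rewrite ltz_nat.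
    by rewrite -(mulrV uz) -mulrBl lunitMr // lunitV.
  have e00 : l * (g 0 0)%:A = p o1 o1 by rewrite -bE mxE.
  have g00 : g 0 0 != 0.
    by apply: contraTneq (lunit_unit ub) => h0; rewrite -e00 h0 alg0 mulr0 unitr0.
  exists 0, 0; split=> // i k; rewrite -(lval_alg ib) -(lunitMr 0 _ ub) -e00 mulrCA -algM divfK //.
  by rewrite -bE.
pose g' := (g i0 k0)^-1 *: g; pose l' := l * (g i0 k0)%:A.
have g'E i k : g' i k = g i k / g i0 k0 by rewrite mxE mulrC.
have eb' : bof p = l' *: embed L g'.
  by apply/matrixP=> i k; rewrite bE !mxE /l' -mulrA -algM mulVKf.
have og' i k : ival 0 (g' i k) by rewrite g'E.
have od : ival 0 (\det g').
  by rewrite (mat2_eta g') det_mat2; apply: ivalB; apply: ivalMo.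
have ol' : lval 0 l' by rewrite /l' -bE.
have ed : \det (bof p) = l' * (l' * (\det g')%:A).
  by rewrite eb' detZ det_map_mx expr2 mulrA.
have hl' : lunit l'.
  have ud := lunit_unit lunit_det; apply: (@lunitP _ _ _ _ _ _ _ ib _ (l' * (\det g')%:A / \det (bof p)) ol').
    by apply: lvalMo; [apply: lvalMo; rewrite ?lval_alg|exact: lunit_lval (lunitV _)].
  by rewrite mulrA -ed mulrV.
have hd' : vunit v (\det g').
  rewrite -(lunit_alg ib); have u2l : lunit (l' * l') by exact: lunitM.
  have -> : (\det g')%:A = (l' * l')^-1 * \det (bof p).
    by rewrite ed (mulrA l' l') mulKr // (lunit_unit u2l).
  by apply: lunitM => //; exact: lunitV.
exists l', g'; split=> //.
- rewrite (mat2_eta g'); move: hd'; rewrite {1}(mat2_eta g') det_mat2 => hd'.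
  have [j0|j0] := posnP j.
    by apply: K1_mat2 => //; rewrite ?j0 ?ivalB ?ival1.
  have [ei ek] := gj j0; apply: K1_mat2 => //.
    by have := gn; rewrite g'E ei ek => gn'; rewrite divff // subrr ival0.
  rewrite -(lval_alg ib) -(lunitMr _ _ hl').
  rewrite mulrC; have /matrixP/(_ 1 0) := eb'; rewrite [in RHS]mxE [embed _ _ _ _]mxE [bof p _ _]mxE /= => <-.
  exact: hp31.
- have [j0|j0] := posnP j.
    by rewrite j0; apply: lvalB; [rewrite lunitMr ?lunitV|exact: lval1].
  have [ei ek] := gj j0; have -> : l' = p o1 o1 by rewrite /l' ei ek -bE mxE.
  by rewrite -(mulrV uz) -mulrBl lunitMr // lunitV.
Qed.

Lemma lvalM_sub m x z : (m <= r)%N -> lval m x -> lval (r - m)%N z -> lval r (x * z).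
Proof. by move=> hm hx hz; apply: lvalW (lvalM hx hz); lia. Qed.

(** Take p = m_2(g), which already lies in K^H, and c its conjugate by eta_m; [eta_conj_levi] shows
    that c - p is divisible by P^r. *)
Lemma stabilizer_converse m (g : 'M[F]_2) : (m <= r)%N -> K1 v (r - m) g ->
  exists p c, [/\ Q p, CC c, p *m eta m = eta m *m c,
    zof p = 1 /\ bof p = embed L g & simil p (\det g) /\ vunit v (\det g)].
Proof.
move=> hm /K1P[a [b [y [d [-> [ha hb hy hd] ha1 hy1 hD]]]]]; rewrite det_mat2 embed_mat2.
set D := a * d - b * y in hD *; have D0 := vunit_neq0 hD.
pose h := mat4 [:: [:: 1; 0; 0; 0]; [:: 0; a; 0; b]; [:: 0; 0; D; 0]; [:: 0; y; 0; d]].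
pose p := mat4 [:: [:: 1; 0; 0; 0]; [:: 0; a%:A; 0; b%:A]; [:: 0; 0; D%:A; 0]; [:: 0; y%:A; 0; d%:A]] : 'M[L]_4.
have hp : embed L h = p by apply: matrix4P; rewrite !mxE /= ?alg0 ?alg1.
have hJ : h^T *m J4 F *m h = D *: J4 F.
  apply/matrixP=> i j; rewrite J4_mulE [RHS]mxE; move: i j; apply: ord4P; apply: ord4P; rewrite !mxE /= /D; ring.
have Kp : KH v p.
  rewrite -hp; apply: (KH_intro hD hJ); apply: ord4P; apply: ord4P; rewrite !mxE /= ?ival0 ?ival1 //.
  exact: vunit_ival.
have sp : simil p D by rewrite -hp; apply: simil_embed.
have [Gp GLp] := KHP Kp; set x := xm m.
have hx : lval m x := lval_xm m.
have ox : lval 0 x by apply: lvalW hx.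
have hxx (z : L) : lval (r - m)%N z -> lval r (x * z) by exact: lvalM_sub.
pose c := eta_mx conj (- x) *m p *m eta_mx conj x.
have ec : c - p = mat4 [:: [:: 0; 0; 0; 0]; [:: conj x * (1 - a%:A); 0; 0; 0];
    [:: x * (conj x * y%:A); - (x * y%:A); 0; x * (D%:A - d%:A)]; [:: - (conj x * y%:A); 0; 0; 0]].
  have -> : c = mat4 [:: [:: 1; 0; 0; 0]; [:: conj x * (1 - a%:A); a%:A; 0; b%:A];
      [:: x * (conj x * y%:A); - (x * y%:A); D%:A; x * (D%:A - d%:A)]; [:: - (conj x * y%:A); y%:A; 0; d%:A]].
    by rewrite -eta_conj_levi /c /eta_mx rmorphN opprK.
  by apply: matrix4P; rewrite !mxE /= ?subrr ?subr0.
have hy' : lval r (x * y%:A) by apply: hxx; rewrite lval_alg.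
have ha' : lval r (x * (1 - a%:A)).
  by apply: hxx; rewrite (_ : 1 - a%:A = (1 - a)%:A) ?lval_alg 1?ivalBC // algB alg1.
have hd' : lval r (x * (D%:A - d%:A)).
  apply: hxx; rewrite -algB lval_alg /D.
  have -> : a * d - b * y - d = (a - 1) * d - b * y by ring.
  by apply: ivalB; [exact: ivalMo|exact: ivaloM].
have cj z : lval r (x * z) -> conj z = z -> lval r (conj x * z).
  by move=> h1 h2; rewrite -h2 -rmorphM lval_conj.
have hya : lval r (conj x * y%:A) by apply: cj => //; exact: conj_alg.
exists p, c; split.
- by split=> //; split; rewrite mxE.
- split.
  + by apply: inG2M; [apply: inG2M => //|]; apply: inG2_eta.
  + by apply: GLoLM; [apply: GLoLM => //; apply: GLoL_eta; rewrite lvalN|exact: GLoL_eta].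
  + exists p => //; rewrite ec; apply: ord4P; apply: ord4P; rewrite mxE /= ?lvalN ?lval0 //.
    * by apply: cj => //; rewrite rmorphB rmorph1 /= conj_alg.
    * exact: lvaloM.
- by rewrite /c -!mulmxA mulmxA etaVK mul1mx.
- by split; [rewrite /zof mxE|rewrite /bof !mxE].
- by [].
Qed.

End CompactGroup.

(** * Induced representations *)

Section AbsoluteValue.
Variables (R : realType) (F : fieldType) (v : local_field F).

Lemma residues_gt0 : 0 < (size (residues_lf v))%:R :> R.
Proof.
rewrite ltr0n; have [//|y] := @residues_lf_complete F v 0; first by left.
by case: (residues_lf v).
Qed.

Lemma abs_lf_gt0 x : x != 0 -> 0 < abs_lf v R x.
Proof. by move=> x0; rewrite /abs_lf (negbTE x0) exprz_gt0 // residues_gt0. Qed.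

Lemma abs_lfM x y : x != 0 -> y != 0 -> abs_lf v R (x * y) = abs_lf v R x * abs_lf v R y.
Proof.
move=> x0 y0; rewrite /abs_lf mulf_eq0 (negbTE x0) (negbTE y0) /= val_lfM // opprD expfzDr //.
by rewrite gt_eqF // residues_gt0.
Qed.

Lemma abs_lf_unit x : vunit v x -> abs_lf v R x = 1.
Proof. by case/andP=> x0 /eqP h; rewrite /abs_lf (negbTE x0) h oppr0 expr0z. Qed.

Lemma cpowM (a b : R) z : 0 < a -> 0 < b -> cpow (a * b) z = cpow a z * cpow b z.
Proof.
move=> a0 b0; rewrite /cpow lnM ?posrE // !mulrDr expRD cosD sinD.
by apply/eqP; rewrite eq_complex /=; apply/andP; split; apply/eqP; ring.
Qed.

Lemma cpow1 z : cpow (1 : R) z = 1.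
Proof.
rewrite /cpow ln1 !mulr0 expR0 cos0 sin0 mulr1 mulr0.
by apply/eqP; rewrite eq_complex /= !eqxx.
Qed.

End AbsoluteValue.

Section FiniteDimension.
Variables (K : fieldType) (W : lmodType K).

Lemma has_dim_fin (T : finType) (e : T -> W) (S : set W) :
  (forall c : T -> K, \sum_i c i *: e i = 0 -> forall i, c i = 0) ->
  (forall w, S w <-> exists c : T -> K, w = \sum_i c i *: e i) -> has_dim S #|T|.
Proof.
move=> free span; exists (fun i => e (enum_val i)).
have reidx (c : T -> K) : \sum_i c i *: e i = \sum_(i < #|T|) c (enum_val i) *: e (enum_val i).
  by rewrite (reindex (@enum_val T T)) //; exact/onW_bij/enum_val_bij.
split=> [c hc j|w].
  have := free (fun x => c (enum_rank x)); rewrite reidx => h.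
  rewrite -[j]enum_valK; apply: h; rewrite -[RHS]hc; apply: eq_bigr => x _.
  by rewrite enum_valK.
rewrite span; split=> -[c ->]; first by exists (c \o enum_val); rewrite reidx.
exists (c \o enum_rank); rewrite reidx; apply: eq_bigr => x _ /=; by rewrite enum_valK.
Qed.

End FiniteDimension.

(** Reversing the order of summation gives the sum of the truncated differences m + 1 - n for m <=
    r, which is the binomial coefficient of r + 2 - n over 2. *)
Lemma card_triangle n r : (\sum_(m < r.+1) ((r - m).+1 - n) =
  if (n <= r)%N then ((r - n + 1) * (r - n + 2)) %/ 2 else 0)%N.
Proof.
rewrite (reindex_inj rev_ord_inj) /=.
under eq_bigr => m _ do rewrite subSS subKn ?(leq_trans (leq_ord m)) //.
have -> : (\sum_(m < r.+1) (m.+1 - n) = 'C(r.+2 - n, 2))%N.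
  elim: r => [|r IH].
    by rewrite big_ord1; case: n => [|[|n]].
  rewrite big_ord_recr /= IH; have [le|lt] := leqP n r.+2.
    by rewrite [in RHS]subSn // binS bin1.
  have -> : (r.+3 - n = 0)%N by lia.
  have -> : (r.+2 - n = 0)%N by lia.
  by [].
case: leqP => h; last by rewrite bin_small //; lia.
rewrite bin2; have -> : (r.+2 - n = r - n + 2)%N by lia.
by rewrite mulnC -divn2 addn2 /= addn1.
Qed.

(** * Invariant functions in the induced representation *)

Section InducedRep.
Variables (R : realType) (F : fieldType) (v : local_field F).
Variables (L : comUnitAlgType F) (conj : {lrmorphism L -> L}).
Variables (al : L) (t nu : F).
Hypothesis ib : integral_basis v conj al t nu.
Variables (V : lmodType R[i]) (tau : 'M[F]_2 -> {linear V -> V}).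
Hypothesis tau_rep : is_rep tau.
Variable omega : F -> R[i].
Hypothesis tau_omega : central_character tau omega.
Variable chi0 : L -> R[i].
Hypothesis chi0_char : is_character v chi0.
Hypothesis chi0_omega : forall a : F, a != 0 -> chi0 a%:A = omega a.
Variable Lambda : L -> R[i].
Hypothesis Lambda_unr : unramified_character v Lambda.
Variable chi : L -> R[i].
Hypothesis chiE : forall z, z \is a GRing.unit -> chi z = (Lambda (conj z))^-1 * (chi0 (conj z))^-1.
Variables (s : R[i]) (r : nat).
Local Notation inG2 := (similitude_group conj (J4 L)).
Local Notation Q := (Q conj).
Local Notation CC := (CC ib r).
Local Notation chi0tau := (chi0tau chi0 tau).
Let cK := conjK ib.

Lemma conj_fixed (x : L) : conj x = x -> exists a, x = a%:A.
Proof. by move=> /(conj_fix ib) ->; eexists. Qed.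

Lemma chi0_mul x y : x \is a GRing.unit -> y \is a GRing.unit -> chi0 (x * y) = chi0 x * chi0 y.
Proof. by case: chi0_char => _ h _; exact: h. Qed.

Lemma chi0_neq0 x : x \is a GRing.unit -> chi0 x != 0.
Proof. by case: chi0_char => h _ _; exact: h. Qed.

Lemma chi0_1 : chi0 1 = 1.
Proof.
have := chi0_mul (unitr1 L) (unitr1 L); rewrite mulr1 -{1}[chi0 1]mulr1 => /mulfI -> //.
exact/chi0_neq0/unitr1.
Qed.

(** The pair (l, g) is determined up to a scalar of F, on which chi_0 agrees with the central
    character. *)
Lemma chi0tauE l g w : l \is a GRing.unit -> g \in unitmx ->
  chi0tau (l *: embed L g) w = chi0 l *: tau g w.
Proof.
move=> ul ug; rewrite /Defs.chi0tau; case: xgetP => [w' _ [l' [g' [ul' ug' e ->]]]|h]; last first.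
  by case: (h (chi0 l *: tau g w)); exists l, g.
have [a [a0 -> ->]] := embedZ_inj ul ul' ug e.
rewrite chi0_mul ?alg_unit // chi0_omega // -mul_scalar_mx (tauM tau_rep) //; last first.
  by rewrite unitmxE det_scalar unitfE expf_neq0.
by rewrite tau_omega // scalerA.
Qed.

Lemma chi0tau_linear b a w w' : G1 conj b ->
  chi0tau b (a *: w + w') = a *: chi0tau b w + chi0tau b w'.
Proof.
move=> /(G1_decomposition ib)[l [g [ul ug ->]]]; rewrite !chi0tauE // linearP scalerDr !scalerA.
by rewrite mulrC.
Qed.

Lemma chi0tauM b b' w : G1 conj b -> G1 conj b' ->
  chi0tau (b *m b') w = chi0tau b (chi0tau b' w).
Proof.
move=> /(G1_decomposition ib)[l [g [ul ug ->]]] /(G1_decomposition ib)[l' [g' [ul' ug' ->]]].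
rewrite -scalemxAl -scalemxAr scalerA -embedM !chi0tauE ?unitrM ?ul ?unitmx_mul ?ug //.
by rewrite chi0_mul // (tauM tau_rep) // (tauZ tau) scalerA.
Qed.

Lemma chiM x y : x \is a GRing.unit -> y \is a GRing.unit -> chi (x * y) = chi x * chi y.
Proof.
move=> ux uy; have [[_ LM _] _] := Lambda_unr.
have [ucx ucy] : conj x \is a GRing.unit /\ conj y \is a GRing.unit by rewrite !(conj_unit ib).
rewrite !chiE ?unitrM ?ux // rmorphM /= LM // chi0_mul // !invfM; ring.
Qed.

(** The factor in the definition of [induced], regarded as a representation of the group P on V. *)
Definition rho p w := (cpow (abs_lf v R (normL conj (zof p) * (mu1 conj (bof p))^-1)) (3 * (s + 2^-1))
  * chi (zof p)) *: chi0tau (bof p) w.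

Lemma rho_linear p a w w' : Q p -> rho p (a *: w + w') = a *: rho p w + rho p w'.
Proof.
move=> hQ; rewrite /rho (chi0tau_linear _ _ _ (bof_G1 cK hQ)).
by rewrite scalerDr !scalerA [a * _]mulrC.
Qed.

Lemma rhoM p p' w : Q p -> Q p' -> rho (p *m p') w = rho p (rho p' w).
Proof.
move=> hQ hQ'; have [_ ez eb] := QM cK hQ hQ'.
have [mu [mu0 e _ _ [u0 _]]] := Q_rel cK hQ; have [mu' [mu0' e' _ _ [u0' _]]] := Q_rel cK hQ'.
have hQQ : Q (p *m p') by case: (QM cK hQ hQ').
have m := mu1E (bof_rel hQ e); have m' := mu1E (bof_rel hQ' e').
have mm := mu1E (bof_rel hQQ (similM e e')).
have zl a w1 := chi0tau_linear a w1 0 (bof_G1 cK hQ).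
have z0 : chi0tau (bof p) 0 = 0.
  by have := zl 1 0; rewrite !scale1r addr0 => h; apply: (addrI (chi0tau (bof p) 0)); rewrite addr0 -h.
have tZ a w' : chi0tau (bof p) (a *: w') = a *: chi0tau (bof p) w'.
  by have := zl a w'; rewrite z0 !addr0.
rewrite /rho mm m m' ez eb !(normLE ib) (chi0tauM _ (bof_G1 cK hQ) (bof_G1 cK hQ')).
rewrite tZ scalerA chiM // (nrmM ib); congr (_ *: _).
have n0 : nrm ib (zof p) != 0 by rewrite -(unitL ib).
have n0' : nrm ib (zof p') != 0 by rewrite -(unitL ib).
have -> : nrm ib (zof p) * nrm ib (zof p') * (mu * mu')^-1 =
    (nrm ib (zof p) * mu^-1) * (nrm ib (zof p') * mu'^-1) by rewrite invfM; ring.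
rewrite abs_lfM ?mulf_neq0 ?invr_eq0 // cpowM ?abs_lf_gt0 ?mulf_neq0 ?invr_eq0 //; ring.
Qed.

(* The modulus character and Lambda are trivial on compact subgroups. *)
Lemma rho_compact p mu w : Q p -> simil conj p mu -> lunit ib (zof p) -> vunit v mu ->
  rho p w = (chi0 (conj (zof p)))^-1 *: chi0tau (bof p) w.
Proof.
move=> hQ e hz hmu; have [_ LU] := Lambda_unr.
have uz := lunit_unit hz; have ucz : conj (zof p) \is a GRing.unit by rewrite (conj_unit ib).
rewrite /rho (mu1E (bof_rel hQ e)) (normLE ib) abs_lf_unit ?cpow1 ?mul1r.
  rewrite chiE // LU ?invr1 ?mul1r //.
  by apply/(oL_unitE ib); rewrite lunit_conj.
by apply: vunitM; [case/andP: hz|exact: vunitV].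
Qed.

Lemma rho1 w : rho 1%:M w = w.
Proof.
have [hQ ez eb] := Q1 conj.
rewrite (rho_compact w hQ (simil1 conj)) ?ez ?lunit1 ?vunit1 // rmorph1 chi0_1 invr1 scale1r eb.
have -> : 1%:M = 1 *: embed L 1%:M :> 'M[L]_2 by rewrite scale1r /embed map_mx1.
by rewrite chi0tauE ?unitr1 ?unitmx1 // chi0_1 scale1r tau1.
Qed.

(** [Q_form] and [CC_decomposition] pass from separate factors to the groups P and K^H Gamma(P^r).
    Smoothness comes for free from invariance under Gamma(P^r). *)
Lemma invariantsP (f : G2 conj -> V) : invariants v s chi chi0 tau r f <->
  forall (g g' : G2 conj) p c, Q p -> CC c -> sval g' = p *m sval g *m c -> f g' = rho p (f g).
Proof.
split=> [[[_ hind] hinv] g g' p c hQ hC e|h].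
  have hpg : inG2 (p *m sval g) by apply: inG2M (svalP g); case: hQ.
  have [k [u [hk hu ec]]] := CC_decomposition hC.
  rewrite (hinv (exist _ (p *m sval g) hpg) g' k u) //=; last by rewrite e ec.
  have [u' [hu' ep]] := Q_form cK conj_fixed hQ; have [_ [_ _ _ _ [uz _]]] := Q_rel cK hQ.
  by rewrite (hind (zof p) (bof p) u' g _ uz (bof_G1 cK hQ) hu') //= -ep.
split; last first.
  move=> g g' k u hk hu e; rewrite -[RHS]rho1; apply: (h g g' 1%:M (k *m u)).
  - by case: (Q1 conj).
  - by apply: CCM; [exact: CC_KH|exact: CC_Gamma].
  - by rewrite e mul1mx.
split.
  move=> g; exists r => g' [u hu e]; rewrite -[RHS]rho1; apply: (h g g' 1%:M u).
  - by case: (Q1 conj).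
  - exact: CC_Gamma.
  - by rewrite e mul1mx.
move=> z b u g g' uz hb hu e; have [hQ ez eb] := Q_m1m2u cK uz hb hu.
have := h g g' _ 1%:M hQ (CC1 ib r); rewrite mulmx1 => /(_ e) ->.
by rewrite /rho ez eb.
Qed.

Variable n : nat.
Hypothesis chi0_n : forall x, oL_unit_cong v n x -> chi0 x = 1.
Local Notation eta m := (eta_mx conj (xm v al m)).
Local Notation VK k := (fixed_by tau (K1 v k)).
Local Notation inv := (invariants v (conj := conj) s chi chi0 tau r).

Lemma rho0 p : Q p -> rho p 0 = 0.
Proof. by move=> hQ; have := rho_linear (-1) 0 0 hQ; rewrite scaler0 addr0 scaleN1r addNr. Qed.

(** By the choice of chi, rho(p) is chi_0(l / conj zeta) tau(g) with l and g from [stabilizer]. The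
    scalar is 1 because l / conj zeta lies in 1 + P^(r - m) and r - m >= n; tau(g) fixes w. *)
Lemma rho_fix p c m w : (m <= r)%N -> (n <= r - m)%N -> Q p -> CC c -> p *m eta m = eta m *m c ->
  VK (r - m) w -> rho p w = w.
Proof.
move=> hm hn hQ hC e hw; have [l [g [eb hl hg hl1]]] := stabilizer hm hQ hC e.
have [hz _] := rel_lunit hQ hC e; have [/inG2P[mu mu0 es] _] := hQ.
have hmu := GLoL_simil ib mu0 es (rel_GLoL hC e).
have ucz : lunit ib (conj (zof p)) by rewrite lunit_conj.
have [[ug _ _] _ _] := hg; have uz := lunit_unit ucz.
rewrite (rho_compact w hQ es hz hmu) eb chi0tauE ?(lunit_unit hl) // (hw g hg) scalerA.
rewrite -{1}[l](divrK uz) chi0_mul ?unitrM ?unitrV ?(lunit_unit hl) // mulrCA mulVf ?(chi0_neq0) // mulr1.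
rewrite chi0_n ?scale1r //; split; first by apply/(oL_unitE ib)/lunitM => //; exact: lunitV.
by apply/(PLpowE ib); apply: lvalW hl1; rewrite lez_nat.
Qed.

Lemma rho_K1 m (g : 'M[F]_2) w : (m <= r)%N -> K1 v (r - m) g ->
  exists p c, [/\ Q p, CC c, p *m eta m = eta m *m c & rho p w = tau g w].
Proof.
move=> hm hg; have [p [c [hQ hC e [ez eb] [es hmu]]]] := stabilizer_converse ib hm hg.
exists p, c; split=> //; have [[ug _ _] _ _] := hg.
rewrite (rho_compact w hQ es _ hmu) ez ?lunit1 // rmorph1 (chi0_1) invr1 scale1r eb.
by rewrite -[embed L g]scale1r chi0tauE ?unitr1 // (chi0_1) scale1r.
Qed.

Definition etaG (m : nat) : G2 conj := exist _ (eta m) (inG2_eta cK _).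

(** With p and c from [rho_K1], tau(g) f(eta_m) = rho(p) f(eta_m) = f(p eta_m c^(-1)) = f(eta_m). *)
Lemma invariant_fixed f m : (m <= r)%N -> inv f -> VK (r - m) (f (etaG m)).
Proof.
move=> hm /invariantsP hf g hg; have [p [c [hQ hC e <-]]] := rho_K1 (f (etaG m)) hm hg.
have [[uc _] _ _] := hC.
by apply/esym/(hf _ _ p (invmx c) hQ (CCV hC)); rewrite /= e mulmxK.
Qed.

Lemma invariant_ext f f' : inv f -> inv f' ->
  (forall m, (m <= r)%N -> f (etaG m) = f' (etaG m)) -> f = f'.
Proof.
move=> /invariantsP hf /invariantsP hf' h; apply/funext => g.
have [m [p [c [hm hQ hC e]]]] := double_coset_decomposition ib r (svalP g).
by rewrite (hf (etaG m) g p c) // (hf' (etaG m) g p c) // h.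
Qed.

Lemma invariant_linear a f f' : inv f -> inv f' -> inv (a *: f + f').
Proof.
move=> /invariantsP hf /invariantsP hf'; apply/invariantsP => g g' p c hQ hC e.
rewrite /= -[LHS]/(a *: f g' + f' g') -[(a *: f + f') g]/(a *: f g + f' g) rho_linear //.
by rewrite (hf g g' p c) // (hf' g g' p c).
Qed.

Lemma invariant0 : inv 0.
Proof. by apply/invariantsP => g g' p c hQ hC e; rewrite rho0. Qed.

Lemma invariant_sum (T : finType) (c : T -> R[i]) (f : T -> G2 conj -> V) :
  (forall x, inv (f x)) -> inv (\sum_x c x *: f x).
Proof.
move=> h; elim/big_ind: _ => [|f1 f2 h1 h2|x _]; first exact: invariant0.
  by rewrite -[f1]scale1r; exact: invariant_linear.
by rewrite -[_ *: _]addr0; apply: invariant_linear => //; exact: invariant0.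
Qed.

(* The invariant function supported on P eta_m K^H Gamma(P^r) with value w at eta_m. *)
Definition coset_fun m w (g : G2 conj) : V :=
  xget 0 [set w' | exists p c, [/\ Q p, CC c, sval g = p *m eta m *m c & w' = rho p w]]%classic.

(** The value does not depend on the factorization: if p eta_m c = p' eta_m c', then p^(-1) p'
    belongs to the stabilizer of eta_m and fixes w by [rho_fix]. *)
Lemma coset_funE m w p c (g : G2 conj) : (m <= r)%N -> (n <= r - m)%N -> VK (r - m) w ->
  Q p -> CC c -> sval g = p *m eta m *m c -> coset_fun m w g = rho p w.
Proof.
move=> hm hn hw hQ hC e; rewrite /coset_fun; case: xgetP => [w' _ [p' [c' [hQ' hC' e' ->]]]|h].
  have up := inG2_unit hQ.1; have [[uc _] _ _] := hC.
  have hV := QV cK hQ; have [hQQ _ _] := QM cK hV hQ'.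
  have {hQQ} fixp : rho (invmx p *m p') w = w.
    apply: (rho_fix hm hn hQQ (CCM hC (CCV hC')) _ hw); have [[uc' _] _ _] := hC'.
    apply: (can_inj (mulmxK uc')); rewrite -!mulmxA mulVmx // mulmx1 [p' *m _]mulmxA -e' e.
    by rewrite !mulmxA mulVmx // mul1mx.
  have -> : p' = p *m (invmx p *m p') by rewrite mulKVmx.
  by rewrite rhoM // ?fixp //; case: (QM cK hV hQ').
by case: (h (rho p w)); exists p, c.
Qed.

Lemma coset_fun_eq0 m m' w p c (g : G2 conj) : (m <= r)%N -> (m' <= r)%N -> m != m' ->
  Q p -> CC c -> sval g = p *m eta m' *m c -> coset_fun m w g = 0.
Proof.
move=> hm hm' mm hQ hC e; rewrite /coset_fun; case: xgetP => // w' _ [p' [c' [hQ' hC' e' _]]].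
have up := inG2_unit hQ.1; have [[uc' _] _ _] := hC'.
have [hQQ _ _] := QM cK (QV cK hQ) hQ'.
case/eqP: mm; apply: (rel_eq hm hm' hQQ (CCM hC (CCV hC'))).
apply: (can_inj (mulmxK uc')); rewrite -!mulmxA mulVmx // mulmx1 [p' *m _]mulmxA -e' e.
by rewrite !mulmxA mulVmx // mul1mx.
Qed.

Lemma coset_fun_inv m w : (m <= r)%N -> (n <= r - m)%N -> VK (r - m) w -> inv (coset_fun m w).
Proof.
move=> hm hn hw; apply/invariantsP => g g' q c0 hq hc0 eg.
have [m' [p [c [hm' hQ hC e]]]] := double_coset_decomposition ib r (svalP g).
have [hqp _ _] := QM cK hq hQ; have hcc := CCM hC hc0.
have e' : sval g' = q *m p *m eta m' *m (c *m c0) by rewrite eg e !mulmxA.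
have [em|nm] := eqVneq m m'.
  rewrite -em in e e'; rewrite (coset_funE hm hn hw hqp hcc e') (coset_funE hm hn hw hQ hC e).
  exact: rhoM.
by rewrite (coset_fun_eq0 w hm hm' nm hqp hcc e') (coset_fun_eq0 w hm hm' nm hQ hC e) rho0.
Qed.

Lemma coset_fun_eta m m' w : (m <= r)%N -> (n <= r - m)%N -> (m' <= r)%N -> VK (r - m) w ->
  coset_fun m w (etaG m') = if m == m' then w else 0.
Proof.
move=> hm hn hm' hw; have [hQ1 _ _] := Q1 conj.
have e : sval (etaG m') = 1%:M *m eta m' *m 1%:M by rewrite mul1mx mulmx1.
case: eqVneq => [em|nm]; last exact: coset_fun_eq0 hm hm' nm hQ1 (CC1 ib r) e.
by rewrite -em in e *; rewrite (coset_funE hm hn hw hQ1 (CC1 ib r) e) rho1.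
Qed.

Hypothesis K1_dim : forall k, has_dim (VK k) (k.+1 - n).

Lemma invariants_dim : has_dim inv (\sum_(m < r.+1) ((r - m).+1 - n)).
Proof.
pose e (m : 'I_r.+1) := projT1 (cid (K1_dim (r - m))).
have he (m : 'I_r.+1) : (forall c, \sum_i c i *: e m i = 0 -> forall i, c i = 0) /\
    (forall w, VK (r - m) w <-> exists c, w = \sum_i c i *: e m i) := projT2 (cid (K1_dim (r - m))).
(* The basis is indexed by pairs of a double coset m and a basis vector of V^K1(p^(r - m)). *)
pose T := {m : 'I_r.+1 & 'I_((r - m).+1 - n)}.
pose TG (m : 'I_r.+1) i : T := existT _ m i.
have -> : (\sum_(m < r.+1) ((r - m).+1 - n))%N = #|{: T}|.
  rewrite card_tagged sumnE big_map enumT -/(index_enum _).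
  by apply: eq_bigr => m _; rewrite card_ord.
have fixe (m : 'I_r.+1) i : VK (r - m) (e m i).
  apply/(he m).2; exists (fun i' => (i' == i)%:R); rewrite (bigD1 i) //= eqxx scale1r big1 ?addr0 //.
  by move=> i' /negbTE ->; rewrite scale0r.
(* By truncated subtraction an index i exists only if r - m >= n, which is the condition for the
   function supported on that double coset to be well defined. *)
have hn (m : 'I_r.+1) (i : 'I_((r - m).+1 - n)) : (n <= r - m)%N by case: i => i; lia.
have hm (m : 'I_r.+1) : (m <= r)%N by rewrite -ltnS.
pose E (x : T) := coset_fun (tag x) (e (tag x) (tagged x)).
have invE x : inv (E x) by exact: coset_fun_inv (hm _) (hn _ (tagged x)) (fixe _ _).
have evalE (c : T -> R[i]) (m : 'I_r.+1) :
    (\sum_x c x *: E x) (etaG m) = \sum_i c (TG m i) *: e m i.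
  have -> : (\sum_x c x *: E x) (etaG m) = \sum_x c x *: E x (etaG m).
    by elim/big_ind2: _ => // f1 a1 f2 a2 <- <-.
  rewrite (eq_bigr (fun x : T => c (TG (tag x) (tagged x)) *: (if tag x == m then e (tag x) (tagged x) else 0))).
    rewrite -(sig_big_dep (J := fun m : 'I_r.+1 => 'I_((r - m).+1 - n)) xpredT (fun=> xpredT) (fun m' i => c (TG m' i) *: (if m' == m then e m' i else 0))) /=.
    rewrite (bigD1 m) //= [X in _ + X]big1 ?addr0 => [|m' /negbTE ->]; first by rewrite eqxx.
    by rewrite big1 // => i _; rewrite scaler0.
  by move=> [m' i] _ /=; rewrite /E /= (coset_fun_eta (hm m') (hn _ i) (hm m)).
apply: (has_dim_fin (e := E)) => [c hc [m i]|w].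
  by apply: ((he m).1 (fun i' => c (TG m i'))); rewrite -evalE hc.
split=> [hw|[c ->]]; last exact: invariant_sum.
have hw' (m : 'I_r.+1) : exists c, w (etaG m) = \sum_i c i *: e m i.
  by apply/(he m).2; exact: invariant_fixed.
pose c m := projT1 (cid (hw' m)).
have hc (m : 'I_r.+1) : w (etaG m) = \sum_i c m i *: e m i := projT2 (cid (hw' m)).
pose d (x : T) := c (tag x) (tagged x); exists d.
apply: invariant_ext => // [|m hmr]; first exact: (invariant_sum d invE).
by rewrite -[m]/(nat_of_ord (Ordinal (hmr : (m < r.+1)%N))) evalE; exact: hc.
Qed.

End InducedRep.

Theorem theorem1p2p3 (R : realType)
  (F : fieldType) (v : local_field F) (charF : [pchar F] =i pred0)
  (L : comUnitAlgType F) (conj : {lrmorphism L -> L})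
  (quadL : quadratic_algebra conj)
  (V : lmodType R[i]) (tau : 'M[F]_2 -> {linear V -> V})
  (tau_rep : is_rep tau) (tau_adm : admissible v tau)
  (tau_irr : irreducible_rep tau) (tau_gen : generic v tau)
  (omega : F -> R[i]) (tau_omega : central_character tau omega)
  (n : nat) (tau_n : has_conductor v tau n)
  (chi0 : L -> R[i]) (chi0_char : is_character v chi0)
  (chi0_omega : forall a : F, a != 0 -> chi0 a%:A = omega a)
  (chi0_n : forall x, oL_unit_cong v n x -> chi0 x = 1)
  (Lambda : L -> R[i]) (Lambda_unr : unramified_character v Lambda)
  (chi : L -> R[i])
  (chiE : forall z, z \is a GRing.unit ->
     chi z = (Lambda (conj z))^-1 * (chi0 (conj z))^-1)
  (s : R[i]) (r : nat) :
  ((n <= r)%N ->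
     has_dim (invariants v (conj := conj) s chi chi0 tau r)
             (((r - n + 1) * (r - n + 2)) %/ 2)%N) /\
  ((r < n)%N -> has_dim (invariants v (conj := conj) s chi chi0 tau r) 0).
Proof.
have [al [t [nu ib]]] := integral_basisP v charF quadL.
have H := invariants_dim ib tau_rep tau_omega chi0_char chi0_omega Lambda_unr chiE s r chi0_n
  (fun k => K1_dim tau_rep tau_adm tau_irr tau_gen k tau_n).
rewrite card_triangle in H.
by split=> hr; move: H; [rewrite hr | rewrite leqNgt hr].
Qed.
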